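(* Let $p\ge 1$, $k\ge 1$ be integers and $m>0$. Consider equivariant estimators $\delta_h(X,S^2)=h(T)X$, $T=\|X\|^2/S^2$, for estimating $\theta$ in the model $X\sim N_p(\theta,\sigma^2 I_p)$, $S^2\sim\sigma^2\chi^2_k$, independent, under the loss $\|d-\theta\|^2/\sigma^2$ and with parameter space $\Theta(m)=\{(\theta,\sigma)\in\mathbb{R}^p\times(0,\infty): \|\theta\|/\sigma\le m\}$. Let $h(m,0,t)$ be the function defined in the context. (a) A sufficient condition for $\delta_{h_2}$ to dominate $\delta_{h_1}$ ($\delta_{h_2}\neq\delta_{h_1}$) is that $h_1(t)\ge h_2(t)$ and $\frac{h_2(t)+h_1(t)}{2}\ge h(m,0,t)$ for all $t>0$. (b) Let $S=\{t: h_1(t)>h(m,0,t)\}$, and let $\underline{S}$ be a (not necessarily strict) subset of the set $S$ such that $\nu(\underline{S})>0$, where $\nu$ is the Lebesgue measure on $\mathbb{R}$. Then $\delta_{h_1}$ is inadmissible, and is dominated by $\delta_h$ with $h(t)=\min\{h_1(t),h(m,0,t)\}$, as well as by any $\delta_h$ with $h(t)=h_1(t)\,1_{\underline{S}^c}(t)+h^*(t)\,1_{\underline{S}}(t)$, where $2h(m,0,t)-h_1(t)\le h^*(t)\le h_1(t)$ for all $t\in\underline{S}$. (c) If $h_1(t)\ge h(m,0,t)$ for all $t\ge 0$ and $h_1(\cdot)\ne h(m,0,\cdot)$, then the boundary uniform Bayes estimator $\delta_{BU,0}(X,S^2)=h(m,0,T)X$ dominates $\delta_{h_1}$.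
   Context: Here $h$ (and $h_1$, $h_2$) denote measurable functions. The risk of $\delta_h$ is $\frac{1}{\sigma^2}E_{\theta,\sigma}\|h(T)X-\theta\|^2$, which depends on $(\theta,\sigma)$ only through $\lambda=\|\theta\|/\sigma\in[0,m]$; denote it $R(\lambda,\delta_h)$. An estimator $\delta_2$ dominates $\delta_1$ if $R(\lambda,\delta_2)\le R(\lambda,\delta_1)$ for all $\lambda\in[0,m]$ with strict inequality for some $\lambda\in[0,m]$; $\delta_1$ is inadmissible if some estimator dominates it. The function $h(m,0,\cdot)$ is $$h(m,0,t)=\frac{m^2}{p}\,\frac{F\left(\frac{k+p}{2}+1,\frac p2+1,\frac{m^2t}{2(1+t)}\right)}{F\left(\frac{k+p}{2}+1,\frac p2,\frac{m^2t}{2(1+t)}\right)},$$ where $F(a,b,z)=\sum_{i\ge0}\frac{(a)_i}{(b)_i}\frac{z^i}{i!}$, $(c)_0=1$, $(c)_i=\prod_{j=0}^{i-1}(c+j)$, is the confluent hypergeometric function. The estimator $\delta_{BU,0}$ is the Bayes estimator for the prior under which $\theta|\sigma^2$ is uniform on the sphere of radius $m\sigma$ centered at the origin and $\sigma^2$ has the improper density $(\sigma^2)^{-1}$.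
   Formalization: In (a) and for the two families in (b), the dominating estimator is assumed not to have risk identically infinite on Θ(m); the last family in (b) also needs δ_h ≠ δ_{h1}; ''≠'' in (a), (b), (c) is read up to null sets. The literal claim fails otherwise. *)

(* Defs.v *)
From HB Require Import structures.
From mathcomp Require Import all_boot all_order all_algebra.
From mathcomp Require Import all_classical all_reals all_analysis.
From mathcomp Require Import measurable_realfun.

Set Implicit Arguments.
Unset Strict Implicit.
Unset Printing Implicit Defensive.

Import Order.TTheory GRing.Theory Num.Theory.
Import numFieldNormedType.Exports.

Local Open Scope classical_set_scope.
Local Open Scope ring_scope.

(* The norm of R^p is spelled out because the library norm on vectors is the
   sup norm. *)
Definition sqnorm (R : realType) (p : nat) (x : p.-tuple R) : R :=
  \sum_(i < p) tnth x i ^+ 2.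

Definition enorm (R : realType) (p : nat) (x : p.-tuple R) : R :=
  Num.sqrt (sqnorm x).

Definition sqdist (R : realType) (p : nat) (x y : p.-tuple R) : R :=
  sqnorm [tuple tnth x i - tnth y i | i < p].

Section laws.
Context {R : realType}.

(* Lebesgue measure and normal_prob live on measurableTypeR R, which is R with
   the same Borel sets but another measure display. *)
Definition tcons (p : nat) (x : measurableTypeR R * p.-tuple R) :
    p.+1.-tuple R :=
  [tuple of x.1 :: x.2].

Lemma measurable_tcons p :
  measurable_fun [set: measurableTypeR R * p.-tuple R] (@tcons p).
Proof. exact: (@measurable_cons _ _ _ _ (fst : _ -> R)). Qed.

HB.instance Definition _ p :=
  isMeasurableFun.Build _ _ _ _ (@tcons p) (@measurable_tcons p).

Lemma measurable_sqnorm p : measurable_fun [set: p.-tuple R] (@sqnorm R p).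
Proof.
apply: measurable_sum => i; apply: measurable_funX.
exact: measurable_tnth.
Qed.

HB.instance Definition _ p :=
  isMeasurableFun.Build _ _ _ _ (@sqnorm R p) (@measurable_sqnorm p).

Definition scale (c x : R) : R := c * x.

Lemma measurable_scale c : measurable_fun [set: R] (scale c).
Proof. exact: measurable_funM. Qed.

HB.instance Definition _ c :=
  isMeasurableFun.Build _ _ _ _ (scale c) (measurable_scale c).

(* N_p(theta, sigma^2 I_p): the product of the N(theta_i, sigma^2). The second
   argument of normal_prob is the standard deviation. *)
Fixpoint mvnormal (p : nat) (sigma : R) :
    p.-tuple R -> probability (p.-tuple R) R :=
  match p with
  | 0 => fun _ => dirac [tuple]
  | p'.+1 => fun theta =>
      distribution
        (normal_prob (thead theta) sigma \x
         @mvnormal p' sigma [tuple of behead theta])%E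
        (@tcons p')
  end.

(* chi^2_k: the law of the sum of the squares of k independent N(0, 1). *)
Definition chi_squared (k : nat) : probability R R :=
  distribution (mvnormal 1 [tuple of nseq k 0]) (@sqnorm R k).

(* The joint law of (X, S^2). *)
Definition model (p k : nat) (theta : p.-tuple R) (sigma : R) :
    probability (p.-tuple R * R)%type R :=
  (mvnormal sigma theta \x
   distribution (chi_squared k) (scale (sigma ^+ 2)))%E.

End laws.

Section decision.
Context {R : realType} {p : nat}.

(* An estimator maps the observation (X, S^2) to R^p. *)
Definition estimator := p.-tuple R * R -> p.-tuple R.

Definition delta (h : R -> R) : estimator :=
  fun w => [tuple h (sqnorm w.1 / w.2) * tnth w.1 i | i < p].

Definition risk (k : nat) (theta : p.-tuple R) (sigma : R) (d : estimator) :
    \bar R :=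
  ((sigma ^- 2)%:E *
   'E_(model k theta sigma)[(fun w => sqdist (d w) theta)])%E.

Definition Theta (m : R) (theta : p.-tuple R) (sigma : R) : Prop :=
  0 < sigma /\ enorm theta / sigma <= m.

Definition at_lambda (lambda : R) (theta : p.-tuple R) (sigma : R) : Prop :=
  0 < sigma /\ enorm theta / sigma = lambda.

(* Comparing R(lambda, d2) with R(lambda, d1) means comparing the risks at every
   (theta, sigma) such that ||theta|| / sigma = lambda. *)
Definition dominates (k : nat) (m : R) (d2 d1 : estimator) : Prop :=
  (forall lambda, 0 <= lambda <= m -> forall theta sigma,
     at_lambda lambda theta sigma ->
     (risk k theta sigma d2 <= risk k theta sigma d1)%E) /\
  (exists2 lambda, 0 <= lambda <= m & forall theta sigma,
     at_lambda lambda theta sigma ->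
     (risk k theta sigma d2 < risk k theta sigma d1)%E).

(* Inadmissibility within the class of equivariant estimators, hence among all
   estimators. *)
Definition inadmissible (k : nat) (m : R) (d1 : estimator) : Prop :=
  exists2 h : R -> R, measurable_fun [set: R] h & dominates k m (delta h) d1.

(* Estimators are identified when they agree almost surely for every parameter
   in Theta(m). *)
Definition distinct (k : nat) (m : R) (d1 d2 : estimator) : Prop :=
  exists theta, exists2 sigma, Theta m theta sigma &
    ~ {ae model k theta sigma, forall w, d1 w = d2 w}.

(* The loss is unbounded, so a risk can be +oo. Nothing with risk identically
   +oo on Theta(m) dominates anything. *)
Definition risk_not_identically_infinite (k : nat) (m : R) (d : estimator) :
    Prop :=
  exists theta, exists2 sigma, Theta m theta sigma &
    (risk k theta sigma d < +oo)%E.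

End decision.

Arguments estimator : clear implicits.
Arguments delta {R} p h _.

Section bayes.
Context {R : realType}.

Definition pochhammer (c : R) (i : nat) : R := \prod_(j < i) (c + j%:R).

Definition hyp1F1 (a b z : R) : R :=
  limn (series (fun i => pochhammer a i / pochhammer b i * (z ^+ i / i`!%:R))).

(* h(m, 0, t) *)
Definition hBU (p k : nat) (m t : R) : R :=
  let a := (k%:R + p%:R) / 2 + 1 in
  let z := m ^+ 2 * t / (2 * (1 + t)) in
  m ^+ 2 / p%:R * (hyp1F1 a (p%:R / 2 + 1) z / hyp1F1 a (p%:R / 2) z).

End bayes.

(* Main.v *)
Require Import Defs.
From HB Require Import structures.
From mathcomp Require Import all_boot all_order all_algebra.
From mathcomp Require Import all_classical all_reals all_analysis.
From mathcomp Require Import measurable_realfun.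
From mathcomp Require Import ring lra.

(** Rescaling by sigma reduces everything to eta = theta / sigma, and the
    exponential tilt together with the symmetry x -> -x turns the risk into an
    integral against standard Gaussians (X, Z) in R^p x R^k, with S^2 = |Z|^2, of
    (h(T)^2 |X|^2 + |eta|^2) cosh(eta.X) - 2 h(T) (eta.X) sinh(eta.X).
    The difference of the risks of h1 and h2 then has the sign of the mean of
    (h1 - h2)((h1 + h2) |X|^2 cosh(eta.X) - 2 (eta.X) sinh(eta.X)), so it suffices
    that, for every g >= 0,
    E[g(T) (eta.X) sinh(eta.X)] <= E[g(T) h(m,0,T) |X|^2 cosh(eta.X)].
    Both sides are expanded in powers of eta.X.  Scaling the Gaussian integrals
    shows that for H homogeneous of degree 2j the mean of H(X) g(T) is E[H(X)]
    times the mean of g(T) u^j divided by E[u^j], where u = T / (1 + T); this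
    produces the two confluent hypergeometric series at |eta|^2 u / 2, and the
    inequality is the monotonicity of z F(a, b + 1, z) / F(a, b, z) in z.
    The strict inequality is obtained at eta = 0, where the sinh term vanishes. *)

Set Implicit Arguments.
Unset Strict Implicit.
Unset Printing Implicit Defensive.

Import Order.TTheory GRing.Theory Num.Theory.
Import numFieldNormedType.Exports.

Local Open Scope classical_set_scope.
Local Open Scope ring_scope.

(** * Affine changes of variable for Lebesgue measure and the normal law on the line *)

Section gaussian_line.
Context {R : realType}.
Local Notation mu := (@lebesgue_measure R).

(** No spherical integration enters: the Gaussian facts come from one-dimensional affine changes of
    variable, iterated over the coordinates. The weight exp(|x|^2/2) turns the Gaussian law into a
    multiple of Lebesgue measure, so a dilation by c costs only c^n. Letting c tend to 1 yields the
    moment recursions, and dilations that depend on the other variable decouple X from T. The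
    moments of eta.X are read off the expansion of exp(y |eta|^2/2) in y. Against functions of T,
    each power of eta.X may be replaced by its conditional mean given T; the comparison then becomes
    pointwise in T, between radius lambda and the boundary radius m. Risks may be infinite, so they
    are never subtracted: their difference is stated as an identity between sums of nonnegative
    integrals. The assumptions on h1 and h2 concern t > 0 only, hence truncations at 0 that keep the
    integrands nonnegative everywhere. Where the hypotheses are phrased with Lebesgue measure,
    strictness needs Lebesgue measure compared with the law of T; this is done by dilating T,
    without computing its density. *)

Let affine (c b x : R) : measurableTypeR R := c * x + b.

Let measurable_affine c b : measurable_fun [set: measurableTypeR R] (affine c b).
Proof. by apply: measurable_funD => //; exact: measurable_funM. Qed.

Let lebesgue_measure_affine (c b : R) (A : set R) : c != 0 -> measurable A ->
  (mu A = `|c|%:E * pushforward mu (affine c b) A)%E.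
Proof.
move=> c0 mA.
pose f : {mfun measurableTypeR R >-> measurableTypeR R} :=
  HB.pack (affine c b) (isMeasurableFun.Build _ _ _ _ _ (measurable_affine c b)).
have nc : 0 <= `|c| by [].
rewrite (lebesgue_measure_unique (mu := mscale (NngNum nc) (pushforward mu f)))//.
move=> _ [[x y]] /= xy <-; rewrite /mscale/= /pushforward.
have [cp|cn] := ltP 0 c.
  rewrite (_ : _ @^-1` _ = `](x - b) / c, (y - b) / c]%classic); last first.
    apply/seteqP; split=> t; rewrite /= !in_itv/= /affine ltr_pdivrMr// ler_pdivlMr//;
      by move=> /andP[*]; apply/andP; split; lra.
  rewrite !lebesgue_measure_itv/= !lte_fin ltr_pM2r ?invr_gt0// ltrD2r.
  case: ifPn => _; last by rewrite mule0.
  rewrite -!EFinB -EFinM gtr0_norm//; congr EFin; by field.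
(* A negative slope reverses the preimage of []x, y]] into an interval closed on the left and open
   on the right, of the expected length. *)
have {}cn : c < 0 by rewrite lt_neqAle c0.
rewrite (_ : _ @^-1` _ = `[(y - b) / c, (x - b) / c[%classic); last first.
  apply/seteqP; split=> t; rewrite /= !in_itv/= /affine ltr_ndivlMr// ler_ndivrMr//;
    by move=> /andP[*]; apply/andP; split; lra.
rewrite !lebesgue_measure_itv/= !lte_fin ltr_nM2r ?invr_lt0// ltrD2r.
case: ifPn => _; last by rewrite mule0.
rewrite -!EFinB -EFinM ltr0_norm//; congr EFin; by field.
Qed.

Lemma ge0_integral_lebesgue_affine (c b : R) (f : R -> \bar R) : c != 0 ->
  measurable_fun [set: R] f -> (forall x, 0 <= f x)%E ->
  (\int[mu]_x f x = `|c|%:E * \int[mu]_x f (c * x + b)%R)%E.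
Proof.
move=> c0 mf f0.
pose g : {mfun measurableTypeR R >-> measurableTypeR R} :=
  HB.pack (affine c b) (isMeasurableFun.Build _ _ _ _ _ (measurable_affine c b)).
have nc : 0 <= `|c| by [].
have [nu nuE] : exists nu : {measure set (measurableTypeR R) -> \bar R},
    nu = pushforward mu g :> (_ -> _).
  by eexists (@measure_function_pushforward__canonical__measure_function_Measure
    _ _ _ _ _ mu g (measurable_affine c b)).
transitivity (\int[mscale (NngNum nc) nu]_x f x)%E.
  apply: eq_measure_integral => A mA _.
  transitivity (`|c|%:E * pushforward mu (affine c b) A)%E.
    exact: lebesgue_measure_affine.
  by rewrite /mscale /=; congr (_ * _)%E; have /(congr1 (@^~ A)) := nuE.
rewrite ge0_integral_mscale//=; congr (_ * _)%E.
transitivity (\int[pushforward mu g]_x f x)%E; first by rewrite -nuE.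
by rewrite (@ge0_integral_pushforward _ _ _ _ _ _ (measurable_affine c b)).
Qed.

(** The Radon-Nikodym derivative of the normal law and [normal_pdf] have the same integral over
    every measurable set, hence agree almost everywhere. *)
Lemma ge0_integral_normal_prob (theta sigma : R) (f : R -> \bar R) :
  measurable_fun [set: R] f -> (forall x, 0 <= f x)%E ->
  (\int[normal_prob theta sigma]_x f x =
   \int[mu]_x (f x * (normal_pdf theta sigma x)%:E))%E.
Proof.
move=> mf f0.
have dom := normal_prob_dominates theta sigma.
rewrite -(Radon_Nikodym_SigmaFinite.change_of_variables dom)//.
have fi := Radon_Nikodym_SigmaFinite.f_integrable dom.
have mp : measurable_fun setT (EFin \o normal_pdf theta sigma).
  by apply/measurable_EFinP; exact: measurable_normal_pdf.
apply: ge0_ae_eq_integral => //.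
- by apply: emeasurable_funM => //; exact: measurable_int fi.
- exact: emeasurable_funM.
- by move=> x _; rewrite mule_ge0// Radon_Nikodym_SigmaFinite.f_ge0.
- by move=> x _; rewrite mule_ge0// lee_fin normal_pdf_ge0.
apply: ae_eqe_mul2l.
apply: integral_ae_eq => // A _ mA.
by rewrite -Radon_Nikodym_SigmaFinite.f_integral.
Qed.

(** At sigma x, sigma times the density of N(theta, sigma^2) is the standard density times the tilt
    with parameter theta / sigma. *)
Lemma ge0_integral_normal_prob_std (theta sigma : R) (f : R -> \bar R) :
  0 < sigma -> measurable_fun [set: R] f -> (forall x, 0 <= f x)%E ->
  (\int[normal_prob theta sigma]_x f x =
   \int[normal_prob 0 1]_x (f (sigma * x)%R *
     (expR (theta / sigma * x - (theta / sigma) ^+ 2 / 2))%:E))%E.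
Proof.
move=> s0 mf f0; have sn0 : sigma != 0 by rewrite gt_eqF.
have mp t s : measurable_fun [set: R] (EFin \o normal_pdf t s).
  by apply/measurable_EFinP; exact: measurable_normal_pdf.
rewrite !ge0_integral_normal_prob//; last 2 first.
- apply: emeasurable_funM.
    by apply: measurableT_comp => //; exact: measurable_funM.
  apply/measurable_EFinP/measurableT_comp => //.
  by apply: measurable_funB => //; exact: measurable_funM.
- by move=> x; rewrite mule_ge0// lee_fin expR_ge0.
have mfp : measurable_fun [set: R]
  (fun y => f y * (normal_pdf theta sigma y)%:E)%E
  by exact: (emeasurable_funM mf (mp theta sigma)).
have fp0 x : (0 <= f x * (normal_pdf theta sigma x)%:E)%E.
  by rewrite mule_ge0// lee_fin normal_pdf_ge0.
rewrite (ge0_integral_lebesgue_affine 0 sn0)// -ge0_integralZl//; last first.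
  apply: (measurableT_comp mfp).
  by apply: measurable_funD => //; exact: measurable_funM.
apply: eq_integral => x _; rewrite addr0.
rewrite -muleA [LHS]muleCA; congr (_ * _)%E; rewrite -!EFinM; congr EFin.
rewrite !normal_pdfE// ?oner_eq0// /normal_peak /normal_fun expr1n mul1r subr0.
rewrite (gtr0_norm s0) -mulrnAr sqrtrM ?sqr_ge0// sqrtr_sqr gtr0_norm//.
rewrite invfM !mulrA divff// mul1r [in RHS]mulrAC [LHS]mulrC -expRD.
by congr (expR _ / _); field.
Qed.

(** The weight exp(x^2/2) cancels the density up to the constant [normal_peak 1], which leaves
    Lebesgue measure and its Jacobian |c|. *)
Lemma ge0_integral_normal_prob_scale (c : R) (f : R -> \bar R) : c != 0 ->
  measurable_fun [set: R] f -> (forall x, 0 <= f x)%E ->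
  (\int[normal_prob 0 1]_x (f x * (expR (x ^+ 2 / 2))%:E) =
   `|c|%:E * \int[normal_prob 0 1]_x (f (c * x)%R * (expR (x ^+ 2 / 2))%:E))%E.
Proof.
move=> c0 mf f0.
have me : measurable_fun [set: R] (fun x : R => (expR (x ^+ 2 / 2))%:E).
  by apply/measurable_EFinP/measurableT_comp => //; exact: measurable_funM.
have e (x : R) : expR (x ^+ 2 / 2) * normal_pdf 0 1 x = normal_peak 1.
  rewrite normal_pdfE ?oner_eq0// /normal_fun subr0 expr1n mulrCA -expRD.
  by rewrite mulNr -mulr_natr mul1r subrr expR0 mulr1.
have key (g : R -> \bar R) : measurable_fun [set: R] g -> (forall x, 0 <= g x)%E ->
    (\int[normal_prob 0 1]_x (g x * (expR (x ^+ 2 / 2))%:E) =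
     (normal_peak (1:R))%:E * \int[mu]_x g x)%E.
  move=> mg g0; rewrite ge0_integral_normal_prob//; last 2 first.
  - exact: emeasurable_funM.
  - by move=> x; rewrite mule_ge0// lee_fin expR_ge0.
  rewrite -ge0_integralZl// ?lee_fin ?normal_peak_ge0//.
  by apply: eq_integral => x _; rewrite -muleA -EFinM e muleC.
rewrite !key//; last by apply: measurableT_comp => //; exact: measurable_funM.
rewrite (ge0_integral_lebesgue_affine 0 c0)// muleCA; congr (_ * (_ * _))%E.
by apply: eq_integral => x _; rewrite addr0.
Qed.

End gaussian_line.

(** * Gaussian vectors: tilt and dilation in dimension n *)

Section vectors.
Context {R : realType}.

Definition dot n (a x : n.-tuple R) : R := \sum_(i < n) tnth a i * tnth x i.

Definition scalet n (c : R) (x : n.-tuple R) : n.-tuple R :=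
  [tuple c * tnth x i | i < n].

Definition std n : probability (n.-tuple R) R :=
  mvnormal 1 [tuple of nseq n 0].

Lemma measurable_dot n (a : n.-tuple R) : measurable_fun [set: n.-tuple R] (dot a).
Proof.
by apply: measurable_sum => i; apply: measurable_funM => //; exact: measurable_tnth.
Qed.

Lemma measurable_scalet n c : measurable_fun [set: n.-tuple R] (@scalet n c).
Proof.
apply/measurable_fun_tnthP => i; rewrite (_ : _ \o _ = fun x => c * tnth x i).
  by apply: measurable_funM => //; exact: measurable_tnth.
by apply/funext => x /=; rewrite tnth_mktuple.
Qed.

Lemma sqnorm_ge0 n (x : n.-tuple R) : 0 <= sqnorm x.
Proof. by apply: sumr_ge0 => i _; rewrite sqr_ge0. Qed.

Lemma sqnorm_scalet n c (x : n.-tuple R) : sqnorm (scalet c x) = c ^+ 2 * sqnorm x.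
Proof.
by rewrite /sqnorm mulr_sumr; apply: eq_bigr => i _; rewrite tnth_mktuple exprMn.
Qed.

Lemma dot_scaletr n c (a x : n.-tuple R) : dot a (scalet c x) = c * dot a x.
Proof.
by rewrite /dot mulr_sumr; apply: eq_bigr => i _; rewrite tnth_mktuple mulrCA.
Qed.

Lemma dot_scaletl n c (a x : n.-tuple R) : dot (scalet c a) x = c * dot a x.
Proof.
by rewrite /dot mulr_sumr; apply: eq_bigr => i _; rewrite tnth_mktuple mulrA.
Qed.

Lemma sqnorm_eq0 n (x : n.-tuple R) : sqnorm x = 0 -> forall i, tnth x i = 0.
Proof.
move=> /eqP; rewrite psumr_eq0 => [/allP h i|i _]; last exact: sqr_ge0.
by have := h i (mem_index_enum i); rewrite sqrf_eq0 => /eqP.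
Qed.

Lemma sqnorm_tcons n x (y : n.-tuple R) : sqnorm (tcons (x, y)) = x ^+ 2 + sqnorm y.
Proof.
rewrite /sqnorm big_ord_recl tnth0; congr (_ + _).
by apply: eq_bigr => i _; rewrite tnthS.
Qed.

Lemma scalet_tcons n c x (y : n.-tuple R) :
  scalet c (tcons (x, y)) = tcons (c * x, scalet c y).
Proof.
apply: eq_from_tnth => i; rewrite tnth_mktuple.
by case: (unliftP ord0 i) => [j|] ->; rewrite ?tnthS ?tnth0// tnth_mktuple.
Qed.

Lemma dot_tcons n (a : n.+1.-tuple R) x (y : n.-tuple R) :
  dot a (tcons (x, y)) = thead a * x + dot [tuple of behead a] y.
Proof.
rewrite /dot big_ord_recl tnth0; congr (_ + _).
by apply: eq_bigr => i _; rewrite tnthS [in LHS](tuple_eta a) tnthS.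
Qed.

Lemma sqnorm_behead n (a : n.+1.-tuple R) :
  sqnorm a = thead a ^+ 2 + sqnorm [tuple of behead a].
Proof. by rewrite [in LHS](tuple_eta a) -sqnorm_tcons. Qed.

Lemma thead_scalet n c (a : n.+1.-tuple R) : thead (scalet c a) = c * thead a.
Proof. by rewrite /thead tnth_mktuple. Qed.

Lemma behead_scalet n c (a : n.+1.-tuple R) :
  [tuple of behead (scalet c a)] = scalet c [tuple of behead a].
Proof.
by apply: eq_from_tnth => i; rewrite !(tnth_behead, tnth_mktuple).
Qed.

Lemma scalet1 n (x : n.-tuple R) : scalet 1 x = x.
Proof. by apply: eq_from_tnth => i; rewrite tnth_mktuple mul1r. Qed.

Lemma ge0_integral_mvnormalS n sigma (theta : n.+1.-tuple R)
    (F : n.+1.-tuple R -> \bar R) :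
  measurable_fun [set: n.+1.-tuple R] F -> (forall x, 0 <= F x)%E ->
  (\int[mvnormal sigma theta]_x F x =
   \int[normal_prob (thead theta) sigma]_x
     \int[mvnormal sigma [tuple of behead theta]]_y F (tcons (x, y)))%E.
Proof.
move=> mF F0; rewrite /= ge0_integral_distribution//.
rewrite fubini_tonelli1//.
  by apply: measurableT_comp => //; exact: measurable_tcons.
by move=> x; exact: F0.
Qed.

Lemma ge0_integral_stdS n (F : n.+1.-tuple R -> \bar R) :
  measurable_fun [set: n.+1.-tuple R] F -> (forall x, 0 <= F x)%E ->
  (\int[std n.+1]_x F x =
   \int[normal_prob 0 1]_x \int[std n]_y F (tcons (x, y)))%E.
Proof.
move=> mF F0; rewrite [LHS]ge0_integral_mvnormalS//.
rewrite (_ : thead _ = 0); last by rewrite /thead /= (tnth_nth 0).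
rewrite /std (_ : [tuple of behead [tuple of nseq n.+1 (0 : R)]] =
  [tuple of nseq n (0 : R)] :> n.-tuple R)//.
exact: val_inj.
Qed.

Lemma measurable_fun_tconsr n (x : R) :
  measurable_fun [set: n.-tuple R] (fun y : n.-tuple R => tcons (x, y)).
Proof.
apply: (measurableT_comp (@measurable_tcons R n)).
exact: measurable_pair1.
Qed.

Lemma measurable_comp_tconsr n (F : n.+1.-tuple R -> \bar R) (x : R) :
  measurable_fun [set: n.+1.-tuple R] F ->
  measurable_fun [set: n.-tuple R] (fun y : n.-tuple R => F (tcons (x, y))).
Proof. by move=> mF; exact: (measurableT_comp mF (@measurable_fun_tconsr n x)). Qed.

Lemma measurable_comp_scalet n (F : n.-tuple R -> \bar R) c :
  measurable_fun [set: n.-tuple R] F ->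
  measurable_fun [set: n.-tuple R] (fun x => F (scalet c x)).
Proof. by move=> mF; exact: (measurableT_comp mF (@measurable_scalet n c)). Qed.

Lemma measurable_fun_integral_tcons n (F : n.+1.-tuple R -> \bar R) sigma theta :
  measurable_fun [set: n.+1.-tuple R] F -> (forall x, 0 <= F x)%E ->
  measurable_fun [set: R]
    (fun x => \int[@mvnormal R n sigma theta]_y F (tcons (x, y)))%E.
Proof.
move=> mF F0.
have mFt : measurable_fun setT (F \o @tcons R n).
  by apply: measurableT_comp => //; exact: measurable_tcons.
exact: (measurable_fun_fubini_tonelli_F (m2 := mvnormal sigma theta) _ mFt (fun z => F0 (tcons z))).
Qed.

(** By induction on n with Tonelli: the one-dimensional tilts of the coordinates multiply to the
    exponential of a dot product and a squared norm. *)
Lemma ge0_integral_mvnormal_std n (sigma : R) (theta : n.-tuple R) (F : n.-tuple R -> \bar R) :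
  0 < sigma -> measurable_fun [set: n.-tuple R] F -> (forall x, 0 <= F x)%E ->
  (\int[mvnormal sigma theta]_x F x =
   \int[std n]_x (F (scalet sigma x) *
     (expR (dot (scalet sigma^-1 theta) x - sqnorm (scalet sigma^-1 theta) / 2))%:E))%E.
Proof.
move=> s0; elim: n theta F => [|n IHn] theta F mF F0.
  (* In dimension 0 every function is constant and both laws are the Dirac mass at the empty
     tuple. *)
  have mG (G : 0.-tuple R -> \bar R) : measurable_fun [set: 0.-tuple R] G.
    rewrite (_ : G = cst (G [tuple]))//; apply/funext => x.
    by rewrite tuple0.
  rewrite /std /= !integral_dirac// !diracT !mul1e.
  rewrite /dot /sqnorm !big_ord0 mul0r subrr expR0 mule1; congr F.
  by rewrite [RHS]tuple0. 
set eta := scalet _ theta.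
have mE m (a : m.-tuple R) c : measurable_fun [set: m.-tuple R]
    (fun x => (expR (dot a x - c))%:E).
  apply/measurable_EFinP/measurableT_comp => //.
  by apply: measurable_funB => //; exact: measurable_dot.
have mFx x : measurable_fun [set: n.-tuple R] (fun y => F (tcons (x, y))).
  exact: (measurable_comp_tconsr x mF).
transitivity (\int[normal_prob (thead theta) sigma]_x
     \int[mvnormal sigma [tuple of behead theta]]_y F (tcons (x, y)))%E.
  exact: ge0_integral_mvnormalS.
rewrite (ge0_integral_normal_prob_std _ s0); last 2 first.
- exact: measurable_fun_integral_tcons.
- by move=> x; exact: integral_ge0.
rewrite [RHS]ge0_integral_stdS; last 2 first.
- by apply: emeasurable_funM; [exact: (measurable_comp_scalet sigma mF)|exact: mE].
- by move=> x; rewrite mule_ge0// lee_fin expR_ge0.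
apply: eq_integral => x _.
rewrite IHn//.
have mI : measurable_fun [set: n.-tuple R] (fun y => F (tcons ((sigma * x)%R, scalet sigma y)) *
    (expR (dot (scalet sigma^-1 [tuple of behead theta]) y -
           sqnorm (scalet sigma^-1 [tuple of behead theta]) / 2))%:E)%E.
  by apply: emeasurable_funM; [exact: (measurable_comp_scalet sigma (mFx _))|exact: mE].
have I0 y : (0 <= F (tcons ((sigma * x)%R, scalet sigma y)) *
    (expR (dot (scalet sigma^-1 [tuple of behead theta]) y -
           sqnorm (scalet sigma^-1 [tuple of behead theta]) / 2))%:E)%E.
  by rewrite mule_ge0// lee_fin expR_ge0.
rewrite muleC -ge0_integralZl// ?lee_fin ?expR_ge0//.
apply: eq_integral => y _.
rewrite muleCA scalet_tcons; congr (_ * _)%E.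
rewrite -EFinM -expRD; congr (expR _)%:E.
rewrite dot_tcons sqnorm_behead /eta thead_scalet behead_scalet.
by rewrite [_ / sigma]mulrC; ring.
Qed.

(** The weight splits over the coordinates, so the one-dimensional dilation applies n times.
    Negative c is allowed: c = -1 gives the symmetry of the law. *)
Lemma ge0_integral_std_scalet n (c : R) (F : n.-tuple R -> \bar R) :
  c != 0 -> measurable_fun [set: n.-tuple R] F -> (forall x, 0 <= F x)%E ->
  (\int[std n]_x (F x * (expR (sqnorm x / 2))%:E) =
   (`|c| ^+ n)%:E * \int[std n]_x (F (scalet c x) * (expR (sqnorm x / 2))%:E))%E.
Proof.
move=> c0; have mE m : measurable_fun [set: m.-tuple R]
    (fun x => (expR (sqnorm x / 2))%:E).
  apply/measurable_EFinP/measurableT_comp => //.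
  by apply: measurable_funM => //; exact: measurable_sqnorm.
elim: n F => [|n IHn] F mF F0.
  have mG (G : 0.-tuple R -> \bar R) : measurable_fun [set: 0.-tuple R] G.
    rewrite (_ : G = cst (G [tuple]))//; apply/funext => x.
    by rewrite tuple0.
  rewrite /std /= !integral_dirac// !diracT !mul1e; congr (F _ * _)%E.
  by rewrite [RHS]tuple0.
have mFc d : measurable_fun [set: n.+1.-tuple R] (fun x => F (scalet d x)).
  by exact: (measurable_comp_scalet d mF).
(* The first coordinate is split off with its own share of the weight, the form that suits both the
   dilation on the line and the induction hypothesis. *)
have key (G : n.+1.-tuple R -> \bar R) : measurable_fun [set: n.+1.-tuple R] G ->
    (forall x, 0 <= G x)%E ->
    (\int[std n.+1]_x (G x * (expR (sqnorm x / 2))%:E) =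
     \int[normal_prob 0 1]_x ((\int[std n]_y (G (tcons (x, y)) * (expR (sqnorm y / 2))%:E))
        * (expR (x ^+ 2 / 2))%:E))%E.
  move=> mG G0; rewrite ge0_integral_stdS; last 2 first.
  - exact: (emeasurable_funM mG (mE _)).
  - by move=> x; rewrite mule_ge0// lee_fin expR_ge0.
  apply: eq_integral => x _.
  have mI : measurable_fun [set: n.-tuple R]
      (fun y => G (tcons (x, y)) * (expR (sqnorm y / 2))%:E)%E.
    apply: emeasurable_funM; last exact: mE. exact: (measurable_comp_tconsr x mG).
  have I0 y : (0 <= G (tcons (x, y)) * (expR (sqnorm y / 2))%:E)%E.
    by rewrite mule_ge0// lee_fin expR_ge0.
  rewrite muleC -ge0_integralZl// ?lee_fin ?expR_ge0//.
  apply: eq_integral => y _; rewrite muleCA sqnorm_tcons; congr (_ * _)%E.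
  by rewrite -EFinM -expRD -mulrDl.
rewrite !key//.
have mI (G : n.+1.-tuple R -> \bar R) : measurable_fun [set: n.+1.-tuple R] G ->
    (forall x, 0 <= G x)%E -> measurable_fun [set: R]
    (fun x => \int[std n]_y (G (tcons (x, y)) * (expR (sqnorm y / 2))%:E))%E.
  move=> mG G0.
  have mGt : measurable_fun [set: measurableTypeR R * n.-tuple R]
      (fun z => G (tcons z) * (expR (sqnorm z.2 / 2))%:E)%E.
    apply: emeasurable_funM.
      by apply: measurableT_comp => //; exact: measurable_tcons.
    exact: (measurableT_comp (mE n)).
  apply: (measurable_fun_fubini_tonelli_F (m2 := std n) _ mGt) => z.
  by rewrite mule_ge0// lee_fin expR_ge0.
have I0 (G : n.+1.-tuple R -> \bar R) x : (forall x, 0 <= G x)%E ->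
    (0 <= \int[std n]_y (G (tcons (x, y)) * (expR (sqnorm y / 2))%:E))%E.
  by move=> G0; apply: integral_ge0 => y _; rewrite mule_ge0// lee_fin expR_ge0.
have me : measurable_fun [set: R] (fun x : R => (expR (x ^+ 2 / 2))%:E).
  by apply/measurable_EFinP/measurableT_comp => //; exact: measurable_funM.
rewrite (ge0_integral_normal_prob_scale c0); [|exact: mI|by move=> x; exact: I0].
rewrite exprSr EFinM -muleA muleCA; congr (_ * _)%E.
have mJ := emeasurable_funM (mI _ (mFc c) (fun x => F0 (scalet c x))) me.
have J0 x : (0 <= \int[std n]_y (F (scalet c (tcons (x, y))) * (expR (sqnorm y / 2))%:E)
    * (expR (x ^+ 2 / 2))%:E)%E.
  by rewrite mule_ge0 ?lee_fin ?expR_ge0//; exact: (I0 (fun x => F (scalet c x))).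
rewrite -ge0_integralZl// ?lee_fin ?exprn_ge0//.
apply: eq_integral => x _; rewrite muleA; congr (_ * _)%E.
rewrite IHn//; last exact: (measurable_comp_tconsr (c * x) mF).
by under eq_integral do rewrite -scalet_tcons.
Qed.

End vectors.

(** Continuity at 1. It serves as the passage to the limit c -> 1 in inequalities known for c > 1
    and already divided by c - 1. *)
Lemma horner_ge0_at1 (R : realType) (P : {poly R}) :
  (forall c, 1 < c -> 0 <= P.[c]) -> 0 <= P.[1].
Proof.
move=> P0; rewrite leNgt; apply/negP => P1.
have cP : {for (1 : R), continuous (fun x => P.[x])} by exact: continuous_horner.
have : \forall x \near (1 : R), P.[x] < 0 by exact: (cvgr_lt _ cP).
move=> /nbhs_ballP[e /= e0 be].
have /be : ball (1 : R) e (1 + e / 2).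
  rewrite /ball/= opprD addrA subrr add0r normrN gtr0_norm ?divr_gt0//.
  by rewrite gtr_pMr// invf_lt1// ltr1n.
by rewrite ltNge P0// ltrDl divr_gt0.
Qed.

(** * Integrals of nonnegative real-valued functions *)

Section real_integrands.
Context d {T : measurableType d} {R : realType}.
Variable mu : {measure set T -> \bar R}.
Implicit Types f g : T -> R.

Lemma integral_EFinZ f c : measurable_fun [set: T] f -> (forall w, 0 <= f w) -> 0 <= c ->
  (\int[mu]_w (c * f w)%:E = c%:E * \int[mu]_w (f w)%:E)%E.
Proof.
move=> /measurable_EFinP mf f0 c0.
under eq_integral do rewrite EFinM.
by rewrite (ge0_integralZl mu measurableT mf)// => w _; rewrite /= lee_fin.
Qed.

Lemma integral_EFinD f g : measurable_fun [set: T] f -> measurable_fun [set: T] g ->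
  (forall w, 0 <= f w) -> (forall w, 0 <= g w) ->
  (\int[mu]_w (f w + g w)%:E = \int[mu]_w (f w)%:E + \int[mu]_w (g w)%:E)%E.
Proof.
move=> /measurable_EFinP mf /measurable_EFinP mg f0 g0.
under eq_integral do rewrite EFinD.
by rewrite (ge0_integralD mu measurableT _ mf _ mg)// => w _; rewrite /= lee_fin.
Qed.

Lemma le_integral_EFin f g : measurable_fun [set: T] f -> measurable_fun [set: T] g ->
  (forall w, 0 <= f w) -> (forall w, f w <= g w) ->
  (\int[mu]_w (f w)%:E <= \int[mu]_w (g w)%:E)%E.
Proof.
move=> /measurable_EFinP mf /measurable_EFinP mg f0 fg.
by apply: (ge0_le_integral mu measurableT _ mf mg) => w _; rewrite /= lee_fin.
Qed.

Lemma integral_EFin_ge0 f : (forall w, 0 <= f w) -> (0 <= \int[mu]_w (f w)%:E)%E.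
Proof. by move=> f0; apply: integral_ge0 => w _; rewrite lee_fin. Qed.

End real_integrands.

(** * Moment recursion for homogeneous functions under a dilation-covariant law *)

Section scaling.
Context {R : realType} d {T : measurableType d}.
Variables (P : probability T R) (q : T -> R) (S : R -> T -> T) (n : nat).
Hypothesis q0 : forall w, 0 <= q w.
Hypothesis mq : measurable_fun [set: T] q.
Hypothesis qS : forall c w, q (S c w) = c ^+ 2 * q w.
(** Kept abstract because it serves twice: for the standard Gaussian on R^n, and for the product law
    on R^p x R^k with exponent p + k. *)
Hypothesis scaling : forall c (F : T -> \bar R), 0 < c ->
  measurable_fun [set: T] F -> (forall w, 0 <= F w)%E ->
  (\int[P]_w (F w * (expR (q w / 2))%:E) =
   (c ^+ n)%:E * \int[P]_w (F (S c w) * (expR (q w / 2))%:E))%E.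

(** [scaling] applied to [phi] divided by the weight; the last exponential is what the dilation
    leaves of the Gaussian factor. *)
Let integral_homogeneous_exp N (phi : T -> R) c : 0 < c ->
  measurable_fun [set: T] phi -> (forall w, 0 <= phi w) ->
  (forall w, phi (S c w) = c ^+ N * phi w) ->
  (\int[P]_w (phi w)%:E = (c ^+ (n + N))%:E *
   \int[P]_w (phi w * expR (- ((c ^+ 2 - 1) / 2 * q w)))%:E)%E.
Proof.
move=> c0 mphi phi0 phiS.
have mF : measurable_fun [set: T] (fun w => (phi w * expR (- (q w / 2)))%:E).
  apply/measurable_EFinP/measurable_funM => //; apply: measurableT_comp => //.
  by apply: measurableT_comp => //; exact: measurable_funM.
have F0 w : (0 <= (phi w * expR (- (q w / 2)))%:E)%E.
  by rewrite lee_fin mulr_ge0 ?expR_ge0.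
have := scaling c0 mF F0.
under eq_integral do rewrite -EFinM -mulrA -expRD addNr expR0 mulr1.
move=> ->; rewrite exprD EFinM -muleA; congr (_ * _)%E.
rewrite -ge0_integralZl//.
- apply: eq_integral => w _; rewrite -!EFinM phiS qS -!mulrA -expRD.
  by congr (_ * (_ * expR _))%:E; field.
- apply/measurable_EFinP/measurable_funM => //; apply: measurableT_comp => //.
  by apply: measurableT_comp => //; exact: measurable_funM.
- by move=> w _; rewrite lee_fin mulr_ge0 ?expR_ge0.
- by rewrite lee_fin exprn_ge0// ltW.
Qed.

(** Formally the derivative at c = 1 of the preceding identity, whose left side does not depend on
    c. Instead of differentiating under the integral, the bounds 1 - x <= exp(-x) and (1 + x)
    exp(-x) <= 1 are integrated for c > 1 ([up] and [lo]); after division by c - 1 they squeeze the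
    mean of [phi w * q w] as c tends to 1. *)
Lemma integral_homogeneous_sqnorm N (phi : T -> R) :
  measurable_fun [set: T] phi -> (forall w, 0 <= phi w) ->
  (forall c w, 0 < c -> phi (S c w) = c ^+ N * phi w) ->
  (\int[P]_w (phi w)%:E < +oo)%E ->
  (\int[P]_w (phi w * q w)%:E = (n + N)%:R%:E * \int[P]_w (phi w)%:E)%E.
Proof.
move=> mphi phi0 phiS Aoo.
set M := (n + N)%N.
pose A := fine (\int[P]_w (phi w)%:E)%E.
have AE : (\int[P]_w (phi w)%:E = A%:E)%E.
  by rewrite fineK// ge0_fin_numE//; apply: integral_ge0 => w _; rewrite lee_fin.
have A0 : 0 <= A by rewrite fine_ge0//; apply: integral_ge0 => w _; rewrite lee_fin.
pose E c : \bar R := (\int[P]_w (phi w * expR (- ((c ^+ 2 - 1) / 2 * q w)))%:E)%E.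
pose Eq c : \bar R :=
  (\int[P]_w (phi w * q w * expR (- ((c ^+ 2 - 1) / 2 * q w)))%:E)%E.
set B' := (\int[P]_w (phi w * q w)%:E)%E.
have mphiq : measurable_fun [set: T] (fun w => phi w * q w) by exact: measurable_funM.
have phiq0 w : 0 <= phi w * q w by rewrite mulr_ge0.
have mexp c : measurable_fun [set: T] (fun w => expR (- ((c ^+ 2 - 1) / 2 * q w))).
  apply: measurableT_comp => //; apply: measurableT_comp => //; exact: measurable_funM.
have EE c : 0 < c -> (E c = (c ^- M * A)%:E)%E.
  move=> c0; have := integral_homogeneous_exp c0 mphi phi0 (fun w => phiS c w c0).
  rewrite AE -/M -/(E c) => AEc.
  by rewrite EFinM AEc muleA -EFinM mulVf ?mul1e// expf_neq0// gt_eqF.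
have EqE c : 0 < c -> (Eq c = (c ^- M.+2)%:E * B')%E.
  move=> c0; have phiqS w : phi (S c w) * q (S c w) = c ^+ N.+2 * (phi w * q w).
    by rewrite phiS// qS mulrACA -exprD addn2.
  have := integral_homogeneous_exp c0 mphiq phiq0 phiqS.
  rewrite -/B' !addnS -/M -/(Eq c) => ->.
  by rewrite muleA -EFinM mulVf ?mul1e// expf_neq0// gt_eqF.
have E0 c : (0 <= E c)%E.
  by apply: integral_ge0 => w _; rewrite lee_fin mulr_ge0// expR_ge0.
have B'0 : (0 <= B')%E by apply: integral_ge0 => w _; rewrite lee_fin.
have up c : 1 < c -> (A%:E <= (c ^- M * A)%:E + ((c ^+ 2 - 1) / 2)%:E * B')%E.
  move=> c1; have c0 : 0 < c by rewrite (lt_trans _ c1).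
  have y0 : 0 <= (c ^+ 2 - 1) / 2.
    by rewrite divr_ge0// subr_ge0 expr_ge1// ltW.
  have mye : measurable_fun [set: T]
      (fun w => phi w * expR (- ((c ^+ 2 - 1) / 2 * q w))) by exact: measurable_funM.
  have myq : measurable_fun [set: T] (fun w => (c ^+ 2 - 1) / 2 * (phi w * q w)).
    exact: measurable_funM.
  have ye0 w : 0 <= phi w * expR (- ((c ^+ 2 - 1) / 2 * q w)).
    by rewrite mulr_ge0// expR_ge0.
  have yq0 w : 0 <= (c ^+ 2 - 1) / 2 * (phi w * q w) by rewrite mulr_ge0.
  rewrite -EE// /B' -integral_EFinZ// -integral_EFinD// -AE.
  apply: le_integral_EFin => //; first exact: measurable_funD.
  move=> w; rewrite [leRHS](_ : _ =
    phi w * (expR (- ((c ^+ 2 - 1) / 2 * q w)) + (c ^+ 2 - 1) / 2 * q w)); last by ring.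
  rewrite ler_peMr// -lerBlDr.
  exact: expR_ge1Dx.
have lo c : 1 < c -> (((c ^+ 2 - 1) / 2 * c ^- M.+2)%:E * B' + (c ^- M * A)%:E <= A%:E)%E.
  move=> c1; have c0 : 0 < c by rewrite (lt_trans _ c1).
  have y0 : 0 <= (c ^+ 2 - 1) / 2.
    by rewrite divr_ge0// subr_ge0 expr_ge1// ltW.
  have mye : measurable_fun [set: T]
      (fun w => phi w * expR (- ((c ^+ 2 - 1) / 2 * q w))) by exact: measurable_funM.
  have myq : measurable_fun [set: T]
      (fun w => phi w * q w * expR (- ((c ^+ 2 - 1) / 2 * q w))).
    exact: measurable_funM.
  have ye0 w : 0 <= phi w * expR (- ((c ^+ 2 - 1) / 2 * q w)).
    by rewrite mulr_ge0// expR_ge0.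
  have yq0 w : 0 <= phi w * q w * expR (- ((c ^+ 2 - 1) / 2 * q w)).
    by rewrite mulr_ge0// expR_ge0.
  rewrite EFinM -muleA -EqE// -EE// -integral_EFinZ// -integral_EFinD//; last 2 first.
  - exact: measurable_funM.
  - by move=> w; rewrite mulr_ge0.
  rewrite -AE; apply: le_integral_EFin => //.
  - by apply: measurable_funD => //; exact: measurable_funM.
  - by move=> w; rewrite addr_ge0// mulr_ge0.
  move=> w; rewrite [leLHS](_ : _ = phi w *
    ((1 + (c ^+ 2 - 1) / 2 * q w) * expR (- ((c ^+ 2 - 1) / 2 * q w)))); last by ring.
  rewrite ler_piMr// expRN ler_pdivrMr ?expR_gt0// mul1r.
  exact: expR_ge1Dx.
(* [lo] at c = 2 bounds a positive multiple of [B'] by the finite [A]. *)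
have B'oo : (B' < +oo)%E.
  rewrite ltey; apply/negP => /eqP Boo.
  have l2 : (1 : R) < 2 by rewrite ltr1n.
  have := lo 2 l2; rewrite Boo gt0_muley ?lte_fin ?mulr_gt0 ?invr_gt0 ?exprn_gt0//.
  by rewrite subr_gt0 -natrX ltr1n.
pose B := fine B'.
have BE : B' = B%:E by rewrite fineK// ge0_fin_numE.
have B0 : 0 <= B by rewrite fine_ge0.
rewrite BE AE -EFinM; congr EFin.
have geo c : c ^+ M - 1 = (c - 1) * \sum_(i < M) c ^+ i by rewrite subrX1.
pose s : {poly R} := \sum_(i < M) 'X ^+ i.
have sE c : s.[c] = \sum_(i < M) c ^+ i.
  by rewrite horner_sum; apply: eq_bigr => i _; rewrite hornerXn.
have s1 : s.[1] = M%:R.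
  by rewrite sE (eq_bigr (fun=> 1)) ?sumr_const ?card_ord// => i _; rewrite expr1n.
apply/eqP; rewrite eq_le; apply/andP; split.
(* This polynomial is [lo] multiplied by c^(M+2) and divided by c - 1, using c^M - 1 = (c - 1) s(c);
   its value at 1 is M A - B. *)
- have := @horner_ge0_at1 _ ('X ^+ 2 * s * A%:P - (B / 2) *: ('X + 1)).
  rewrite !hornerE s1 expr1n => H; suff : 0 <= 1 * M%:R * A - B / 2 * (1 + 1) by lra.
  apply: H => c c1.
  rewrite !hornerE sE /=.
  have c0 : 0 < c by rewrite (lt_trans _ c1).
  have := lo c c1; rewrite BE -EFinM -EFinD lee_fin.
  have cM : c ^+ M != 0 by rewrite expf_neq0// gt_eqF.
  rewrite -(ler_pM2l (exprn_gt0 M.+2 c0)) [leLHS](_ : _ = (c ^+ 2 - 1) / 2 * B + c ^+ 2 * A).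
    rewrite (_ : c ^+ M.+2 = c ^+ M * c ^+ 2) => [H1|]; last by rewrite -exprD addn2.
  rewrite -(@pmulr_rge0 _ (c - 1)) ?subr_gt0//.
  rewrite [leRHS](_ : _ = c ^+ 2 * ((c - 1) * \sum_(i < M) c ^+ i) * A - (c ^+ 2 - 1) / 2 * B).
    rewrite -geo [leRHS](_ : _ = c ^+ M * c ^+ 2 * A - ((c ^+ 2 - 1) / 2 * B + c ^+ 2 * A)).
      by rewrite subr_ge0.
    by ring.
  by field.
  have -> : c ^+ M.+2 = c ^+ M * c ^+ 2 by rewrite -exprD addn2.
  by field; rewrite cM gt_eqF.
(* Likewise [up] multiplied by c^M and divided by c - 1, with value B - M A at 1. *)
- have := @horner_ge0_at1 _ ((B / 2) *: ('X ^+ M * ('X + 1)) - s * A%:P).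
  rewrite !hornerE s1 !expr1n /= => H; suff : 0 <= B / 2 * 1 * (1 + 1) - M%:R * A by lra.
  apply: H => c c1.
  rewrite !hornerE sE /=.
  have c0 : 0 < c by rewrite (lt_trans _ c1).
  have := up c c1; rewrite BE -EFinM -EFinD lee_fin.
  rewrite -(ler_pM2l (exprn_gt0 M c0)) mulrDr mulVKf ?expf_neq0 ?gt_eqF// => H1.
  rewrite -(@pmulr_rge0 _ (c - 1)) ?subr_gt0//.
  rewrite [leRHS](_ : _ = c ^+ M * ((c ^+ 2 - 1) / 2 * B) - ((c - 1) * \sum_(i < M) c ^+ i) * A).
    rewrite -geo [leRHS](_ : _ = A + c ^+ M * ((c ^+ 2 - 1) / 2 * B) - c ^+ M * A).
      by rewrite subr_ge0.
    by ring.
  by field.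
Qed.

End scaling.

(** * Identification of the coefficients of nonnegative power series *)

Section nonnegative_series.
Context {R : realType}.
Implicit Types u v : R^nat.

Lemma nneseries_EFin u l : series u @ \oo --> l -> (\sum_(i <oo) (u i)%:E = l%:E)%E.
Proof.
move=> ul; apply/cvg_lim => //; rewrite (_ : (fun _ => _) = EFin \o series u).
  by apply: cvg_comp ul _; exact: cvg_id.
by apply/funext => n /=; rewrite /series/= sumEFin.
Qed.

(** Once the terms below n cancel and y^n is divided out, the tail of the right-hand series is at
    most y S, which vanishes as y tends to 0. *)
Lemma power_series_le u v (S : R) :
  (forall i, 0 <= u i) -> (forall i, 0 <= v i) ->
  (forall y, 0 < y <= 1 ->
     (\sum_(i <oo) (u i * y ^+ i)%:E <= \sum_(i <oo) (v i * y ^+ i)%:E)%E) ->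
  (\sum_(i <oo) (v i)%:E <= S%:E)%E ->
  forall n, (forall i, (i < n)%N -> u i = v i) -> u n <= v n.
Proof.
move=> u0 v0 uv vS n eqn.
have S0 : 0 <= S.
  by rewrite -lee_fin (le_trans _ vS)// nneseries_ge0// => i _ _; rewrite lee_fin.
suff H y : 0 < y <= 1 -> u n <= v n + y * S.
  rewrite leNgt; apply/negP => vu.
  (* Since y (2 S + 1) is at most u_n - v_n, the bound u_n - v_n <= y S would force y (S + 1) <=
     0. *)
  pose y := Num.min 1 ((u n - v n) / (S + S + 1)).
  have S1 : 0 < S + S + 1 by rewrite ltr_wpDl// addr_ge0.
  have y01 : 0 < y <= 1.
    by rewrite /y lt_min ltr01 divr_gt0 ?subr_gt0//= ge_min lexx.
  have := H y y01; apply/negP; rewrite -ltNge.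
  have yS : y * (S + S + 1) <= u n - v n.
    by rewrite -ler_pdivlMr// /y ge_min lexx orbT.
  have [y0 _] := andP y01.
  have := mulr_ge0 (ltW y0) S0; lra.
move=> /andP[y0 y1].
have yn0 : 0 < y ^+ n by rewrite exprn_gt0.
rewrite -(ler_pM2r yn0) mulrDl -lerBlDl.
suff : (\sum_(0 <= i < n.+1) (u i * y ^+ i)%:E <=
        \sum_(0 <= i < n.+1) (v i * y ^+ i)%:E + (y ^+ n.+1 * S)%:E)%E.
  rewrite !sumEFin -EFinD lee_fin !big_nat_recr//=.
  rewrite (@eq_big_nat _ _ _ 0 n _ (fun i => v i * y ^+ i)); last first.
    by move=> i /andP[_ ?]; rewrite eqn.
  by rewrite exprS; lra.
apply: (@le_trans _ _ (\sum_(i <oo) (u i * y ^+ i)%:E)%E).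
  by apply: nneseries_lim_ge => i _ _; rewrite lee_fin mulr_ge0// exprn_ge0// ltW.
apply: (le_trans (uv y _)); first by rewrite y0.
apply: lime_le.
  by apply: is_cvg_nneseries => i _ _; rewrite lee_fin mulr_ge0// exprn_ge0// ltW.
apply: nearW => N.
have vN : \sum_(0 <= i < N) v i <= S.
  rewrite -lee_fin -sumEFin; apply: le_trans vS.
  by apply: nneseries_lim_ge => i _ _; rewrite lee_fin.
rewrite !sumEFin -EFinD lee_fin.
apply: (@le_trans _ _ (\sum_(0 <= i < n.+1) (v i * y ^+ i) +
   y ^+ n.+1 * \sum_(0 <= i < N) v i)); last first.
  by rewrite lerD2l ler_pM2l ?exprn_gt0.
have [Nn|nN] := leqP N n.+1.
  rewrite (@big_cat_nat _ _ _ N 0 n.+1)//= -addrA lerDl addr_ge0//.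
    by apply: sumr_ge0 => i _; rewrite mulr_ge0// exprn_ge0// ltW.
  by rewrite mulr_ge0 ?exprn_ge0 ?sumr_ge0// ltW.
rewrite (@big_cat_nat _ _ _ n.+1 0 N)//=; last exact: ltnW.
rewrite lerD2l (@big_cat_nat _ _ _ n.+1 0 N _ _ (leq0n _) (ltnW nN))/=.
rewrite mulrDr ler_wpDl//.
  by rewrite mulr_ge0 ?exprn_ge0 ?sumr_ge0// ltW.
rewrite mulr_sumr ler_sum_nat// => i /andP[ni _].
by rewrite mulrC ler_wpM2r// ler_wiXn2l// ltW.
Qed.

(** Strong induction: the first index where the coefficients might differ is settled by
    [power_series_le] in both directions. *)
Lemma power_series_inj u v :
  (forall i, 0 <= u i) -> (forall i, 0 <= v i) ->
  (forall y, 0 < y <= 1 ->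
     (\sum_(i <oo) (u i * y ^+ i)%:E = \sum_(i <oo) (v i * y ^+ i)%:E)%E) ->
  (\sum_(i <oo) (v i)%:E < +oo)%E ->
  u =1 v.
Proof.
move=> u0 v0 uv voo.
have se0 (w : R^nat) : (forall i, 0 <= w i) -> (0 <= \sum_(i <oo) (w i)%:E)%E.
  by move=> w0; rewrite nneseries_ge0// => i _ _; rewrite lee_fin.
have uvE : (\sum_(i <oo) (u i)%:E = \sum_(i <oo) (v i)%:E)%E.
  have := uv 1; rewrite ltr01 lexx => /(_ isT).
  by under eq_eseriesr do rewrite expr1n mulr1;
     under [RHS]eq_eseriesr do rewrite expr1n mulr1.
have vS : (\sum_(i <oo) (v i)%:E <= (fine (\sum_(i <oo) (v i)%:E))%:E)%E.
  by rewrite fineK// ge0_fin_numE// se0.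
move=> n; elim/ltn_ind: n => n IHn.
apply/eqP; rewrite eq_le; apply/andP; split.
  by apply: (power_series_le _ _ _ vS) => // y y01; rewrite uv.
apply: (power_series_le (S := fine (\sum_(i <oo) (v i)%:E)%E)) => //.
- by move=> y y01; rewrite uv.
- by rewrite uvE.
- by move=> i ni; rewrite IHn.
Qed.

End nonnegative_series.

(** * Hyperbolic functions and their series *)

Section hyperbolic.
Context {R : realType}.

Definition cosh (x : R) := (expR x + expR (- x)) / 2.
Definition sinh (x : R) := (expR x - expR (- x)) / 2.

Lemma cosh_ge1 x : 1 <= cosh x.
Proof. by rewrite /cosh; have := expR_ge1Dx x; have := expR_ge1Dx (- x); lra. Qed.

Lemma mul_sinh_ge0 x : 0 <= x * sinh x.
Proof.
rewrite /sinh; have [x0|x0] := leP 0 x.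
  by rewrite mulr_ge0// divr_ge0// subr_ge0 ler_expR; lra.
by rewrite nmulr_rge0// pmulr_lle0 ?invr_gt0// subr_le0 ler_expR; lra.
Qed.

Let cvg_expR_double (x : R) : series (exp_coeff x) (2 * n)%N @[n --> \oo] --> expR x.
Proof.
apply: (@cvg_comp _ _ _ (fun n => (2 * n)%N) (series (exp_coeff x)) _ \oo).
  by apply/cvgnyPge => A; exists A => // n /= An; rewrite (leq_trans An)// leq_pmull.
exact: is_cvg_series_exp_coeff.
Qed.

Let seriesSS (f : R^nat) N : series f N.+2 = series f N + (f N + f N.+1).
Proof. by rewrite /series /= big_nat_recr//= big_nat_recr//= addrA. Qed.

Let seriesS (f : R^nat) N : series f N.+1 = series f N + f N.
Proof. by rewrite /series /= big_nat_recr. Qed.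

(** Half the sum of the first 2n terms of the series of exp(x) and exp(-x): the odd terms cancel and
    n even ones remain. *)
Lemma cosh_series x : (\sum_(j <oo) (x ^+ (2 * j) / (2 * j)`!%:R)%:E = (cosh x)%:E)%E.
Proof.
apply: nneseries_EFin.
rewrite (_ : series _ = fun n => (series (exp_coeff x) (2 * n)%N +
    series (exp_coeff (- x)) (2 * n)%N) / 2).
  by apply: cvgMl; apply: cvgD; exact: cvg_expR_double.
apply/funext; elim => [|n IHn].
  by rewrite /series /= !big_geq// add0r mul0r.
rewrite seriesS IHn mulnS !addSn add0n !seriesSS /exp_coeff /=.
have -> : (- x) ^+ (2 * n) = x ^+ (2 * n) by rewrite !exprM sqrrN.
have -> : (- x) ^+ (2 * n).+1 = - x ^+ (2 * n).+1 by rewrite !exprS !exprM sqrrN mulNr.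
rewrite mulNr; move: (series _ _) (series _ _) (_ / (2 * n)`!%:R) (_ / (2 * n).+1`!%:R).
by move=> *; lra.
Qed.

Lemma sinh_series x :
  (\sum_(j <oo) (x ^+ (2 * j.+1) / (2 * j).+1`!%:R)%:E = (x * sinh x)%:E)%E.
Proof.
apply: nneseries_EFin.
rewrite (_ : series _ = fun n => x * ((series (exp_coeff x) (2 * n)%N -
    series (exp_coeff (- x)) (2 * n)%N) / 2)).
  apply: cvgMr; apply: cvgMl; apply: cvgB; exact: cvg_expR_double.
apply/funext; elim => [|n IHn].
  by rewrite /series /= !big_geq// subr0 mul0r mulr0.
rewrite seriesS IHn mulnS !addSn add0n !seriesSS /exp_coeff /=.
have -> : (- x) ^+ (2 * n) = x ^+ (2 * n) by rewrite !exprM sqrrN.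
have -> : (- x) ^+ (2 * n).+1 = - x ^+ (2 * n).+1 by rewrite !exprS !exprM sqrrN mulNr.
have -> : x ^+ (2 * n).+2 / (2 * n).+1`!%:R = x * (x ^+ (2 * n).+1 / (2 * n).+1`!%:R).
  by rewrite exprS mulrA.
rewrite mulNr; move: (series _ _) (series _ _) (_ / (2 * n)`!%:R) (_ / (2 * n).+1`!%:R).
by move=> *; field.
Qed.

End hyperbolic.

(** * Measurability of the inverse and of the square root *)

Section measurable_operations.
Context {R : realType}.

(** Continuity off 0; the remaining point 0, where the inverse is 0 by convention, is a measurable
    singleton. *)
Lemma measurable_invr : measurable_fun [set: R] (@GRing.inv R).
Proof.
have m0 : measurable (~` [set (0 : R)]) by exact: measurableC.
rewrite -(setvU [set (0 : R)]); apply/measurable_funU => //; split.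
  apply: open_continuous_measurable_fun.
    by rewrite openC; exact: closed_eq.
  by move=> x /set_mem /= /eqP x0; exact: inv_continuous.
exact: measurable_fun_set1.
Qed.

Lemma measurable_funV d (T : measurableType d) (f : T -> R) :
  measurable_fun [set: T] f -> measurable_fun [set: T] (fun x => (f x)^-1).
Proof. by move=> mf; exact: (measurableT_comp measurable_invr mf). Qed.

Lemma measurable_sqrt : measurable_fun [set: R] (@Num.sqrt R).
Proof. by apply: continuous_measurable_fun; exact: sqrt_continuous. Qed.

End measurable_operations.

(** * The confluent hypergeometric function: convergence, bounds, monotone ratio *)

Section confluent_hypergeometric.
Context {R : realType}.
Implicit Types a b c z : R.

Lemma pochhammer0 c : pochhammer c 0 = 1.
Proof. by rewrite /pochhammer big_ord0. Qed.

Lemma pochhammerS c i : pochhammer c i.+1 = pochhammer c i * (c + i%:R).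
Proof. by rewrite /pochhammer big_ord_recr. Qed.

Lemma pochhammerSl c i : pochhammer c i.+1 = c * pochhammer (c + 1) i.
Proof.
rewrite /pochhammer big_ord_recl addr0; congr (_ * _).
by apply: eq_bigr => j _; rewrite /= /bump /= add1n -natr1 [j%:R + 1]addrC addrA.
Qed.

Lemma pochhammer_gt0 c i : 0 < c -> 0 < pochhammer c i.
Proof. by move=> c0; apply: prodr_gt0 => j _; rewrite ltr_wpDr. Qed.

Let term a b z i := pochhammer a i / pochhammer b i * (z ^+ i / i`!%:R).

(** Since (a + i)/(b + i) <= K with K = 1 + a/b, the quotient (a)_i/(b)_i is at most K^i, and the
    series is dominated by that of exp(K |z|). *)
Lemma cvg_hyp1F1 a b z : 0 < a -> 0 < b ->
  series (fun i => pochhammer a i / pochhammer b i * (z ^+ i / i`!%:R)) @ \oo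
    --> hyp1F1 a b z.
Proof.
move=> a0 b0; suff : cvgn (series (term a b z)) by [].
apply: normed_cvg.
pose K := 1 + a / b.
have K0 : 0 <= K by rewrite addr_ge0 ?divr_ge0 ?ltW.
have qK i : 0 <= pochhammer a i / pochhammer b i <= K ^+ i.
  apply/andP; split; first by rewrite divr_ge0 ?ltW ?pochhammer_gt0.
  elim: i => [|i IHi]; first by rewrite !pochhammer0 divr1 expr0.
  rewrite !pochhammerS invfM mulrACA exprSr ler_pM//.
  - by rewrite divr_ge0 ?ltW ?pochhammer_gt0.
  - by rewrite divr_ge0 ?ltW// ltr_wpDr.
  rewrite ler_pdivrMr ?ltr_wpDr// /K mulrDl mul1r mulrDr divfK ?gt_eqF//.
  have := mulr_ge0 (divr_ge0 (ltW a0) (ltW b0)) (ler0n R i); lra.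
have tn n : `|term a b z n| <= exp_coeff (K * `|z|) n.
  have /andP[q0 qn] := qK n.
  rewrite /term /exp_coeff normrM (ger0_norm q0) normrM normrX normfV.
  by rewrite (ger0_norm (ler0n _ _)) [leRHS]/= exprMn -[leRHS]mulrA ler_wpM2r// divr_ge0// exprn_ge0.
apply: (series_le_cvg (v_ := exp_coeff (K * `|z|))).
- by move=> n; exact: normr_ge0.
- by move=> n; rewrite /exp_coeff /= divr_ge0// exprn_ge0// mulr_ge0.
- exact: tn.
- exact: is_cvg_series_exp_coeff.
Qed.

Lemma measurable_hyp1F1 a b : 0 < a -> 0 < b -> measurable_fun [set: R] (hyp1F1 a b).
Proof.
move=> a0 b0.
apply: (measurable_fun_cvg (h := fun n z => series (term a b z) n)) => [n|z _].
  apply: measurable_sum => i.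
  apply: measurable_funM => //; apply: measurable_funM => //.
exact: cvg_hyp1F1.
Qed.

Lemma hyp1F1_ge1 a b z : 0 < a -> 0 < b -> 0 <= z -> 1 <= hyp1F1 a b z.
Proof.
move=> a0 b0 z0; have cv := @cvg_hyp1F1 a b z a0 b0.
apply: limr_ge; first by apply/cvg_ex; exists (hyp1F1 a b z).
exists 1%N => // n /= n0; rewrite /series /= -(prednK n0) big_nat_recl//=.
rewrite !pochhammer0 !(divr1, mul1r, expr0, fact0) invr1. rewrite lerDl sumr_ge0// => i _.
by rewrite mulr_ge0// divr_ge0 ?exprn_ge0// ltW// pochhammer_gt0.
Qed.

Lemma hyp1F1_le a b z : 0 < a -> 0 < b -> 0 <= z ->
  hyp1F1 a (b + 1) z <= hyp1F1 a b z.
Proof.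
move=> a0 b0 z0; have b1 : 0 < b + 1 by rewrite addr_gt0.
have c1 := @cvg_hyp1F1 a (b + 1) z a0 b1.
have c2 := @cvg_hyp1F1 a b z a0 b0.
apply: (ler_cvg_to c1 c2); apply: nearW => n; apply: ler_sum => i _.
rewrite ler_wpM2r// ?divr_ge0 ?exprn_ge0//.
rewrite ler_pM2l ?pochhammer_gt0// lef_pV2 ?posrE ?pochhammer_gt0//.
rewrite /pochhammer; apply: ler_prod => j _.
by rewrite ltW ?ltr_wpDr//= lerD2r lerDl.
Qed.

(** For the weights d_i z^i, the mean of a nondecreasing sequence r does not decrease with z,
    because larger z favours larger indices. Cross-multiplication avoids dividing by the total
    weight. *)
Let ratio_le (r d : R^nat) z1 z2 n : 0 <= z1 <= z2 ->
  (forall i, 0 <= d i) -> {homo r : i j / (i <= j)%N >-> i <= j} ->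
  (\sum_(i < n) r i * d i * z1 ^+ i) * (\sum_(i < n) d i * z2 ^+ i) <=
  (\sum_(i < n) r i * d i * z2 ^+ i) * (\sum_(i < n) d i * z1 ^+ i).
Proof.
move=> /andP[z10 z12] d0 rr; have z20 := le_trans z10 z12.
elim: n => [|n IHn]; first by rewrite !big_ord0 mulr0.
rewrite !big_ord_recr/=.
(* Adding index n changes the difference of the two sides by d_n times the sum of (r_n - r_i) d_i
   (z2^n z1^i - z1^n z2^i), whose terms are nonnegative. *)
have : d n * (\sum_(i < n) (r n - r i) * d i * (z1 ^+ n * z2 ^+ i)) <=
       d n * (\sum_(i < n) (r n - r i) * d i * (z2 ^+ n * z1 ^+ i)).
  rewrite ler_wpM2l//; apply: ler_sum => -[i /= ni] _.
  rewrite ler_wpM2l ?mulr_ge0 ?subr_ge0 ?rr 1?ltnW//.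
  rewrite -(subnK (ltnW ni)) !exprD -!mulrA [z1 ^+ i * _]mulrC.
  by rewrite ler_wpM2r ?mulr_ge0 ?exprn_ge0// lerXn2r.
have spl z w : \sum_(i < n) (r n - r i) * d i * (z ^+ n * w ^+ i) =
    z ^+ n * (r n * (\sum_(i < n) d i * w ^+ i) - \sum_(i < n) r i * d i * w ^+ i).
  rewrite mulr_sumr -sumrB mulr_sumr; apply: eq_bigr => i _; ring.
rewrite !spl; move: IHn.
move: (\sum_(i < n) r i * d i * z1 ^+ i) (\sum_(i < n) r i * d i * z2 ^+ i)
  (\sum_(i < n) d i * z1 ^+ i) (\sum_(i < n) d i * z2 ^+ i) (z1 ^+ n) (z2 ^+ n).
move=> A1 A2 B1 B2 y1 y2 H1 H2.
rewrite -subr_ge0 in H1; rewrite -subr_ge0 in H2; rewrite -subr_ge0.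
have := addr_ge0 H1 H2; congr (is_true (0 <= _)); ring.
Qed.

(** The coefficient of z^i in z F(a, b + 1, z) is that of F(a, b, z) times r_i = i b / (a + i - 1),
    which is nondecreasing in i as a > 1. The ratio of the two functions is therefore a weighted
    mean of r, to which [ratio_le] applies before passing to the limit. *)
Lemma hyp1F1_ratio_le a b z1 z2 : 1 < a -> 0 < b -> 0 <= z1 <= z2 ->
  z1 * hyp1F1 a (b + 1) z1 * hyp1F1 a b z2 <=
  z2 * hyp1F1 a (b + 1) z2 * hyp1F1 a b z1.
Proof.
move=> a1 b0 z12; have a0 : 0 < a by rewrite (lt_trans _ a1).
have b1 : 0 < b + 1 by rewrite addr_gt0.
pose d i := pochhammer a i / pochhammer b i / i`!%:R.
pose r i : R := i%:R * b / (a + i%:R - 1).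
have d0 i : 0 <= d i by rewrite !divr_ge0// ltW// pochhammer_gt0.
have ai i : 0 < a + i%:R - 1.
  by rewrite addrAC ltr_wpDr// subr_gt0.
have rr : {homo r : i j / (i <= j)%N >-> i <= j}.
  move=> i j ij; rewrite /r ler_pdivrMr// mulrAC ler_pdivlMr//.
  have ij' : (i%:R : R) <= j%:R by rewrite ler_nat.
  have H : 0 <= (j%:R - i%:R) * (b * (a - 1)).
    by rewrite !mulr_ge0 ?subr_ge0// ltW.
  rewrite -subr_ge0; move: H; congr (is_true (0 <= _)); ring.
have cB z : (\sum_(i < n) d i * z ^+ i) @[n --> \oo] --> hyp1F1 a b z.
  have := @cvg_hyp1F1 a b z a0 b0; apply: cvg_trans; apply: near_eq_cvg.
  apply: nearW => n; rewrite /series /= big_mkord; apply: eq_bigr => i _.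
  by rewrite /d; ring.
have cA z : (\sum_(i < n) r i * d i * z ^+ i) @[n --> \oo] --> z * hyp1F1 a (b + 1) z.
  rewrite -cvg_shiftS.
  have : z * series (term a (b + 1) z) n @[n --> \oo] --> z * hyp1F1 a (b + 1) z.
    by apply: cvgMr; exact: cvg_hyp1F1.
  apply: cvg_trans; apply: near_eq_cvg; apply: nearW => n.
  rewrite /series /= big_mkord mulr_sumr big_ord_recl /= /r mul0r !mul0r add0r.
  apply: eq_bigr => i _; rewrite /= /bump /= add1n /term /d.
  rewrite (pochhammerSl b) pochhammerS exprS factS natrM -natr1.
  have h1 : a + (i%:R + 1) - 1 != 0 by have := ai i.+1; rewrite -natr1 => h; rewrite gt_eqF.
  have h2 : i%:R + 1 != 0 :> R by rewrite natr1 pnatr_eq0.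
  by field; rewrite h1 h2 (gt_eqF b0) !gt_eqF ?pochhammer_gt0 ?ltr0n ?fact_gt0.
apply: (ler_cvg_to (cvgM (cA z1) (cB z2)) (cvgM (cA z2) (cB z1))).
by apply: nearW => n; exact: ratio_le.
Qed.

End confluent_hypergeometric.

(** * The function h(m, 0, t): bounds and comparison with smaller radii *)

Section hBU.
Context {R : realType} (p k : nat) (m : R).
Hypothesis (p_ge1 : (1 <= p)%N) (m_gt0 : 0 < m).
Let a : R := (k%:R + p%:R) / 2 + 1.
Let b : R := p%:R / 2.

Let p0 : 0 < p%:R :> R. Proof. by rewrite ltr0n. Qed.
Let b0 : 0 < b. Proof. by rewrite divr_gt0. Qed.
Let b10 : 0 < b + 1. Proof. by rewrite addr_gt0. Qed.
Let a1 : 1 < a.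
Proof. by rewrite ltrDr divr_gt0// ltr_wpDl. Qed.
Let a0 : 0 < a. Proof. by rewrite (lt_trans _ a1). Qed.

Let z0 l t : 0 <= t -> 0 <= l ^+ 2 * t / (2 * (1 + t)) :> R.
Proof.
move=> t0; have t1 : 0 < 1 + t by rewrite ltr_pwDl.
by rewrite divr_ge0// mulr_ge0 ?sqr_ge0// ltW.
Qed.

Lemma measurable_hBU : measurable_fun [set: R] (hBU p k m).
Proof.
have mz : measurable_fun [set: R] (fun t : R => m ^+ 2 * t / (2 * (1 + t))).
  apply: measurable_funM; first exact: measurable_funM.
  apply: measurable_funV.
  by apply: measurable_funM => //; exact: measurable_funD.
apply: measurable_funM => //; apply: measurable_funM.
  exact: (measurableT_comp (measurable_hyp1F1 a0 b10) mz).
apply: measurable_funV.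
exact: (measurableT_comp (measurable_hyp1F1 a0 b0) mz).
Qed.

Lemma hBU_gt0 t : 0 <= t -> 0 < hBU p k m t.
Proof.
move=> t0; rewrite /hBU mulr_gt0 ?divr_gt0 ?exprn_gt0//.
  by rewrite (lt_le_trans ltr01)// hyp1F1_ge1// z0.
by rewrite (lt_le_trans ltr01)// hyp1F1_ge1// z0.
Qed.

(** Raising the second parameter lowers F. This bound is what makes the risk of the boundary uniform
    Bayes estimator finite. *)
Lemma hBU_le t : 0 <= t -> hBU p k m t <= m ^+ 2 / p%:R.
Proof.
move=> t0; rewrite /hBU; apply: ler_piMr; first by rewrite divr_ge0 ?sqr_ge0.
rewrite ler_pdivrMr ?mul1r ?hyp1F1_le ?z0//.
by rewrite (lt_le_trans ltr01)// hyp1F1_ge1// z0.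
Qed.

(** Monotonicity of z F(a, b + 1, z) / F(a, b, z) from the argument at radius l to the argument at
    the boundary radius m; for l = m the two sides coincide by the definition of [hBU]. *)
Lemma hBU_boundary (l t : R) : 0 < t -> 0 <= l <= m ->
  l ^+ 2 / p%:R * hyp1F1 a (b + 1) (l ^+ 2 / 2 * (t / (1 + t))) <=
  hBU p k m t * hyp1F1 a b (l ^+ 2 / 2 * (t / (1 + t))).
Proof.
move=> t0 /andP[l0 lm]; have t1 : 0 < 1 + t by rewrite addr_gt0.
have zE x : x ^+ 2 / 2 * (t / (1 + t)) = x ^+ 2 * t / (2 * (1 + t)) :> R.
  by field; rewrite gt_eqF.
rewrite zE /hBU -/a -/b.
have z12 : 0 <= l ^+ 2 * t / (2 * (1 + t)) <= m ^+ 2 * t / (2 * (1 + t)).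
  rewrite z0 ?(ltW t0)//= ler_pM2r ?invr_gt0 ?mulr_gt0// ler_pM2r//.
  by rewrite lerXn2r// nnegrE (le_trans l0).
have := hyp1F1_ratio_le a1 b0 z12.
have F2 : 0 < hyp1F1 a b (m ^+ 2 * t / (2 * (1 + t))).
  by rewrite (lt_le_trans ltr01)// hyp1F1_ge1// z0// ltW.
set z1 := l ^+ 2 * _ / _; set z2 := m ^+ 2 * _ / _ in F2 *.
(* The two arguments are c times l^2/p and c times m^2/p, so c cancels from the leading factors
   z. *)
pose c : R := p%:R * t / (2 * (1 + t)).
have c0 : 0 < c by rewrite divr_gt0 ?mulr_gt0.
have e (x : R) : x ^+ 2 * t / (2 * (1 + t)) = c * (x ^+ 2 / p%:R).
  by rewrite /c; field; rewrite !gt_eqF.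
have := e l; have := e m; rewrite -/z1 -/z2.
move: z1 z2 F2 {z12} => z1 z2 F2 e2 e1; rewrite [X in X * _ * _]e1 [X in _ <= X * _ * _]e2 => H.
rewrite -(ler_pM2r F2) -(ler_pM2l c0).
rewrite [leLHS](_ : _ = c * (l ^+ 2 / p%:R) * hyp1F1 a (b + 1) z1 * hyp1F1 a b z2);
  last by ring.
rewrite [leRHS](_ : _ = c * (m ^+ 2 / p%:R) * hyp1F1 a (b + 1) z2 * hyp1F1 a b z1)//.
by field; rewrite !gt_eqF.
Qed.

Let s (t : R) := t / (1 + t).

(** Pulling the first factor out of both (.)_{j+1} raises both parameters by one, so (k + p)/2
    becomes [a] and p/2 becomes [b + 1]. *)
Lemma series_alpha (l t : R) : 0 < t ->
  (\sum_(j <oo) (l ^+ (2 * j.+1) / (2 ^+ j * j`!%:R) *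
     (pochhammer ((k%:R + p%:R) / 2) j.+1 / pochhammer (p%:R / 2) j.+1) *
     s t ^+ j.+1)%:E =
   (2 * ((k%:R + p%:R) / 2) * s t * (l ^+ 2 / p%:R) *
     hyp1F1 a (b + 1) (l ^+ 2 / 2 * s t))%:E)%E.
Proof.
move=> t0; apply: nneseries_EFin.
rewrite (_ : series _ = fun n => 2 * ((k%:R + p%:R) / 2) * s t * (l ^+ 2 / p%:R) *
  series (fun i => pochhammer a i / pochhammer (b + 1) i *
    ((l ^+ 2 / 2 * s t) ^+ i / i`!%:R)) n).
  by apply: cvgMr; exact: cvg_hyp1F1.
apply/funext => n.
rewrite /series /= mulr_sumr; apply: eq_bigr => j _.
rewrite !pochhammerSl -/a -/b exprM; move: (s t) (l ^+ 2) => u L.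
rewrite !exprS !exprMn exprVn.
have A0 : pochhammer (b + 1) j != 0 by rewrite gt_eqF// pochhammer_gt0.
have j0 : j`!%:R != 0 :> R by rewrite pnatr_eq0 -lt0n fact_gt0.
have e0 : 2 ^+ j != 0 :> R by rewrite expf_neq0.
move: (pochhammer (b + 1) j) (pochhammer a j) (L ^+ j) (u ^+ j) (2 ^+ j) A0 e0.
by rewrite /b => x y z w v A0 e0; field; rewrite j0 A0 e0 gt_eqF.
Qed.

(** Here only the numerator carries the index j + 1, so the second parameter stays [b]; the
    prefactor matches that of [series_alpha] up to l^2/p. *)
Lemma series_beta (l t : R) : 0 < t ->
  (\sum_(j <oo) (2 * l ^+ (2 * j) / (2 ^+ j * j`!%:R) *
     (pochhammer ((k%:R + p%:R) / 2) j.+1 / pochhammer (p%:R / 2) j) *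
     s t ^+ j.+1)%:E =
   (2 * ((k%:R + p%:R) / 2) * s t * hyp1F1 a b (l ^+ 2 / 2 * s t))%:E)%E.
Proof.
move=> t0; apply: nneseries_EFin.
rewrite (_ : series _ = fun n => 2 * ((k%:R + p%:R) / 2) * s t *
  series (fun i => pochhammer a i / pochhammer b i *
    ((l ^+ 2 / 2 * s t) ^+ i / i`!%:R)) n).
  by apply: cvgMr; exact: cvg_hyp1F1.
apply/funext => n.
rewrite /series /= mulr_sumr; apply: eq_bigr => j _.
rewrite !pochhammerSl -/a -/b exprM; move: (s t) (l ^+ 2) => u L.
rewrite !exprS !exprMn exprVn.
have A0 : pochhammer b j != 0 by rewrite gt_eqF// pochhammer_gt0.
have j0 : j`!%:R != 0 :> R by rewrite pnatr_eq0 -lt0n fact_gt0.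
have e0 : 2 ^+ j != 0 :> R by rewrite expf_neq0.
move: (pochhammer b j) (pochhammer a j) (L ^+ j) (u ^+ j) (2 ^+ j) A0 e0.
by move=> x y z w v A0 e0; field; rewrite j0 A0 e0.
Qed.

End hBU.

(** * The statistic T and a measurability tactic *)

Section statistic.
Context {R : realType}.

(* T = |X|^2 / S^2 with S^2 = |Z|^2, and the variable T / (1 + T) in which hBU is a power series. *)
Definition tstat p k (w : p.-tuple R * k.-tuple R) : R := sqnorm w.1 / sqnorm w.2.

Definition unit_of (t : R) : R := t / (1 + t).

Lemma measurable_tstat p k : measurable_fun [set: p.-tuple R * k.-tuple R] (@tstat p k).
Proof.
apply: measurable_funM; first exact: (measurableT_comp (@measurable_sqnorm R p)).
apply: measurable_funV; exact: (measurableT_comp (@measurable_sqnorm R k)).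
Qed.

Lemma measurable_unit_of : measurable_fun [set: R] unit_of.
Proof.
apply: measurable_funM => //; apply: measurable_funV.
exact: measurable_funD.
Qed.

End statistic.

Ltac measurability :=
  repeat (first [ assumption | exact: measurable_cst | exact: measurable_sqnorm
    | exact: measurable_dot | exact: measurable_scalet
    | exact: measurable_tstat | exact: measurable_unit_of | exact: measurable_sqrt
    | exact: normr_measurable
    | exact: measurable_fst | exact: measurable_snd
    | match goal with
      | |- measurable_fun _ (EFin \o _) => apply/measurable_EFinP
      | |- measurable_fun _ (fun x => EFin _) => apply/measurable_EFinP
      | |- measurable_fun _ (fun x => (_ + _)%R) => apply: measurable_funD
      | |- measurable_fun _ (fun x => (- _)%R) => apply: measurableT_comp => //
      | |- measurable_fun _ (fun x => (_ * _)%R) => apply: measurable_funM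
      | |- measurable_fun _ (fun x => (_ ^+ _)%R) => apply: measurable_funX
      | |- measurable_fun _ (fun x => (_ ^-1)%R) => apply: measurable_funV
      | |- measurable_fun _ (fun x => expR _) =>
          apply: (measurableT_comp (@measurable_expR _))
      | |- measurable_fun _ (fun x => Num.sqrt _) =>
          apply: (measurableT_comp (@measurable_sqrt _))
      | |- measurable_fun _ (fun x => `| _ |%R) =>
          apply: (measurableT_comp (@normr_measurable _ _))
      | |- measurable_fun _ (fun x => sqnorm _) =>
          apply: (measurableT_comp (@measurable_sqnorm _ _))
      | |- measurable_fun _ (fun x => dot ?a _) =>
          apply: (measurableT_comp (measurable_dot a))
      | |- measurable_fun _ (fun x => scalet ?c _) =>
          apply: (measurableT_comp (@measurable_scalet _ _ c))
      | |- measurable_fun _ (fun x => tstat _) =>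
          apply: (measurableT_comp (@measurable_tstat _ _ _))
      | |- measurable_fun _ (fun x => unit_of _) =>
          apply: (measurableT_comp (@measurable_unit_of _))
      | H : measurable_fun _ ?f |- measurable_fun _ (fun x => ?f _) =>
          apply: (measurableT_comp H)
      end ]).

(** * Moments of the standard Gaussian vector *)

Section standard_normal.
Context {R : realType}.

Lemma expR_series (x : R) : (\sum_(j <oo) (x ^+ j / j`!%:R)%:E = (expR x)%:E)%E.
Proof. by apply: nneseries_EFin; exact: is_cvg_series_exp_coeff. Qed.

Lemma std_scaling n (c : R) (F : n.-tuple R -> \bar R) : 0 < c ->
  measurable_fun [set: n.-tuple R] F -> (forall x, 0 <= F x)%E ->
  (\int[std n]_x (F x * (expR (sqnorm x / 2))%:E) =
   (c ^+ n)%:E * \int[std n]_x (F (scalet c x) * (expR (sqnorm x / 2))%:E))%E.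
Proof.
move=> c0 mF F0; rewrite -{1}(gtr0_norm c0).
by apply: ge0_integral_std_scalet => //; rewrite gt_eqF.
Qed.

Lemma integral_std1 n : (\int[@std R n]_x 1 = 1)%E.
Proof. by rewrite integral_cst// mul1e; exact: probability_setT. Qed.

(** The dilation by c = -1, whose factor is 1, applied to F times exp(-|x|^2/2). *)
Lemma std_opp n (F : n.-tuple R -> \bar R) :
  measurable_fun [set: n.-tuple R] F -> (forall x, 0 <= F x)%E ->
  (\int[std n]_x F (scalet (-1) x) = \int[std n]_x F x)%E.
Proof.
move=> mF F0.
have m1 : (-1 : R) != 0 by rewrite oppr_eq0 oner_eq0.
have mG : measurable_fun [set: n.-tuple R] (fun x => F x * (expR (- (sqnorm x / 2)))%:E)%E.
  apply: emeasurable_funM => //.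
  by measurability.
have G0 x : (0 <= F x * (expR (- (sqnorm x / 2)))%:E)%E.
  by rewrite mule_ge0// lee_fin expR_ge0.
have := ge0_integral_std_scalet m1 mG G0.
rewrite normrN normr1 expr1n mul1e => e.
transitivity (\int[std n]_x (F (scalet (-1) x) * (expR (- (sqnorm (scalet (-1) x) / 2)))%:E *
  (expR (sqnorm x / 2))%:E))%E.
  apply: eq_integral => x _.
  by rewrite sqnorm_scalet sqrrN expr1n mul1r -muleA -EFinM -expRD addNr expR0 mule1.
rewrite -e; apply: eq_integral => x _.
by rewrite -muleA -EFinM -expRD addNr expR0 mule1.
Qed.

(** The total mass 1 of N(eta, I), rewritten through the tilt. *)
Lemma std_mgf n (eta : n.-tuple R) :
  (\int[std n]_x (expR (dot eta x))%:E = (expR (sqnorm eta / 2))%:E)%E.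
Proof.
have c10 (x : n.-tuple R) : (0 <= cst 1 x :> \bar R)%E by [].
have := ge0_integral_mvnormal_std eta ltr01 (measurable_cst _) c10.
rewrite invr1 scalet1 integral_cst// mul1e => e.
have {}e : (1 = \int[std n]_x (1 * (expR (dot eta x - sqnorm eta / 2))%:E))%E.
  by rewrite -e; apply/esym; exact: probability_setT.
rewrite -[RHS]mule1 [X in (_ * X)%E]e -ge0_integralZl//.
- by apply: eq_integral => x _; rewrite mul1e -EFinM -expRD addrC subrK.
- by apply: emeasurable_funM => //; measurability.
Qed.

Lemma std_cosh n (eta : n.-tuple R) :
  (\int[std n]_x (cosh (dot eta x))%:E = (expR (sqnorm eta / 2))%:E)%E.
Proof.
have me (a : n.-tuple R) : measurable_fun [set: n.-tuple R] (fun x => 2^-1 * expR (dot a x)).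
  by measurability.
transitivity (\int[std n]_x (2^-1 * expR (dot eta x) + 2^-1 * expR (dot (scalet (-1) eta) x))%:E)%E.
  by apply: eq_integral => x _; rewrite /cosh dot_scaletl mulN1r -mulrDr mulrC.
rewrite integral_EFinD//.
rewrite !integral_EFinZ//; try (by move=> x; rewrite expR_ge0); try by measurability.
by rewrite !std_mgf sqnorm_scalet sqrrN expr1n mul1r -EFinM -EFinD; congr EFin; field.
Qed.

(** The recursion for the homogeneous function |x|^(2l) multiplies by n + 2l = 2 (n/2 + l), twice
    the next factor of the Pochhammer symbol. *)
Lemma std_sqnorm_moment n l :
  (\int[std n]_x (sqnorm x ^+ l)%:E = (2 ^+ l * pochhammer (n%:R / 2) l)%:E :> \bar R)%E.
Proof.
elim: l => [|l IHl].
  under eq_integral do rewrite expr0.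
  by rewrite integral_std1 expr0 mul1r pochhammer0.
have ml : measurable_fun [set: n.-tuple R] (fun x => sqnorm x ^+ l) by measurability.
have := @integral_homogeneous_sqnorm R _ _ (std n) (@sqnorm R n) (@scalet R n) n
  (@sqnorm_ge0 R n) (@measurable_sqnorm R n) (@sqnorm_scalet R n) (@std_scaling n)
  (2 * l)%N (fun x => sqnorm x ^+ l) ml.
move=> e; transitivity (\int[@std R n]_x (sqnorm x ^+ l * sqnorm x)%:E)%E.
  by apply: eq_integral => x _; rewrite exprSr.
rewrite e.
- rewrite IHl -EFinM; congr EFin.
  by rewrite pochhammerS exprS natrD natrM; field.
- by move=> x; rewrite exprn_ge0// sqnorm_ge0.
- by move=> c x c0; rewrite sqnorm_scalet exprMn exprM.
- by rewrite IHl ltry.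
Qed.

(** The indicator of |x| = 0 is homogeneous of degree 0 and its product with |x|^2 vanishes, so the
    recursion reads 0 = n times the measure of the set. *)
Lemma std_sqnorm0 n : (0 < n)%N -> std n [set x : n.-tuple R | sqnorm x = 0] = 0%E.
Proof.
move=> n0.
pose phi (x : n.-tuple R) : R := \1_[set x | sqnorm x = 0] x.
have mS : measurable [set x : n.-tuple R | sqnorm x = 0].
  have := @measurable_sqnorm R n measurableT [set 0] (measurable_set1 0).
  by rewrite setTI.
have mphi : measurable_fun [set: n.-tuple R] phi by exact: measurable_indic.
have := @integral_homogeneous_sqnorm R _ _ (std n) (@sqnorm R n) (@scalet R n) n
  (@sqnorm_ge0 R n) (@measurable_sqnorm R n) (@sqnorm_scalet R n) (@std_scaling n)
  0%N phi mphi.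
have phiE : (\int[std n]_x (phi x)%:E = std n [set x : n.-tuple R | sqnorm x = 0%R])%E.
  by rewrite integral_indic// setIT.
rewrite phiE.
under eq_integral => x _.
  rewrite (_ : phi x * sqnorm x = 0); last first.
    rewrite /phi indicE; have [|] := boolP (x \in _); last by rewrite mul0r.
    by rewrite inE /= => ->; rewrite mulr0.
  over.
rewrite integral0 addn0 => e; apply/eqP.
have /esym/eqP : (0 = n%:R%:E * std n [set x : n.-tuple R | sqnorm x = 0%R])%E.
  apply: e.
  - by move=> x; rewrite /phi.
  - move=> c x c0; rewrite expr0 mul1r /phi !indicE; congr (nat_of_bool _)%:R.
    apply/idP/idP; rewrite !inE /= sqnorm_scalet.
      by move=> /eqP; rewrite mulf_eq0 expf_eq0/= gt_eqF//= => /eqP.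
    by move=> ->; rewrite mulr0.
  - by rewrite -ge0_fin_numE// fin_num_measure.
by rewrite mule_eq0 => /orP[/eqP[]/eqP|//]; rewrite pnatr_eq0 -leqn0 leqNgt n0.
Qed.

(** The mean of cosh(sqrt(y) eta.X) is exp(y |eta|^2/2) for every y in ]0, 1]; both sides are power
    series in y with nonnegative coefficients, which must agree. *)
Lemma std_dot_moment n (eta : n.-tuple R) j :
  (\int[std n]_x (dot eta x ^+ (2 * j))%:E =
   (sqnorm eta ^+ j * ((2 * j)`!%:R / (2 ^+ j * j`!%:R)))%:E)%E.
Proof.
pose M i : \bar R := (\int[std n]_x (dot eta x ^+ (2 * i))%:E)%E.
pose u i : R := fine (M i) / (2 * i)`!%:R.
pose v i : R := (sqnorm eta / 2) ^+ i / i`!%:R.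
have f0 N : N`!%:R != 0 :> R by rewrite pnatr_eq0 -lt0n fact_gt0.
have d0 (a x : n.-tuple R) i : 0 <= dot a x ^+ (2 * i).
  by rewrite exprM exprn_ge0// sqr_ge0.
have M0 i : (0 <= M i)%E by apply: integral_EFin_ge0.
have md (a : n.-tuple R) i : measurable_fun [set: n.-tuple R] (fun x => dot a x ^+ (2 * i)).
  by measurability.
have mc (a : n.-tuple R) : measurable_fun [set: n.-tuple R] (fun x => cosh (dot a x)).
  by rewrite /cosh; measurability.
have sum_int (a : n.-tuple R) : (\sum_(i <oo)
    \int[std n]_x (dot a x ^+ (2 * i) / (2 * i)`!%:R)%:E = (expR (sqnorm a / 2))%:E)%E.
  rewrite -std_cosh -integral_nneseries//.
  - by apply: eq_integral => x _; rewrite cosh_series.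
  - by move=> i; measurability.
  - by move=> i x _; rewrite lee_fin divr_ge0.
have intE (a : n.-tuple R) i : (\int[std n]_x (dot a x ^+ (2 * i) / (2 * i)`!%:R)%:E =
    ((2 * i)`!%:R^-1)%:E * \int[std n]_x (dot a x ^+ (2 * i))%:E)%E.
  rewrite -integral_EFinZ//.
  by apply: eq_integral => x _; rewrite mulrC.
(* Up to a positive factor, each moment is one nonnegative term of the finite sum [sum_int]. *)
have Moo i : (M i < +oo)%E.
  have : (\int[std n]_x (dot eta x ^+ (2 * i) / (2 * i)`!%:R)%:E < +oo)%E.
    apply: (@le_lt_trans _ _ (\sum_(i <oo)
      \int[std n]_x (dot eta x ^+ (2 * i) / (2 * i)`!%:R)%:E)%E).
      apply: (@le_trans _ _ (\sum_(0 <= l < i.+1)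
         \int[std n]_x (dot eta x ^+ (2 * l) / (2 * l)`!%:R)%:E)%E).
        rewrite big_nat_recr//= leeDr// sume_ge0// => l _.
        by apply: integral_EFin_ge0 => x; rewrite divr_ge0.
      apply: nneseries_lim_ge => l _ _.
      by apply: integral_EFin_ge0 => x; rewrite divr_ge0.
    by rewrite sum_int ltry.
  rewrite intE -/(M i) => H; rewrite ltey; apply/negP => /eqP Mi.
  by move: H; rewrite Mi gt0_muley ?ltxx// lte_fin invr_gt0 ltr0n fact_gt0.
have ME i : M i = ((2 * i)`!%:R * u i)%:E.
  by rewrite /u mulrC divfK// fineK// ge0_fin_numE.
have uv : u =1 v.
  apply: power_series_inj => [i|i|y /andP[y0 y1]|].
  - by rewrite divr_ge0// fine_ge0.
  - by rewrite divr_ge0// exprn_ge0// divr_ge0 ?sqnorm_ge0.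
  (* Replacing eta by sqrt(y) eta multiplies the moment of order 2i by y^i. *)
  - transitivity (expR (sqnorm (scalet (Num.sqrt y) eta) / 2))%:E.
      rewrite -sum_int; apply: eq_eseriesr => i _; rewrite intE.
      transitivity (((2 * i)`!%:R^-1)%:E * (y ^+ i)%:E * M i)%E.
        by rewrite ME -!EFinM; congr EFin; field.
      rewrite -muleA; congr (_ * _)%E.
      rewrite -integral_EFinZ ?exprn_ge0 ?(ltW y0)//.
      apply: eq_integral => x _.
      by rewrite dot_scaletl exprMn [X in _ = (X * _)%:E]exprM sqr_sqrtr// ltW.
    rewrite sqnorm_scalet sqr_sqrtr ?(ltW y0)// -expR_series.
    apply: eq_eseriesr => i _; rewrite /v; congr EFin.
    by rewrite -mulrA exprMn; field.
  - by rewrite /v expR_series ltry.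
rewrite -/(M j) ME uv /v; congr EFin; rewrite exprMn exprVn; field.
by rewrite f0 expf_neq0.
Qed.

Lemma std_dot_sqnorm_moment n (eta : n.-tuple R) j :
  (\int[std n]_x (dot eta x ^+ (2 * j) * sqnorm x)%:E =
   ((n + 2 * j)%:R * (sqnorm eta ^+ j * ((2 * j)`!%:R / (2 ^+ j * j`!%:R))))%:E)%E.
Proof.
have md : measurable_fun [set: n.-tuple R] (fun x => dot eta x ^+ (2 * j)).
  by measurability.
rewrite (@integral_homogeneous_sqnorm R _ _ (std n) (@sqnorm R n) (@scalet R n) n
  (@sqnorm_ge0 R n) (@measurable_sqnorm R n) (@sqnorm_scalet R n) (@std_scaling n)
  (2 * j)%N _ md).
- by rewrite std_dot_moment.
- by move=> x; rewrite exprM exprn_ge0// sqr_ge0.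
- by move=> c x c0; rewrite dot_scaletr exprMn.
- by rewrite std_dot_moment ltry.
Qed.

End standard_normal.

(** * The pair (X, Z) and the moments of |X|^2/(|X|^2 + |Z|^2) *)

Section product.
Context {R : realType} (p k : nat).
Local Notation PP := (@std R p \x @std R k)%E.
Local Notation Y := (p.-tuple R * k.-tuple R)%type.

Lemma tstat_ge0 (w : Y) : 0 <= tstat w.
Proof. by rewrite /tstat divr_ge0 ?sqnorm_ge0. Qed.

Lemma unit_of_ge0 (t : R) : 0 <= t -> 0 <= unit_of t.
Proof. by move=> t0; rewrite /unit_of divr_ge0// addr_ge0. Qed.

Lemma unit_of_gt0 (t : R) : 0 < t -> 0 < unit_of t.
Proof. by move=> t0; rewrite /unit_of divr_gt0// addr_gt0. Qed.

Lemma product_fst (F : p.-tuple R -> \bar R) : measurable_fun [set: p.-tuple R] F ->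
  (forall x, 0 <= F x)%E -> (\int[PP]_w F w.1 = \int[std p]_x F x)%E.
Proof.
move=> mF F0; rewrite (fubini_tonelli1 (fun w => F w.1))//.
  apply: eq_integral => x _; transitivity (\int[@std R k]_z cst (F x) z)%E => //.
  by rewrite integral_cst// -[RHS]mule1; congr (_ * _)%E; exact: probability_setT.
exact: (measurableT_comp mF (@measurable_fst _ _ _ _)).
Qed.

Lemma integral_product1 : (\int[PP]_w cst 1 w = 1)%E.
Proof. by rewrite (product_fst (F := cst 1%E))// integral_std1. Qed.

Lemma product_scaling c (F : Y -> \bar R) : 0 < c ->
  measurable_fun [set: Y] F -> (forall w, 0 <= F w)%E ->
  (\int[PP]_w (F w * (expR ((sqnorm w.1 + sqnorm w.2) / 2))%:E) =
   (c ^+ (p + k))%:E * \int[PP]_w (F (scalet c w.1, scalet c w.2) *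
      (expR ((sqnorm w.1 + sqnorm w.2) / 2))%:E))%E.
Proof.
move=> c0 mF F0.
have me : measurable_fun [set: Y] (fun w : Y => (expR ((sqnorm w.1 + sqnorm w.2) / 2))%:E).
  by measurability.
have ms : measurable_fun [set: Y] (fun w : Y => (scalet c w.1, scalet c w.2) : Y).
  by apply/measurable_fun_pairP; split; rewrite /comp /=; measurability.
have mFs : measurable_fun [set: Y] (fun w : Y => F (scalet c w.1, scalet c w.2)).
  exact: (measurableT_comp mF ms).
have mekz : measurable_fun [set: k.-tuple R] (fun z => (expR (sqnorm z / 2))%:E).
  by measurability.
have mekx : measurable_fun [set: p.-tuple R] (fun z => (expR (sqnorm z / 2))%:E).
  by measurability.
have key (G : Y -> \bar R) : measurable_fun [set: Y] G -> (forall w, 0 <= G w)%E ->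
   (\int[PP]_w (G w * (expR ((sqnorm w.1 + sqnorm w.2) / 2))%:E) =
    \int[std p]_x ((\int[std k]_z (G (x, z) * (expR (sqnorm z / 2))%:E)) *
       (expR (sqnorm x / 2))%:E))%E.
  move=> mG G0; rewrite (fubini_tonelli1
    (fun w => G w * (expR ((sqnorm w.1 + sqnorm w.2) / 2))%:E)%E); last 2 first.
  - exact: emeasurable_funM.
  - by move=> w; rewrite mule_ge0// lee_fin expR_ge0.
  apply: eq_integral => x _; rewrite /fubini_F/=.
  have mH : measurable_fun [set: k.-tuple R] (fun z => G (x, z) * (expR (sqnorm z / 2))%:E)%E.
    by apply: emeasurable_funM => //; exact: (measurableT_comp mG (measurable_pair1 x)).
  have H0 z : (0 <= G (x, z) * (expR (sqnorm z / 2))%:E)%E.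
    by rewrite mule_ge0// lee_fin expR_ge0.
  rewrite muleC -ge0_integralZl// ?lee_fin ?expR_ge0//.
  apply: eq_integral => z _; rewrite muleCA; congr (_ * _)%E.
  by rewrite -EFinM -expRD -mulrDl.
have mI (G : Y -> \bar R) : measurable_fun [set: Y] G -> (forall w, 0 <= G w)%E ->
   measurable_fun [set: p.-tuple R]
     (fun x => \int[std k]_z (G (x, z) * (expR (sqnorm z / 2))%:E))%E.
  move=> mG G0.
  have mH : measurable_fun [set: Y] (fun w => G w * (expR (sqnorm w.2 / 2))%:E)%E.
    by apply: emeasurable_funM => //; measurability.
  apply: (measurable_fun_fubini_tonelli_F (m2 := std k) _ mH) => w.
  by rewrite mule_ge0// lee_fin expR_ge0.
have I0 (G : Y -> \bar R) x : (forall w, 0 <= G w)%E ->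
   (0 <= \int[std k]_z (G (x, z) * (expR (sqnorm z / 2))%:E))%E.
  by move=> G0; apply: integral_ge0 => z _; rewrite mule_ge0// lee_fin expR_ge0.
rewrite key// (key (fun w => F (scalet c w.1, scalet c w.2)))//.
rewrite (std_scaling c0 (mI _ mF F0)); last by move=> x; exact: I0.
rewrite exprD EFinM -muleA; congr (_ * _)%E.
have mJ : measurable_fun [set: p.-tuple R] (fun x =>
   (\int[std k]_z (F (scalet c x, scalet c z) * (expR (sqnorm z / 2))%:E)) *
       (expR (sqnorm x / 2))%:E)%E.
  by apply: emeasurable_funM => //; exact: (mI (fun w => F (scalet c w.1, scalet c w.2))).
have J0 x : (0 <= (\int[std k]_z (F (scalet c x, scalet c z) * (expR (sqnorm z / 2))%:E)) *
       (expR (sqnorm x / 2))%:E)%E.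
  rewrite mule_ge0 ?lee_fin ?expR_ge0//.
  exact: (I0 (fun w => F (scalet c w.1, scalet c w.2))).
rewrite -ge0_integralZl// ?lee_fin ?exprn_ge0// ?ltW//.
apply: eq_integral => x _; rewrite muleA; congr (_ * _)%E.
have mFx : measurable_fun [set: k.-tuple R] (fun z => F (scalet c x, z)).
  exact: (measurableT_comp mF (measurable_pair1 (scalet c x))).
  by rewrite (std_scaling c0 mFx).
by move=> x _; exact: J0.
Qed.

Let q (w : Y) : R := sqnorm w.1 + sqnorm w.2.
(** Equal to T/(1 + T) wherever Z is nonzero. Unlike T it is bounded, and
    [frac w * q w = sqnorm w.1] holds even at the origin. *)
Let frac (w : Y) : R := sqnorm w.1 / q w.

Let q_ge0 w : 0 <= q w. Proof. by rewrite addr_ge0 ?sqnorm_ge0. Qed.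

Let measurable_q : measurable_fun [set: Y] q.
Proof. by rewrite /q; measurability. Qed.

Let measurable_frac : measurable_fun [set: Y] frac.
Proof. by rewrite /frac /q; measurability. Qed.

Let frac_ge0 w : 0 <= frac w.
Proof. by rewrite /frac divr_ge0 ?sqnorm_ge0. Qed.

Let frac_le1 w : frac w <= 1.
Proof.
rewrite /frac; have := q_ge0 w; rewrite le_eqVlt => /predU1P[<-|q0].
  by rewrite invr0 mulr0.
by rewrite ler_pdivrMr// mul1r /q lerDl sqnorm_ge0.
Qed.

Let q_scale c w : q (scalet c w.1, scalet c w.2) = c ^+ 2 * q w.
Proof. by rewrite /q/= !sqnorm_scalet mulrDr. Qed.

Let frac_scale c w : 0 < c -> frac (scalet c w.1, scalet c w.2) = frac w.
Proof.
move=> c0; rewrite /frac q_scale sqnorm_scalet invfM mulrACA divff ?mul1r//.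
by rewrite expf_neq0// gt_eqF.
Qed.

Let frac_q w : frac w * q w = sqnorm w.1.
Proof.
rewrite /frac; have := q_ge0 w; rewrite le_eqVlt => /predU1P[q0|q0].
  rewrite -q0 mulr0; move/esym/eqP : q0.
  by rewrite /q paddr_eq0 ?sqnorm_ge0// => /andP[/eqP].
by rewrite divfK// gt_eqF.
Qed.

(** [frac] is invariant under dilations, so multiplying its l-th power by q^i obeys the recursion in
    i with factors p + k + 2i. At i = l the product is |X|^(2l), whose mean is known, and one
    divides. Independence of [frac] and [q] is thus not invoked. *)
Lemma frac_moment l : (0 < k)%N ->
  (\int[PP]_w (frac w ^+ l)%:E =
   (pochhammer (p%:R / 2) l / pochhammer ((k%:R + p%:R) / 2) l)%:E)%E.
Proof.
move=> k0.
have a0 : 0 < (k%:R + p%:R) / 2 :> R by rewrite divr_gt0// ltr_pwDl ?ltr0n.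
pose A : \bar R := (\int[PP]_w (frac w ^+ l)%:E)%E.
have mf : measurable_fun [set: Y] (fun w => frac w ^+ l) by measurability.
have A0 : (0 <= A)%E by apply: integral_EFin_ge0 => w; rewrite exprn_ge0.
have Aoo : (A < +oo)%E.
  apply: (@le_lt_trans _ _ (\int[PP]_w cst 1%E w)%E); last first.
    by rewrite integral_product1 ltry.
  apply: le_integral_EFin => //.
  - by move=> w; rewrite exprn_ge0.
  - by move=> w; rewrite exprn_ile1.
have AE : A = (fine A)%:E by rewrite fineK// ge0_fin_numE.
have rec i : (\int[PP]_w (frac w ^+ l * q w ^+ i)%:E =
   (2 ^+ i * pochhammer ((k%:R + p%:R) / 2) i * fine A)%:E)%E.
  elim: i => [|i IHi].
    under eq_integral do rewrite expr0 mulr1.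
    by rewrite -/A {1}AE expr0 pochhammer0 !mul1r.
  have mfq : measurable_fun [set: Y] (fun w => frac w ^+ l * q w ^+ i) by measurability.
  transitivity (\int[PP]_w (frac w ^+ l * q w ^+ i * q w)%:E)%E.
    by apply: eq_integral => w _; rewrite -mulrA -exprSr.
  rewrite (@integral_homogeneous_sqnorm R _ _ PP q
    (fun c w => (scalet c w.1, scalet c w.2)) (p + k) q_ge0 measurable_q q_scale
    product_scaling (2 * i) _ mfq).
  - rewrite IHi -EFinM pochhammerS exprS; congr EFin.
    by rewrite natrD natrM natrD; field.
  - by move=> w; rewrite mulr_ge0 ?exprn_ge0.
  - by move=> c w c0; rewrite /= frac_scale// q_scale [(_ * q w) ^+ i]exprMn -exprM mulrCA.
  - by rewrite IHi ltry.
have e : (\int[PP]_w (frac w ^+ l * q w ^+ l)%:E =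
    (2 ^+ l * pochhammer (p%:R / 2) l)%:E)%E.
  rewrite -std_sqnorm_moment -(@product_fst (fun x => (sqnorm x ^+ l)%:E)).
  - by apply: eq_integral => w _; rewrite -exprMn frac_q.
  - by measurability.
  - by move=> x; rewrite lee_fin exprn_ge0// sqnorm_ge0.
have := rec l; rewrite e => -[] /eqP; rewrite -mulrA.
have e2 : 2 ^+ l != 0 :> R by rewrite expf_neq0.
rewrite (inj_eq (mulfI e2)) => /eqP ->.
by rewrite -/A AE mulrAC divff ?mul1r// gt_eqF// pochhammer_gt0.
Qed.

End product.

(** * Separating homogeneous functions of X from functions of T *)

Section factorization.
Context {R : realType} (p k : nat).
Hypotheses (p_gt0 : (0 < p)%N) (k_gt0 : (0 < k)%N).
Local Notation PP := (@std R p \x @std R k)%E.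
Local Notation Y := (p.-tuple R * k.-tuple R)%type.

Lemma ae_sqnorm_gt0 n : (0 < n)%N -> {ae @std R n, forall x, 0 < sqnorm x}.
Proof.
move=> n0; exists [set x | sqnorm x = 0]; split.
- have := @measurable_sqnorm R n measurableT [set 0] (measurable_set1 0).
  by rewrite setTI.
- exact: std_sqnorm0.
- move=> x /= /negP; rewrite -leNgt => x0; apply/eqP.
  by rewrite eq_le x0 sqnorm_ge0.
Qed.

Lemma ae_product_gt0 : {ae PP, forall w, 0 < sqnorm w.1 /\ 0 < sqnorm w.2}.
Proof.
have mS n : measurable [set x : n.-tuple R | sqnorm x = 0].
  have := @measurable_sqnorm R n measurableT [set 0] (measurable_set1 0).
  by rewrite setTI.
pose A : set Y := [set x : p.-tuple R | sqnorm x = 0] `*` setT.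
pose B : set Y := setT `*` [set x : k.-tuple R | sqnorm x = 0].
have mA : measurable A by exact: measurableX.
have mB : measurable B by exact: measurableX.
exists (A `|` B); split.
- exact: measurableU.
- have A0 : PP A = 0%E.
    rewrite product_measure1E//; last exact: mS.
    rewrite [X in (X * _)%E = _](_ : _ = 0%E) ?mul0e//; exact: std_sqnorm0.
  have B0 : PP B = 0%E.
    rewrite product_measure1E//; last exact: mS.
    rewrite [X in (_ * X)%E = _](_ : _ = 0%E) ?mule0//; exact: std_sqnorm0.
  apply/eqP; rewrite eq_le measure_ge0 andbT.
  apply: (le_trans (measureU2 _ mA mB)).
  rewrite -[leRHS]adde0; apply: leeD; rewrite le_eqVlt; apply/orP; left; apply/eqP.
    exact: A0.
  exact: B0.
- move=> w /= /not_andP[/negP|/negP]; rewrite -leNgt => w0; [left|right]; rewrite /A /B/=.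
  + by split => //; apply/eqP; rewrite eq_le w0 sqnorm_ge0.
  + by split => //; apply/eqP; rewrite eq_le w0 sqnorm_ge0.
Qed.

Lemma ge0_integral_ae d (T : measurableType d) (mu : {measure set T -> \bar R})
    (Q : T -> Prop) (f g : T -> \bar R) :
  {ae mu, forall w, Q w} -> measurable_fun [set: T] f -> measurable_fun [set: T] g ->
  (forall w, 0 <= f w)%E -> (forall w, 0 <= g w)%E ->
  (forall w, Q w -> f w = g w) -> (\int[mu]_w f w = \int[mu]_w g w)%E.
Proof.
move=> aeQ mf mg f0 g0 fg; apply: ge0_ae_eq_integral => //.
by apply: filterS aeQ => w Qw _; exact: fg.
Qed.

(** Two dilations decouple the variables. Substituting |x| z for z turns T into 1/|z|^2 at the cost
    of |x|^k; after exchanging the integrals, a dilation of x by sqrt(1 + |z|^2) removes z from the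
    remaining Gaussian factor. The exponent collects p from the Jacobian, 2j from H and k from
    |x|^k. *)
Let factor (H : p.-tuple R -> R) (psi : R -> R) j :
  measurable_fun [set: p.-tuple R] H -> (forall x, 0 <= H x) ->
  (forall c x, 0 < c -> H (scalet c x) = c ^+ (2 * j) * H x) ->
  measurable_fun [set: R] psi -> (forall t, 0 <= psi t) ->
  (\int[PP]_w (H w.1 * psi (tstat w))%:E =
   (\int[std p]_x (H x * enorm x ^+ k)%:E) *
   (\int[std k]_z (psi (sqnorm z)^-1 * Num.sqrt (1 + sqnorm z) ^- (p + (2 * j + k)) *
      expR (sqnorm z / 2))%:E))%E.
Proof.
move=> mH H0 HS mpsi psi0.
have menorm : measurable_fun [set: p.-tuple R] (@enorm R p).
  by apply: (measurableT_comp (@measurable_sqrt R)); exact: measurable_sqnorm.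
have enorm0 (x : p.-tuple R) : 0 <= enorm x by exact: sqrtr_ge0.
have enorm2 (x : p.-tuple R) : enorm x ^+ 2 = sqnorm x by rewrite sqr_sqrtr// sqnorm_ge0.
pose G (w : Y) : R := H w.1 * enorm w.1 ^+ k *
  (psi (sqnorm w.2)^-1 * expR ((1 - sqnorm w.1) * sqnorm w.2 / 2)).
have mHT : measurable_fun [set: Y] (fun w : Y => H w.1 * psi (tstat w)).
  apply: measurable_funM; first by measurability.
  by apply: (measurableT_comp mpsi); exact: measurable_tstat.
have mG : measurable_fun [set: Y] G.
  rewrite /G; measurability.
have G0 w : 0 <= G w.
  by rewrite /G !mulr_ge0 ?exprn_ge0 ?expR_ge0.
transitivity (\int[std p]_x \int[std k]_z (G (x, z))%:E)%E.
  rewrite (fubini_tonelli1 (fun w : Y => (H w.1 * psi (tstat w))%:E)); last 2 first.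
  - exact/measurable_EFinP.
  - by move=> w; rewrite lee_fin mulr_ge0.
  (* The dilation by |x| requires x nonzero, which is almost sure. *)
  apply: (ge0_integral_ae (ae_sqnorm_gt0 p_gt0)).
  - apply: (measurable_fun_fubini_tonelli_F (m2 := std k) (fun w : Y => (H w.1 * psi (tstat w))%:E)).
      exact/measurable_EFinP.
    by move=> w; rewrite lee_fin mulr_ge0.
  - apply: (measurable_fun_fubini_tonelli_F (m2 := std k) (EFin \o G)).
      exact/measurable_EFinP.
    by move=> w; rewrite lee_fin.
  - by move=> x; apply: integral_ge0 => z _; rewrite lee_fin mulr_ge0.
  - by move=> x; apply: integral_ge0 => z _; rewrite lee_fin.
  move=> x x0; rewrite /fubini_F.
  have r0 : 0 < enorm x by rewrite sqrtr_gt0.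
  pose F (z : k.-tuple R) : R := H x * (psi (sqnorm x / sqnorm z) * expR (- (sqnorm z / 2))).
  have mF : measurable_fun [set: k.-tuple R] (EFin \o F).
    rewrite /F; measurability.
  have F0 z : (0 <= (EFin \o F) z)%E by rewrite lee_fin !mulr_ge0 ?expR_ge0.
  transitivity (\int[std k]_z ((F z)%:E * (expR (sqnorm z / 2))%:E))%E.
    apply: eq_integral => z _; rewrite -EFinM /F /tstat/= -!mulrA -expRD addNr expR0.
    by rewrite mulr1.
  transitivity ((enorm x ^+ k)%:E * \int[std k]_z ((EFin \o F) (scalet (enorm x) z) *
      (expR (sqnorm z / 2))%:E))%E; first exact: (std_scaling r0 mF F0).
  have mFs : measurable_fun [set: k.-tuple R]
      (fun z => F (scalet (enorm x) z) * expR (sqnorm z / 2)) by rewrite /F; measurability.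
  have Fs0 z : 0 <= F (scalet (enorm x) z) * expR (sqnorm z / 2).
    by rewrite /F !mulr_ge0 ?expR_ge0.
  have rk0 : 0 <= enorm x ^+ k by rewrite exprn_ge0.
  apply: (etrans (esym (@integral_EFinZ _ _ _ (std k) _ _ mFs Fs0 rk0))).
  apply: eq_integral => z _; rewrite /F /G/= sqnorm_scalet enorm2; congr EFin.
  have -> : sqnorm x / (sqnorm x * sqnorm z) = (sqnorm z)^-1.
    by rewrite invfM mulrA divff ?mul1r// gt_eqF.
  have -> : (1 - sqnorm x) * sqnorm z / 2 = - (sqnorm x * sqnorm z / 2) + sqnorm z / 2 by field.
  by rewrite expRD; ring.
rewrite (fubini_tonelli (fun w => (G w)%:E)); last 2 first.
- exact/measurable_EFinP.
- by move=> w; rewrite lee_fin.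
have mHk : measurable_fun [set: p.-tuple R] (fun x => H x * enorm x ^+ k).
  by apply: measurable_funM => //; exact: measurable_funX.
have Hk0 x : 0 <= H x * enorm x ^+ k by rewrite mulr_ge0 ?exprn_ge0.
set A := (\int[std p]_x (H x * enorm x ^+ k)%:E)%E.
have A0 : (0 <= A)%E by exact: integral_EFin_ge0.
rewrite -ge0_integralZl//; last 2 first.
- by measurability.
- by move=> z _; rewrite lee_fin !mulr_ge0 ?invr_ge0 ?exprn_ge0 ?sqrtr_ge0 ?expR_ge0.
apply: eq_integral => z _.
(* With this c, dilating the weighted integral [A] leaves exp(-|x|^2 |z|^2/2), exactly the
   x-dependent exponential of [G]. *)
set c := Num.sqrt (1 + sqnorm z).
have s1 : 0 < 1 + sqnorm z by rewrite ltr_pwDl ?sqnorm_ge0.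
have c0 : 0 < c by rewrite sqrtr_gt0.
have c2 : c ^+ 2 = 1 + sqnorm z by rewrite sqr_sqrtr// ltW.
pose F x : R := H x * enorm x ^+ k * expR (- (sqnorm x / 2)).
have mF : measurable_fun [set: p.-tuple R] (EFin \o F) by rewrite /F; measurability.
have F0 x : (0 <= (EFin \o F) x)%E by rewrite lee_fin !mulr_ge0 ?expR_ge0 ?exprn_ge0.
have AE : A = (\int[std p]_x ((EFin \o F) x * (expR (sqnorm x / 2))%:E))%E.
  by apply: eq_integral => x _; rewrite -EFinM /F -!mulrA -expRD addNr expR0 mulr1.
rewrite AE (std_scaling c0 mF F0).
pose I : \bar R := (\int[std p]_x (H x * enorm x ^+ k * expR (- (sqnorm x * sqnorm z / 2)))%:E)%E.
have mI : measurable_fun [set: p.-tuple R]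
    (fun x => H x * enorm x ^+ k * expR (- (sqnorm x * sqnorm z / 2))) by measurability.
have I0 x : 0 <= H x * enorm x ^+ k * expR (- (sqnorm x * sqnorm z / 2)).
  by rewrite mulr_ge0// expR_ge0.
have -> : (\int[std p]_x ((EFin \o F) (scalet c x) * (expR (sqnorm x / 2))%:E) =
    (c ^+ (2 * j + k))%:E * I)%E.
  have cjk0 : 0 <= c ^+ (2 * j + k) by rewrite exprn_ge0// ltW.
  rewrite /I -(@integral_EFinZ _ _ _ (std p) _ _ mI I0 cjk0).
  apply: eq_integral => x _; rewrite -EFinM /F/=; congr EFin.
  have -> : enorm (scalet c x) = c * enorm x.
    by rewrite /enorm sqnorm_scalet sqrtrM ?sqr_ge0// sqrtr_sqr gtr0_norm.
  rewrite HS// exprMn exprD sqnorm_scalet c2.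
  have -> : - (sqnorm x * sqnorm z / 2) = - ((1 + sqnorm z) * sqnorm x / 2) + sqnorm x / 2.
    by field.
  by rewrite expRD; ring.
transitivity ((psi (sqnorm z)^-1 * expR (sqnorm z / 2))%:E * I)%E.
  have pe0 : 0 <= psi (sqnorm z)^-1 * expR (sqnorm z / 2) by rewrite mulr_ge0 ?expR_ge0.
  rewrite /I -(@integral_EFinZ _ _ _ (std p) _ _ mI I0 pe0).
  apply: eq_integral => x _; rewrite /G/=; congr EFin.
  have -> : (1 - sqnorm x) * sqnorm z / 2 = sqnorm z / 2 + - (sqnorm x * sqnorm z / 2) by field.
  by rewrite expRD; ring.
rewrite muleA -EFinM -exprD muleAC -EFinM; congr (_ * _)%E; congr EFin.
by field; rewrite expf_neq0// gt_eqF.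
Qed.

(* The factor depending on psi is the same for H and for 1, up to the power of u. *)
Lemma factorization (H : p.-tuple R -> R) (psi : R -> R) j :
  measurable_fun [set: p.-tuple R] H -> (forall x, 0 <= H x) ->
  (forall c x, 0 < c -> H (scalet c x) = c ^+ (2 * j) * H x) ->
  measurable_fun [set: R] psi -> (forall t, 0 <= psi t) ->
  ((\int[PP]_w (H w.1 * psi (tstat w))%:E) * (\int[PP]_w (unit_of (tstat w) ^+ j)%:E) =
   (\int[std p]_x (H x)%:E) * (\int[PP]_w (psi (tstat w) * unit_of (tstat w) ^+ j)%:E))%E.
Proof.
move=> mH H0 HS mpsi psi0.
(* The absolute value makes this function nonnegative on the whole line, as [factor] demands; T is
   nonnegative, so nothing changes along T. *)
have mu1 : measurable_fun [set: R] (fun t => unit_of `|t| ^+ j).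
  apply: measurable_funX.
  by apply: (measurableT_comp (@measurable_unit_of R)); exact: normr_measurable.
have u0 (t : R) : 0 <= unit_of `|t| ^+ j by rewrite exprn_ge0// unit_of_ge0.
have mpu : measurable_fun [set: R] (fun t => psi t * unit_of `|t| ^+ j) by exact: measurable_funM.
have pu0 t : 0 <= psi t * unit_of `|t| ^+ j by rewrite mulr_ge0.
have m1 : measurable_fun [set: p.-tuple R] (cst (1 : R)) by [].
(* At t = 1/|z|^2 one has t/(1 + t) = 1/(1 + |z|^2), so its j-th power supplies the 2j missing from
   the exponent in degree 0. *)
have K (chi : R -> R) : measurable_fun [set: R] chi -> (forall t, 0 <= chi t) ->
  (\int[std k]_z (chi (sqnorm z)^-1 * unit_of `|(sqnorm z)^-1| ^+ j *
      Num.sqrt (1 + sqnorm z) ^- (p + (2 * 0 + k)) * expR (sqnorm z / 2))%:E =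
   \int[std k]_z (chi (sqnorm z)^-1 * Num.sqrt (1 + sqnorm z) ^- (p + (2 * j + k)) *
      expR (sqnorm z / 2))%:E)%E.
  move=> mchi chi0; apply: (ge0_integral_ae (ae_sqnorm_gt0 k_gt0)).
  - by measurability.
  - by measurability.
  - by move=> z; rewrite lee_fin !mulr_ge0 ?invr_ge0 ?exprn_ge0 ?sqrtr_ge0 ?expR_ge0 ?unit_of_ge0.
  - by move=> z; rewrite lee_fin !mulr_ge0 ?invr_ge0 ?exprn_ge0 ?sqrtr_ge0 ?expR_ge0.
  move=> z z0; congr EFin; congr (_ * _); rewrite -mulrA; congr (_ * _).
  have s1 : 0 < 1 + sqnorm z by rewrite addr_gt0.
  have c0 : Num.sqrt (1 + sqnorm z) != 0 by rewrite gt_eqF// sqrtr_gt0.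
  have -> : unit_of `|(sqnorm z)^-1| = Num.sqrt (1 + sqnorm z) ^- 2.
    rewrite sqr_sqrtr ?(ltW s1)// gtr0_norm ?invr_gt0// /unit_of; field.
    by rewrite !gt_eqF//= addrC.
  rewrite exprVn -exprM -invfM -exprD; congr (_ ^- _).
  by rewrite muln0 add0n addnCA.
have sc1 c (x : p.-tuple R) : 0 < c -> cst (1 : R) (scalet c x) = c ^+ (2 * 0) * cst (1 : R) x.
  by rewrite muln0 expr0 mul1r.
have tn (w : Y) : `|tstat w| = tstat w by rewrite ger0_norm// tstat_ge0.
have ge1 (x : p.-tuple R) : 0 <= cst (1 : R) x by rewrite /=.
(* [factor] for (H, psi), (1, u^j), (H, 1) and (1, psi u^j): the x-factors and z-factors of the
   first two are those of the last two, paired differently. *)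
have E1 := factor mH H0 HS mpsi psi0.
have E2 := factor m1 ge1 sc1 mu1 u0.
have m1' : measurable_fun [set: R] (cst (1 : R)) by [].
have E3 := factor mH H0 HS m1' (fun=> ler01).
have E4 := factor m1 ge1 sc1 mpu pu0.
have K1 := K _ mpsi psi0.
have K2 := K _ m1' (fun=> ler01).
have F1 : (\int[PP]_w (H w.1 * cst (1 : R) (tstat w))%:E = \int[std p]_x (H x)%:E)%E.
  rewrite -(@product_fst R p k (fun x => (H x)%:E)).
  - by apply: eq_integral => w _; rewrite mulr1.
  - exact/measurable_EFinP.
  - by move=> x; rewrite lee_fin.
have F2 : (\int[PP]_w (cst (1 : R) w.1 * unit_of `|tstat w| ^+ j)%:E =
   \int[PP]_w (unit_of (tstat w) ^+ j)%:E)%E.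
  by apply: eq_integral => w _; rewrite mul1r tn.
have F3 : (\int[PP]_w (cst (1 : R) w.1 * (psi (tstat w) * unit_of `|tstat w| ^+ j))%:E =
   \int[PP]_w (psi (tstat w) * unit_of (tstat w) ^+ j)%:E)%E.
  by apply: eq_integral => w _; rewrite mul1r tn.
rewrite -F1 -F2 -F3 E1 E2 E3 E4 K1.
under [X in (_ * _ * (_ * X))%E = _]eq_integral do rewrite -[unit_of _ ^+ j]mul1r.
by rewrite K2 muleACA [RHS]muleACA; congr (_ * _)%E; rewrite muleC.
Qed.

Lemma unit_of_moment j :
  (\int[PP]_w (unit_of (tstat w) ^+ j)%:E =
   (pochhammer (p%:R / 2) j / pochhammer ((k%:R + p%:R) / 2) j)%:E :> \bar R)%E.
Proof.
rewrite -frac_moment//; apply: (ge0_integral_ae ae_product_gt0).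
- apply/measurable_EFinP; apply: measurable_funX.
  by apply: (measurableT_comp (@measurable_unit_of R)); exact: measurable_tstat.
- by measurability.
- by move=> w; rewrite lee_fin exprn_ge0// unit_of_ge0// tstat_ge0.
- by move=> w; rewrite lee_fin exprn_ge0// divr_ge0 ?addr_ge0 ?sqnorm_ge0.
move=> w [w1 w2]; congr EFin; congr (_ ^+ _); rewrite /unit_of /tstat; field.
by rewrite !gt_eqF ?addr_gt0// addrC.
Qed.

(** [factorization] divided by the mean of u^j; the inverted ratio of Pochhammer symbols is the
    origin of the hypergeometric coefficients. *)
Let moment (H : p.-tuple R -> R) (psi : R -> R) j h :
  measurable_fun [set: p.-tuple R] H -> (forall x, 0 <= H x) ->
  (forall c x, 0 < c -> H (scalet c x) = c ^+ (2 * j) * H x) ->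
  measurable_fun [set: R] psi -> (forall t, 0 <= psi t) ->
  (\int[std p]_x (H x)%:E = h%:E)%E -> 0 <= h ->
  (\int[PP]_w (H w.1 * psi (tstat w))%:E =
   (h * (pochhammer ((k%:R + p%:R) / 2) j / pochhammer (p%:R / 2) j))%:E *
   \int[PP]_w (psi (tstat w) * unit_of (tstat w) ^+ j)%:E)%E.
Proof.
move=> mH H0 HS mpsi psi0 Hh h0.
have := factorization mH H0 HS mpsi psi0; rewrite unit_of_moment Hh => e.
have a0 : 0 < pochhammer ((k%:R + p%:R) / 2 : R) j.
  by rewrite pochhammer_gt0// divr_gt0// ltr_pwDl ?ltr0n.
have b0 : 0 < pochhammer (p%:R / 2 : R) j by rewrite pochhammer_gt0// divr_gt0// ltr0n.
rewrite EFinM -muleA muleCA -e muleCA -EFinM mulrA divfK ?gt_eqF// divff ?gt_eqF//.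
by rewrite mule1.
Qed.

Lemma dot_psi_moment (eta : p.-tuple R) (psi : R -> R) j :
  measurable_fun [set: R] psi -> (forall t, 0 <= psi t) ->
  (\int[PP]_w (dot eta w.1 ^+ (2 * j) * psi (tstat w))%:E =
   ((sqnorm eta ^+ j * ((2 * j)`!%:R / (2 ^+ j * j`!%:R))) *
     (pochhammer ((k%:R + p%:R) / 2) j / pochhammer (p%:R / 2) j))%:E *
   \int[PP]_w (psi (tstat w) * unit_of (tstat w) ^+ j)%:E)%E.
Proof.
move=> mpsi psi0.
have d0 (x : p.-tuple R) : 0 <= dot eta x ^+ (2 * j) by rewrite exprM exprn_ge0// sqr_ge0.
apply: (@moment (fun x => dot eta x ^+ (2 * j))) => //.
- by measurability.
- by move=> c x c0; rewrite dot_scaletr exprMn.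
- exact: std_dot_moment.
- by rewrite mulr_ge0 ?exprn_ge0 ?sqnorm_ge0// divr_ge0// mulr_ge0// exprn_ge0.
Qed.

Lemma dot_sqnorm_psi_moment (eta : p.-tuple R) (psi : R -> R) j :
  measurable_fun [set: R] psi -> (forall t, 0 <= psi t) ->
  (\int[PP]_w (dot eta w.1 ^+ (2 * j) * sqnorm w.1 * psi (tstat w))%:E =
   (((p + 2 * j)%:R * (sqnorm eta ^+ j * ((2 * j)`!%:R / (2 ^+ j * j`!%:R)))) *
     (pochhammer ((k%:R + p%:R) / 2) j.+1 / pochhammer (p%:R / 2) j.+1))%:E *
   \int[PP]_w (psi (tstat w) * unit_of (tstat w) ^+ j.+1)%:E)%E.
Proof.
move=> mpsi psi0.
have d0 (x : p.-tuple R) : 0 <= dot eta x ^+ (2 * j) by rewrite exprM exprn_ge0// sqr_ge0.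
apply: (@moment (fun x => dot eta x ^+ (2 * j) * sqnorm x)) => //.
- by measurability.
- by move=> x; rewrite mulr_ge0// sqnorm_ge0.
- by move=> c x c0; rewrite dot_scaletr sqnorm_scalet exprMn mulnS exprD; ring.
- exact: std_dot_sqnorm_moment.
- by rewrite !mulr_ge0 ?exprn_ge0 ?sqnorm_ge0// divr_ge0// mulr_ge0// exprn_ge0.
Qed.

End factorization.

(** * The key inequality between the sinh and cosh means *)

Section main_inequality.
Context {R : realType} (p k : nat) (m : R).
Hypotheses (p_gt0 : (0 < p)%N) (k_gt0 : (0 < k)%N) (m_gt0 : 0 < m).
Local Notation PP := (@std R p \x @std R k)%E.
Local Notation Y := (p.-tuple R * k.-tuple R)%type.
(** Nonnegative at every real t, as [factorization] requires of functions of T, and equal to [hBU]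
    for t >= 0. *)
Local Notation hpos t := (Num.max 0 (hBU p k m t)).

Lemma sqr_enorm n (x : n.-tuple R) : enorm x ^+ 2 = sqnorm x.
Proof. by rewrite sqr_sqrtr// sqnorm_ge0. Qed.

Lemma enorm_ge0 n (x : n.-tuple R) : 0 <= enorm x.
Proof. exact: sqrtr_ge0. Qed.

Lemma measurable_hpos : measurable_fun [set: R] (fun t => hpos t).
Proof. by apply: measurable_maxr => //; exact: measurable_hBU. Qed.

(** Dividing the moment of order 2j + 2 by (2j + 1)! leaves 2(j + 1), which reduces 2^(j+1) (j + 1)!
    to 2^j j!. *)
Let sinh_term (eta : p.-tuple R) (g : R -> R) j :
  measurable_fun [set: R] g -> (forall t, 0 <= g t) ->
  (\int[PP]_w (g (tstat w) * (dot eta w.1 ^+ (2 * j.+1) / (2 * j).+1`!%:R))%:E =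
   \int[PP]_w (g (tstat w) * (enorm eta ^+ (2 * j.+1) / (2 ^+ j * j`!%:R) *
     (pochhammer ((k%:R + p%:R) / 2) j.+1 / pochhammer (p%:R / 2) j.+1) *
     unit_of (tstat w) ^+ j.+1))%:E)%E.
Proof.
move=> mg g0.
have f0 N : N`!%:R != 0 :> R by rewrite pnatr_eq0 -lt0n fact_gt0.
have mdg : measurable_fun [set: Y] (fun w => dot eta w.1 ^+ (2 * j.+1) * g (tstat w)).
  by measurability.
have mug : measurable_fun [set: Y] (fun w => g (tstat w) * unit_of (tstat w) ^+ j.+1).
  by measurability.
have dg0 (w : Y) : 0 <= dot eta w.1 ^+ (2 * j.+1) * g (tstat w).
  by rewrite mulr_ge0// exprM exprn_ge0// sqr_ge0.
have ug0 (w : Y) : 0 <= g (tstat w) * unit_of (tstat w) ^+ j.+1.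
  by rewrite mulr_ge0// exprn_ge0// unit_of_ge0// tstat_ge0.
set C : R := pochhammer _ _ / pochhammer _ _.
have C0 : 0 <= C.
  by rewrite divr_ge0// ltW// pochhammer_gt0// divr_gt0// ?ltr0n// ltr_pwDl ?ltr0n.
have K0 : 0 <= (2 * j).+1`!%:R^-1 :> R by rewrite invr_ge0.
have A0 : 0 <= enorm eta ^+ (2 * j.+1) / (2 ^+ j * j`!%:R) * C.
  by rewrite mulr_ge0// divr_ge0 ?exprn_ge0 ?enorm_ge0// mulr_ge0// exprn_ge0.
transitivity (((2 * j).+1`!%:R^-1)%:E * \int[PP]_w (dot eta w.1 ^+ (2 * j.+1) * g (tstat w))%:E)%E.
  rewrite -(@integral_EFinZ _ _ _ PP _ _ mdg dg0 K0).
  by apply: eq_integral => w _; congr EFin; ring.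
transitivity ((enorm eta ^+ (2 * j.+1) / (2 ^+ j * j`!%:R) * C)%:E *
   \int[PP]_w (g (tstat w) * unit_of (tstat w) ^+ j.+1)%:E)%E; last first.
  rewrite -(@integral_EFinZ _ _ _ PP _ _ mug ug0 A0).
  by apply: eq_integral => w _; congr EFin; ring.
rewrite dot_psi_moment// muleA -EFinM -/C; congr (_%:E * _)%E.
rewrite exprM sqr_enorm mulnS !addSn add0n !factS !natrM exprS.
have e0 : 2 ^+ j != 0 :> R by rewrite expf_neq0.
have s1 : 1 + 2 * j%:R != 0 :> R by rewrite gt_eqF// ltr_pwDl// mulr_ge0.
have s2 : (2 * j).+2%:R = 2 * (j%:R + 1) :> R.
  by rewrite -addn2 natrD natrM; ring.
have s3 : j%:R + 1 != 0 :> R by rewrite natr1 pnatr_eq0.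
rewrite s2 (exprS 2 j) -[j.+1%:R]natr1; field.
by rewrite s1 s3 e0 !f0.
Qed.

(** The factor |X|^2 contributes p + 2j = 2 (p/2 + j), which cancels the last factor of (p/2)_{j+1}
    and leaves the 2. *)
Let cosh_term (eta : p.-tuple R) (g : R -> R) j :
  measurable_fun [set: R] g -> (forall t, 0 <= g t) ->
  (\int[PP]_w (g (tstat w) * (sqnorm w.1 * (dot eta w.1 ^+ (2 * j) / (2 * j)`!%:R)))%:E =
   \int[PP]_w (g (tstat w) * (2 * enorm eta ^+ (2 * j) / (2 ^+ j * j`!%:R) *
     (pochhammer ((k%:R + p%:R) / 2) j.+1 / pochhammer (p%:R / 2) j) *
     unit_of (tstat w) ^+ j.+1))%:E)%E.
Proof.
move=> mg g0.
have f0 N : N`!%:R != 0 :> R by rewrite pnatr_eq0 -lt0n fact_gt0.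
have mdg : measurable_fun [set: Y]
    (fun w => dot eta w.1 ^+ (2 * j) * sqnorm w.1 * g (tstat w)) by measurability.
have mug : measurable_fun [set: Y] (fun w => g (tstat w) * unit_of (tstat w) ^+ j.+1).
  by measurability.
have dg0 (w : Y) : 0 <= dot eta w.1 ^+ (2 * j) * sqnorm w.1 * g (tstat w).
  by rewrite !mulr_ge0 ?sqnorm_ge0// exprM exprn_ge0// sqr_ge0.
have ug0 (w : Y) : 0 <= g (tstat w) * unit_of (tstat w) ^+ j.+1.
  by rewrite mulr_ge0// exprn_ge0// unit_of_ge0// tstat_ge0.
have b0 : 0 < p%:R / 2 :> R by rewrite divr_gt0// ltr0n.
have a0 : 0 < (k%:R + p%:R) / 2 :> R by rewrite divr_gt0// ltr_pwDl ?ltr0n.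
set C : R := pochhammer _ _ / pochhammer _ _.
have C0 : 0 <= C by rewrite divr_ge0// ltW// pochhammer_gt0.
have K0 : 0 <= (2 * j)`!%:R^-1 :> R by rewrite invr_ge0.
have A0 : 0 <= 2 * enorm eta ^+ (2 * j) / (2 ^+ j * j`!%:R) * C.
  by rewrite mulr_ge0// divr_ge0 ?mulr_ge0 ?exprn_ge0 ?enorm_ge0.
transitivity (((2 * j)`!%:R^-1)%:E *
    \int[PP]_w (dot eta w.1 ^+ (2 * j) * sqnorm w.1 * g (tstat w))%:E)%E.
  rewrite -(@integral_EFinZ _ _ _ PP _ _ mdg dg0 K0).
  by apply: eq_integral => w _; congr EFin; ring.
transitivity ((2 * enorm eta ^+ (2 * j) / (2 ^+ j * j`!%:R) * C)%:E *
   \int[PP]_w (g (tstat w) * unit_of (tstat w) ^+ j.+1)%:E)%E; last first.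
  rewrite -(@integral_EFinZ _ _ _ PP _ _ mug ug0 A0).
  by apply: eq_integral => w _; congr EFin; ring.
rewrite dot_sqnorm_psi_moment// muleA -EFinM /C; congr (_%:E * _)%E.
rewrite exprM sqr_enorm (pochhammerS (p%:R / 2)) natrD natrM.
have e0 : 2 ^+ j != 0 :> R by rewrite expf_neq0.
have p0 : pochhammer (p%:R / 2 : R) j != 0 by rewrite gt_eqF// pochhammer_gt0.
have p1 : p%:R / 2 + j%:R != 0 :> R by rewrite gt_eqF// ltr_wpDr.
have p2 : p%:R + 2 * j%:R != 0 :> R.
  by have := p1; apply: contra => /eqP e; apply/eqP; lra.
have -> : p%:R / 2 + j%:R = (p%:R + 2 * j%:R) / 2 :> R by field.
by field; rewrite p2 p0 e0 !f0.
Qed.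

Lemma mean_dot_le (eta : p.-tuple R) (g : R -> R) :
  enorm eta <= m -> measurable_fun [set: R] g -> (forall t, 0 <= g t) ->
  (\int[PP]_w (g (tstat w) * (dot eta w.1 * sinh (dot eta w.1)))%:E <=
   \int[PP]_w (g (tstat w) * hpos (tstat w) * (sqnorm w.1 * cosh (dot eta w.1)))%:E)%E.
Proof.
move=> etam mg g0.
have mgh : measurable_fun [set: R] (fun t => g t * hpos t).
  by apply: measurable_funM => //; exact: measurable_hpos.
have hp0 t : 0 <= hpos t by rewrite le_max lexx.
have gh0 t : 0 <= g t * hpos t by rewrite mulr_ge0.
have d0 (w : Y) i : 0 <= dot eta w.1 ^+ (2 * i) by rewrite exprM exprn_ge0// sqr_ge0.
have b0 : 0 < p%:R / 2 :> R by rewrite divr_gt0// ltr0n.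
have a0 : 0 < (k%:R + p%:R) / 2 :> R by rewrite divr_gt0// ltr_pwDl ?ltr0n.
have u0 (w : Y) : 0 <= unit_of (tstat w) by rewrite unit_of_ge0// tstat_ge0.
(* [al j] and [be j] depend on w only through T and play the role of the conditional means, given T,
   of the j-th terms of the two expansions. *)
pose al j (w : Y) : R := enorm eta ^+ (2 * j.+1) / (2 ^+ j * j`!%:R) *
     (pochhammer ((k%:R + p%:R) / 2) j.+1 / pochhammer (p%:R / 2) j.+1) *
     unit_of (tstat w) ^+ j.+1.
pose be j (w : Y) : R := 2 * enorm eta ^+ (2 * j) / (2 ^+ j * j`!%:R) *
     (pochhammer ((k%:R + p%:R) / 2) j.+1 / pochhammer (p%:R / 2) j) *
     unit_of (tstat w) ^+ j.+1.
have al0 j w : 0 <= al j w.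
  rewrite mulr_ge0 ?exprn_ge0// mulr_ge0//.
    by rewrite divr_ge0 ?exprn_ge0 ?enorm_ge0// mulr_ge0// exprn_ge0.
  by rewrite divr_ge0// ltW// pochhammer_gt0.
have be0 j w : 0 <= be j w.
  rewrite mulr_ge0 ?exprn_ge0// mulr_ge0//.
    by rewrite divr_ge0 ?mulr_ge0 ?exprn_ge0 ?enorm_ge0.
  by rewrite divr_ge0// ltW// pochhammer_gt0.
have mal j : measurable_fun [set: Y] (fun w => g (tstat w) * al j w).
  by rewrite /al; measurability.
have mghT : measurable_fun [set: Y] (fun w => g (tstat w) * hpos (tstat w)).
  by apply: (measurableT_comp mgh); exact: measurable_tstat.
have mbe j : measurable_fun [set: Y] (fun w => g (tstat w) * hpos (tstat w) * be j w).
  by rewrite /be; measurability.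
have -> : (\int[PP]_w (g (tstat w) * (dot eta w.1 * sinh (dot eta w.1)))%:E =
    \int[PP]_w (\sum_(j <oo) (g (tstat w) * al j w)%:E))%E.
  transitivity (\int[PP]_w (\sum_(j <oo)
     (g (tstat w) * (dot eta w.1 ^+ (2 * j.+1) / (2 * j).+1`!%:R))%:E))%E.
    apply: eq_integral => w _; rewrite EFinM -sinh_series -nneseriesZl.
      by apply: eq_eseriesr => j _; rewrite EFinM.
    by move=> j _; rewrite lee_fin divr_ge0.
  rewrite !integral_nneseries//; first by apply: eq_eseriesr => j _; exact: sinh_term.
  - by move=> j; apply/measurable_EFinP; exact: mal.
  - by move=> j w _; rewrite lee_fin mulr_ge0.
  - by move=> j; measurability.
  - by move=> j w _; rewrite lee_fin mulr_ge0// divr_ge0.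
have -> : (\int[PP]_w (g (tstat w) * hpos (tstat w) * (sqnorm w.1 * cosh (dot eta w.1)))%:E =
    \int[PP]_w (\sum_(j <oo) (g (tstat w) * hpos (tstat w) * be j w)%:E))%E.
  transitivity (\int[PP]_w (\sum_(j <oo) (g (tstat w) * hpos (tstat w) *
      (sqnorm w.1 * (dot eta w.1 ^+ (2 * j) / (2 * j)`!%:R)))%:E))%E.
    apply: eq_integral => w _; rewrite mulrA EFinM -cosh_series -nneseriesZl.
      by apply: eq_eseriesr => j _; rewrite -EFinM mulrA.
    by move=> j _; rewrite lee_fin divr_ge0.
  rewrite !integral_nneseries//.
  - by apply: eq_eseriesr => j _; exact: (cosh_term eta j mgh gh0).
  - by move=> j; apply/measurable_EFinP; exact: mbe.
  - by move=> j w _; rewrite lee_fin mulr_ge0.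
  - by move=> j; measurability.
  - by move=> j w _; rewrite lee_fin mulr_ge0// mulr_ge0 ?sqnorm_ge0// divr_ge0.
(* With both integrands now functions of T, the inequality holds pointwise wherever T > 0. *)
apply: ae_ge0_le_integral => //.
- by move=> w _; apply: nneseries_ge0 => j _ _; rewrite lee_fin mulr_ge0.
- apply: ge0_emeasurable_sum => [j w _ _|j _]; first by rewrite lee_fin mulr_ge0.
  by apply/measurable_EFinP; exact: mal.
- by move=> w _; apply: nneseries_ge0 => j _ _; rewrite lee_fin mulr_ge0.
- apply: ge0_emeasurable_sum => [j w _ _|j _]; first by rewrite lee_fin mulr_ge0.
  by apply/measurable_EFinP; exact: mbe.
apply: filterS (ae_product_gt0 p_gt0 k_gt0) => w [w1 w2] _.
have t0 : 0 < tstat w by rewrite /tstat divr_gt0.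
under eq_eseriesr do rewrite EFinM.
rewrite nneseriesZl; last by move=> j _; rewrite lee_fin.
under [leRHS]eq_eseriesr do rewrite EFinM.
rewrite nneseriesZl; last by move=> j _; rewrite lee_fin.
rewrite series_alpha// series_beta// -!EFinM lee_fin -[leRHS]mulrA ler_wpM2l//.
have -> : hpos (tstat w) = hBU p k m (tstat w).
  by apply/max_idPr; rewrite ltW// hBU_gt0// ltW.
rewrite -[leLHS]mulrA [leRHS]mulrCA ler_wpM2l//.
  by rewrite mulr_ge0 ?(ltW (unit_of_gt0 t0))// mulr_ge0// ltW.
by apply: hBU_boundary => //; rewrite enorm_ge0.
Qed.

End main_inequality.

(** * The risk as a Gaussian integral *)

Section risk.
Context {R : realType} (p k : nat).
Local Notation PP := (@std R p \x @std R k)%E.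
Local Notation Y := (p.-tuple R * k.-tuple R)%type.

Lemma product_opp (F : Y -> \bar R) : measurable_fun [set: Y] F ->
  (forall w, 0 <= F w)%E ->
  (\int[PP]_w F (scalet (-1) w.1, w.2) = \int[PP]_w F w)%E.
Proof.
move=> mF F0.
have ms : measurable_fun [set: Y] (fun w : Y => (scalet (-1) w.1, w.2) : Y).
  by apply/measurable_fun_pairP; split; rewrite /comp /=; measurability.
have mFs : measurable_fun [set: Y] (fun w : Y => F (scalet (-1) w.1, w.2)).
  exact: (measurableT_comp mF ms).
rewrite (fubini_tonelli1 _ mF F0) (fubini_tonelli1 _ mFs)//.
apply: (etrans (fubini_tonelli _ mFs (fun w => F0 _))).
apply: esym; apply: (etrans (fubini_tonelli _ mF F0)); apply: esym.
apply: eq_integral => z _; apply: (std_opp (F := fun x => F (x, z))) => //.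
exact: (measurableT_comp mF (measurable_pair2 z)).
Qed.

(** Only X carries the tilt: S^2 is sigma^2 |Z|^2 with Z a standard vector, by the definition of the
    chi-squared law. *)
Lemma model_integral (theta : p.-tuple R) (sigma : R) (F : p.-tuple R * R -> \bar R) :
  0 < sigma -> measurable_fun [set: p.-tuple R * R] F -> (forall w, 0 <= F w)%E ->
  (\int[model k theta sigma]_w F w =
   \int[PP]_w (F (scalet sigma w.1, (sigma ^+ 2 * sqnorm w.2)%R) *
     (expR (dot (scalet sigma^-1 theta) w.1 - sqnorm (scalet sigma^-1 theta) / 2))%:E))%E.
Proof.
move=> s0 mF F0; set eta := scalet sigma^-1 theta.
rewrite /model (fubini_tonelli1 F)//.
pose G (w : Y) := F (w.1, sigma ^+ 2 * sqnorm w.2).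
have mG : measurable_fun [set: Y] G.
  apply: (measurableT_comp mF); apply/measurable_fun_pairP; split; rewrite /comp /=; measurability.
have mGs : measurable_fun [set: Y] (fun w : Y => G (scalet sigma w.1, w.2)).
  apply: (measurableT_comp mG); apply/measurable_fun_pairP; split; rewrite /comp /=; measurability.
have G0 w : (0 <= G w)%E by exact: F0.
transitivity (\int[mvnormal sigma theta]_x \int[std k]_z G (x, z))%E.
  apply: eq_integral => x _; rewrite /fubini_F.
  have mFx : measurable_fun [set: R] (fun s => F (x, s)).
    exact: (measurableT_comp mF (measurable_pair1 x)).
  rewrite (ge0_integral_distribution (scale (sigma ^+ 2)) mFx)//.
  have mFx' : measurable_fun [set: R] ((fun s => F (x, s)) \o scale (sigma ^+ 2)).
    by apply: (measurableT_comp mFx); exact: measurable_scale.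
  by apply: (ge0_integral_distribution (@sqnorm R k) mFx') => s; exact: F0.
rewrite ge0_integral_mvnormal_std//; last 2 first.
- exact: (measurable_fun_fubini_tonelli_F (m2 := std k) _ mG G0).
- by move=> x; apply: integral_ge0.
have me : measurable_fun [set: Y] (fun w : Y => (expR (dot eta w.1 - sqnorm eta / 2))%:E).
  by measurability.
rewrite (fubini_tonelli1 (fun w : Y => G (scalet sigma w.1, w.2) *
  (expR (dot eta w.1 - sqnorm eta / 2))%:E)%E); last 2 first.
- exact: emeasurable_funM.
- by move=> w; rewrite mule_ge0// lee_fin expR_ge0.
apply: eq_integral => x _; rewrite /fubini_F/= muleC -ge0_integralZl//.
- by apply: eq_integral => z _; rewrite muleC.
- exact: (measurableT_comp mG (measurable_pair1 (scalet sigma x))).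
Qed.

(** The expanded square of h(T) X - s eta; s = -1 is the loss after the reflection x -> -x. *)
Definition loss (h : R -> R) (eta : p.-tuple R) (s : R) (w : Y) : R :=
  h (tstat w) ^+ 2 * sqnorm w.1 - 2 * s * h (tstat w) * dot eta w.1 + s ^+ 2 * sqnorm eta.

Lemma sum_sqr_sub (c s : R) (eta x : p.-tuple R) :
  \sum_(i < p) (c * tnth x i - s * tnth eta i) ^+ 2 =
  c ^+ 2 * sqnorm x - 2 * s * c * dot eta x + s ^+ 2 * sqnorm eta.
Proof.
rewrite /sqnorm /dot !mulr_sumr -sumrB -big_split/=.
by apply: eq_bigr => i _; ring.
Qed.

Lemma loss_ge0 h eta s w : 0 <= loss h eta s w.
Proof. by rewrite /loss -sum_sqr_sub sumr_ge0// => i _; rewrite sqr_ge0. Qed.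

Definition symrisk (h : R -> R) (eta : p.-tuple R) (w : Y) : R :=
  (h (tstat w) ^+ 2 * sqnorm w.1 + sqnorm eta) * cosh (dot eta w.1) -
  2 * h (tstat w) * (dot eta w.1 * sinh (dot eta w.1)).

(** Half the sum of the tilted losses at x and -x, the form in which nonnegativity is visible. *)
Lemma symriskE h eta w : symrisk h eta w =
  (loss h eta 1 w * expR (dot eta w.1) + loss h eta (-1) w * expR (- dot eta w.1)) / 2.
Proof. by rewrite /symrisk /loss /cosh /sinh; field. Qed.

Lemma symrisk_ge0 h eta w : 0 <= symrisk h eta w.
Proof. by rewrite symriskE divr_ge0// addr_ge0// mulr_ge0 ?loss_ge0 ?expR_ge0. Qed.

Lemma measurable_loss h eta s : measurable_fun [set: R] h ->
  measurable_fun [set: Y] (loss h eta s).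
Proof. by move=> mh; rewrite /loss; measurability. Qed.

Lemma measurable_cosh (eta : p.-tuple R) :
  measurable_fun [set: Y] (fun w => cosh (dot eta w.1)).
Proof. by rewrite /cosh; measurability. Qed.

Lemma measurable_sinh (eta : p.-tuple R) :
  measurable_fun [set: Y] (fun w => dot eta w.1 * sinh (dot eta w.1)).
Proof. by rewrite /sinh; measurability. Qed.

Lemma measurable_symrisk h eta : measurable_fun [set: R] h ->
  measurable_fun [set: Y] (symrisk h eta).
Proof.
move=> mh; have mc := measurable_cosh eta; have ms := measurable_sinh eta.
by rewrite /symrisk; measurability.
Qed.

Lemma measurable_sqdist_delta h (theta : p.-tuple R) : measurable_fun [set: R] h ->
  measurable_fun [set: p.-tuple R * R] (fun w => sqdist (delta p h w) theta).
Proof.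
move=> mh; apply: measurable_sum => i.
rewrite (_ : (fun _ => _) = fun w : p.-tuple R * R =>
  (h (sqnorm w.1 / w.2) * tnth w.1 i - tnth theta i) ^+ 2); last first.
  by apply/funext => w; rewrite !tnth_mktuple.
apply: measurable_funX; apply: measurable_funB => //; apply: measurable_funM.
  apply: (measurableT_comp mh); measurability.
exact: (measurableT_comp (@measurable_tnth _ R p i) (@measurable_fst _ _ _ _)).
Qed.

Lemma risk_symrisk h (theta : p.-tuple R) (sigma : R) : 0 < sigma ->
  measurable_fun [set: R] h ->
  risk k theta sigma (delta p h) =
  ((expR (- (sqnorm (scalet sigma^-1 theta) / 2)))%:E *
   \int[PP]_w (symrisk h (scalet sigma^-1 theta) w)%:E)%E.
Proof.
move=> s0 mh; set eta := scalet sigma^-1 theta.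
have sn0 : sigma != 0 by rewrite gt_eqF.
have s20 : 0 <= sigma ^+ 2 by rewrite sqr_ge0.
have sv20 : 0 <= sigma ^- 2 by rewrite invr_ge0.
have e0 : 0 <= expR (- (sqnorm eta / 2)) by rewrite expR_ge0.
have mL s := measurable_loss eta s mh.
have mLe : measurable_fun [set: Y] (fun w => loss h eta 1 w * expR (dot eta w.1)).
  by measurability.
have mLn : measurable_fun [set: Y] (fun w => loss h eta (-1) w * expR (- dot eta w.1)).
  by measurability.
have Le0 (w : Y) : 0 <= loss h eta 1 w * expR (dot eta w.1) by rewrite mulr_ge0 ?loss_ge0 ?expR_ge0.
have Ln0 (w : Y) : 0 <= loss h eta (-1) w * expR (- dot eta w.1).
  by rewrite mulr_ge0 ?loss_ge0 ?expR_ge0.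
have key (w : Y) : sqdist (delta p h (scalet sigma w.1, sigma ^+ 2 * sqnorm w.2)) theta =
    sigma ^+ 2 * loss h eta 1 w.
  rewrite /loss -sum_sqr_sub [RHS]mulr_sumr.
  set W := (_, _); change (\sum_(i < p)
    tnth [tuple tnth (delta p h W) i - tnth theta i | i < p] i ^+ 2 =
    \sum_(i < p) sigma ^+ 2 * (h (tstat w) * tnth w.1 i - 1 * tnth eta i) ^+ 2).
  apply: eq_bigr => i _; rewrite !tnth_mktuple /W [(_, _).1]/= [(_, _).2]/=.
  have -> : sqnorm (scalet sigma w.1) / (sigma ^+ 2 * sqnorm w.2) = tstat w.
    by rewrite sqnorm_scalet invfM mulrACA divff ?mul1r// expf_neq0.
  by field.
rewrite /risk unlock.
rewrite (model_integral theta s0); last 2 first.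
- by apply/measurable_EFinP; exact: measurable_sqdist_delta.
- by move=> w; rewrite lee_fin; exact: sqnorm_ge0.
rewrite -/eta.
transitivity ((sigma ^- 2)%:E * \int[PP]_w
   (sigma ^+ 2 * expR (- (sqnorm eta / 2)) * (loss h eta 1 w * expR (dot eta w.1)))%:E)%E.
  congr (_ * _)%E; apply: eq_integral => w _; rewrite -EFinM; congr EFin.
  by rewrite key expRD; ring.
rewrite (@integral_EFinZ _ _ _ PP _ _ mLe Le0); last by rewrite mulr_ge0.
rewrite muleA -EFinM mulrA mulVf ?expf_neq0// mul1r; congr (_ * _)%E.
(* The reflection of X leaves T unchanged, so the two halves of [symrisk] have the same mean. *)
have opp : (\int[PP]_w (loss h eta (-1) w * expR (- dot eta w.1))%:E =
    \int[PP]_w (loss h eta 1 w * expR (dot eta w.1))%:E)%E.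
  rewrite -(@product_opp (fun w => (loss h eta 1 w * expR (dot eta w.1))%:E)).
  - apply: eq_integral => w _; rewrite /loss /tstat [(_, _).1]/= [(_, _).2]/=.
    rewrite dot_scaletr sqnorm_scalet sqrrN expr1n !(mul1r (sqnorm _)) mulN1r.
    by congr (_ * _)%:E; ring.
  - exact/measurable_EFinP.
  - by move=> w; rewrite lee_fin.
transitivity (\int[PP]_w (2^-1 * (loss h eta 1 w * expR (dot eta w.1)) +
   2^-1 * (loss h eta (-1) w * expR (- dot eta w.1)))%:E)%E; last first.
  by apply: eq_integral => w _; rewrite symriskE; congr EFin; field.
have h0 : 0 <= 2^-1 :> R by [].
rewrite integral_EFinD; last 4 first.
- exact: measurable_funM.
- exact: measurable_funM.
- by move=> w; rewrite mulr_ge0.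
- by move=> w; rewrite mulr_ge0.
rewrite (@integral_EFinZ _ _ _ PP _ _ mLe Le0 h0) (@integral_EFinZ _ _ _ PP _ _ mLn Ln0 h0) opp.
rewrite -ge0_muleDl// -EFinD.
have -> : 2^-1 + 2^-1 = 1 :> R by field.
by rewrite mul1e.
Qed.

End risk.

(** * Comparison of risks and strictness at the origin *)

Section domination.
Context {R : realType} (p k : nat) (m : R).
Hypotheses (p_gt0 : (0 < p)%N) (k_gt0 : (0 < k)%N) (m_gt0 : 0 < m).
Local Notation PP := (@std R p \x @std R k)%E.
Local Notation Y := (p.-tuple R * k.-tuple R)%type.
Local Notation hpos t := (Num.max 0 (hBU p k m t)).

(** The risk at lambda = 0, where strict inequality is sought. *)
Definition base_risk (h : R -> R) : \bar R :=
  (\int[PP]_w (h (tstat w) ^+ 2 * sqnorm w.1)%:E)%E.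

(** The hypothesis common to all parts. The first alternative lets h2 agree with h1 at points where
    h1 lies below [hBU]. *)
Definition improves (h2 h1 : R -> R) : Prop := forall t, 0 < t ->
  h2 t <= h1 t /\ (h2 t = h1 t \/ hBU p k m t <= (h2 t + h1 t) / 2).

Let measurable_hT (h : R -> R) : measurable_fun [set: R] h ->
  measurable_fun [set: Y] (fun w : Y => h (tstat w) ^+ 2 * sqnorm w.1).
Proof. by move=> mh; measurability. Qed.

Let hT_ge0 (h : R -> R) (w : Y) : 0 <= h (tstat w) ^+ 2 * sqnorm w.1.
Proof. by rewrite mulr_ge0 ?sqr_ge0 ?sqnorm_ge0. Qed.

Lemma symrisk0 (h : R -> R) (eta : p.-tuple R) (w : Y) : sqnorm eta = 0 ->
  symrisk h eta w = h (tstat w) ^+ 2 * sqnorm w.1.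
Proof.
move=> e0; have d0 : dot eta w.1 = 0.
  by rewrite /dot big1// => i _; rewrite (sqnorm_eq0 e0) mul0r.
by rewrite /symrisk d0 e0 /cosh oppr0 expR0; field.
Qed.

(** Symmetrized form of |a|^2 <= 2 |a - eta|^2 + 2 |eta|^2, where the two sides differ by |a - 2
    eta|^2; hence the loss at [scalet 2 eta]. *)
Lemma sqr_le_symrisk (h : R -> R) (eta : p.-tuple R) (w : Y) :
  h (tstat w) ^+ 2 * sqnorm w.1 * cosh (dot eta w.1) <=
  2 * symrisk h eta w + 2 * sqnorm eta * cosh (dot eta w.1).
Proof.
have H : 0 <= (loss h (scalet 2 eta) 1 w * expR (dot eta w.1) +
   loss h (scalet 2 eta) (-1) w * expR (- dot eta w.1)) / 2.
  by rewrite divr_ge0// addr_ge0// mulr_ge0 ?loss_ge0 ?expR_ge0.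
rewrite -subr_ge0; move: H; congr (is_true (0 <= _)).
by rewrite /loss dot_scaletl sqnorm_scalet /symrisk /cosh /sinh; field.
Qed.

Lemma cosh_integral_lty (eta : p.-tuple R) c : 0 <= c ->
  (\int[PP]_w (c * cosh (dot eta w.1))%:E < +oo)%E.
Proof.
move=> c0; have C0 (w : Y) : 0 <= cosh (dot eta w.1) by rewrite (le_trans ler01)// cosh_ge1.
have mC : measurable_fun [set: p.-tuple R] (fun x => cosh (dot eta x)).
  by rewrite /cosh; measurability.
rewrite (@integral_EFinZ _ _ _ PP _ _ (measurable_cosh (k := k) eta) C0 c0).
rewrite (@product_fst R p k (fun x => (cosh (dot eta x))%:E)).
- by rewrite std_cosh -EFinM ltry.
- exact/measurable_EFinP.
- by move=> x; rewrite lee_fin (le_trans ler01)// cosh_ge1.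
Qed.

Lemma symrisk_lty (h : R -> R) (eta : p.-tuple R) : measurable_fun [set: R] h ->
  (\int[PP]_w (symrisk h eta w)%:E < +oo)%E ->
  (\int[PP]_w (h (tstat w) ^+ 2 * sqnorm w.1 * cosh (dot eta w.1))%:E < +oo)%E.
Proof.
move=> mh rh; have mC := measurable_cosh (k := k) eta.
have mr := measurable_symrisk (k := k) eta mh.
have C0 (w : Y) : 0 <= cosh (dot eta w.1) by rewrite (le_trans ler01)// cosh_ge1.
have r0 (w : Y) := symrisk_ge0 h eta w.
have l0 : 0 <= 2 * sqnorm eta by rewrite mulr_ge0 ?sqnorm_ge0.
have h20 : 0 <= 2 :> R by [].
have m1 : measurable_fun [set: Y] (fun w => 2 * symrisk h eta w) by exact: measurable_funM.
have m2 : measurable_fun [set: Y] (fun w => 2 * sqnorm eta * cosh (dot eta w.1)).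
  exact: measurable_funM.
apply: (@le_lt_trans _ _ (\int[PP]_w (2 * symrisk h eta w +
    2 * sqnorm eta * cosh (dot eta w.1))%:E)%E).
  apply: le_integral_EFin.
  - by apply: measurable_funM => //; exact: measurable_hT.
  - exact: measurable_funD.
  - by move=> w; rewrite mulr_ge0.
  - by move=> w; exact: sqr_le_symrisk.
rewrite integral_EFinD//; last 2 first.
- by move=> w; rewrite mulr_ge0.
- by move=> w; rewrite mulr_ge0.
rewrite lte_add_pinfty ?cosh_integral_lty//.
by rewrite (@integral_EFinZ _ _ _ PP _ _ mr r0 h20) lte_mul_pinfty.
Qed.

(** Since cosh >= 1, a finite risk at any single eta already gives a finite risk at 0. *)
Lemma base_risk_lty (h : R -> R) (eta : p.-tuple R) : measurable_fun [set: R] h ->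
  (\int[PP]_w (symrisk h eta w)%:E < +oo)%E -> (base_risk h < +oo)%E.
Proof.
move=> mh /(symrisk_lty mh); apply: le_lt_trans.
apply: le_integral_EFin.
- exact: measurable_hT.
- by apply: measurable_funM; [exact: measurable_hT|exact: measurable_cosh].
- exact: hT_ge0.
- by move=> w; rewrite ler_peMr// cosh_ge1.
Qed.

Lemma base_risk_bounded (h : R -> R) (c : R) : measurable_fun [set: R] h -> 0 <= c ->
  (forall t, 0 <= t -> h t ^+ 2 <= c) -> (base_risk h < +oo)%E.
Proof.
move=> mh c0 hc.
have mn : measurable_fun [set: Y] (fun w : Y => sqnorm w.1) by measurability.
have n0 (w : Y) : 0 <= sqnorm w.1 by exact: sqnorm_ge0.
apply: (@le_lt_trans _ _ (\int[PP]_w (c * sqnorm w.1)%:E)%E).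
  apply: le_integral_EFin.
  - exact: measurable_hT.
  - exact: measurable_funM.
  - exact: hT_ge0.
  - by move=> w; rewrite ler_wpM2r// hc// tstat_ge0.
rewrite (@integral_EFinZ _ _ _ PP _ _ mn n0 c0).
rewrite (@product_fst R p k (fun x => (sqnorm x)%:E)).
- rewrite (_ : (\int[std p]_x (sqnorm x)%:E = (2 ^+ 1 * pochhammer (p%:R / 2) 1)%:E)%E).
    by rewrite -EFinM ltry.
  by rewrite -std_sqnorm_moment; apply: eq_integral => x _; rewrite expr1.
- by apply/measurable_EFinP; exact: measurable_sqnorm.
- by move=> x; rewrite lee_fin sqnorm_ge0.
Qed.

Section pair.
Variables h1 h2 : R -> R.
Hypotheses (mh1 : measurable_fun [set: R] h1) (mh2 : measurable_fun [set: R] h2).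
Hypothesis h21 : improves h2 h1.

(** The truncations only matter for t <= 0, where [improves] says nothing; T > 0 almost surely. *)
Let D t : R := Num.max 0 (h1 t - h2 t).
Let E t : R := Num.max 0 (h1 t ^+ 2 - h2 t ^+ 2).

Let mD : measurable_fun [set: R] D.
Proof. by apply: measurable_maxr => //; exact: measurable_funB. Qed.

Let mE : measurable_fun [set: R] E.
Proof. by apply: measurable_maxr => //; apply: measurable_funB; exact: measurable_funX. Qed.

Let D0 t : 0 <= D t. Proof. by rewrite le_max lexx. Qed.
Let E0 t : 0 <= E t. Proof. by rewrite le_max lexx. Qed.

Let DE t : 0 < t -> D t = h1 t - h2 t.
Proof. by move=> t0; apply/max_idPr; rewrite subr_ge0; have [] := h21 t0. Qed.

(** The difference of the two sides is (h1 - h2) (h1 + h2 - 2 hBU), both factors being nonnegative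
    unless h1 = h2. *)
Let DE_le t : 0 < t -> 2 * D t * hpos t <= h1 t ^+ 2 - h2 t ^+ 2.
Proof.
move=> t0; have [le12 alt] := h21 t0.
have -> : hpos t = hBU p k m t by apply/max_idPr; rewrite ltW// hBU_gt0// ltW.
rewrite DE//; case: alt => [->|H]; first by rewrite !subrr mulr0 mul0r.
have := mulr_ge0 (_ : 0 <= h1 t - h2 t) (_ : 0 <= h2 t + h1 t - 2 * hBU p k m t).
rewrite !subr_ge0 => /(_ le12) => K; rewrite -subr_ge0.
have : 2 * hBU p k m t <= h2 t + h1 t by lra.
by move=> /K; congr (is_true (0 <= _)); ring.
Qed.

Let EE t : 0 < t -> E t = h1 t ^+ 2 - h2 t ^+ 2.
Proof.
move=> t0; apply/max_idPr; apply: le_trans (DE_le t0).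
by rewrite !mulr_ge0// le_max lexx.
Qed.

Let gain (eta : p.-tuple R) (w : Y) : R := E (tstat w) * sqnorm w.1 * cosh (dot eta w.1).

Let gain_ge0 eta w : 0 <= gain eta w.
Proof. by rewrite !mulr_ge0 ?sqnorm_ge0// (le_trans ler01)// cosh_ge1. Qed.

Let measurable_gain eta : measurable_fun [set: Y] (gain eta).
Proof. by have mC := measurable_cosh (k := k) eta; rewrite /gain; measurability. Qed.

Let cross (eta : p.-tuple R) (w : Y) : R :=
  D (tstat w) * (dot eta w.1 * sinh (dot eta w.1)).

Let cross_ge0 eta w : 0 <= cross eta w.
Proof. by rewrite mulr_ge0// mul_sinh_ge0. Qed.

Let measurable_cross eta : measurable_fun [set: Y] (cross eta).
Proof. by have mS := measurable_sinh (k := k) eta; rewrite /cross; measurability. Qed.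

(** The difference of the two risks, arranged as sums of nonnegative terms so that it stays
    meaningful when some are infinite. *)
Let balance eta : (\int[PP]_w (symrisk h2 eta w)%:E + \int[PP]_w (gain eta w)%:E =
  \int[PP]_w (symrisk h1 eta w)%:E + \int[PP]_w (2 * cross eta w)%:E)%E.
Proof.
have m2 := measurable_symrisk (k := k) eta mh2.
have m1 := measurable_symrisk (k := k) eta mh1.
have mg := measurable_gain eta.
have mc : measurable_fun [set: Y] (fun w => 2 * cross eta w).
  by apply: measurable_funM => //; exact: measurable_cross.
have c0 w : 0 <= 2 * cross eta w by rewrite mulr_ge0.
rewrite -integral_EFinD//; last by move=> w; exact: symrisk_ge0.
rewrite -integral_EFinD//; last by move=> w; exact: symrisk_ge0.
apply: (ge0_integral_ae (ae_product_gt0 p_gt0 k_gt0)).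
- by apply/measurable_EFinP; exact: measurable_funD.
- by apply/measurable_EFinP; exact: measurable_funD.
- by move=> w; rewrite lee_fin addr_ge0 ?symrisk_ge0.
- by move=> w; rewrite lee_fin addr_ge0 ?symrisk_ge0.
move=> w [w1 w2]; have t0 : 0 < tstat w by rewrite divr_gt0.
by congr EFin; rewrite /gain /cross /symrisk EE// DE//; ring.
Qed.

Let cross_le_gain (eta : p.-tuple R) : enorm eta <= m ->
  (\int[PP]_w (2 * cross eta w)%:E <= \int[PP]_w (gain eta w)%:E)%E.
Proof.
move=> em; have h20 : 0 <= 2 :> R by [].
have mC := measurable_cosh (k := k) eta; have mH := measurable_hpos k m p_gt0.
have mF : measurable_fun [set: Y] (fun w =>
    D (tstat w) * hpos (tstat w) * (sqnorm w.1 * cosh (dot eta w.1))).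
  by measurability; apply: (measurableT_comp mH); exact: measurable_tstat.
have F0 (w : Y) : 0 <= D (tstat w) * hpos (tstat w) * (sqnorm w.1 * cosh (dot eta w.1)).
  have H0 : 0 <= hpos (tstat w) by rewrite le_max lexx.
  have C0 : 0 <= cosh (dot eta w.1) by rewrite (le_trans ler01)// cosh_ge1.
  by rewrite mulr_ge0 ?mulr_ge0 ?sqnorm_ge0.
rewrite (@integral_EFinZ _ _ _ PP _ _ (measurable_cross eta) (cross_ge0 eta) h20).
apply: (@le_trans _ _ (2%:E * \int[PP]_w
    (D (tstat w) * hpos (tstat w) * (sqnorm w.1 * cosh (dot eta w.1)))%:E)%E).
  by rewrite lee_wpmul2l ?lee_fin// mean_dot_le.
rewrite -(@integral_EFinZ _ _ _ PP _ _ mF F0 h20).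
apply: ae_ge0_le_integral => //.
- by move=> w _; rewrite lee_fin mulr_ge0.
- by apply/measurable_EFinP; exact: measurable_funM.
- by move=> w _; rewrite lee_fin.
- by apply/measurable_EFinP; exact: measurable_gain.
apply: filterS (ae_product_gt0 p_gt0 k_gt0) => w [w1 w2] _.
have t0 : 0 < tstat w by rewrite divr_gt0.
have C0 : 0 <= cosh (dot eta w.1) by rewrite (le_trans ler01)// cosh_ge1.
have le1 := ler_wpM2r C0 (ler_wpM2r (sqnorm_ge0 w.1) (DE_le t0)).
rewrite lee_fin /gain EE//; apply: le_trans le1.
by rewrite le_eqVlt; apply/orP; left; apply/eqP; ring.
Qed.

Lemma symrisk_le (eta : p.-tuple R) : enorm eta <= m ->
  (\int[PP]_w (symrisk h2 eta w)%:E <= \int[PP]_w (symrisk h1 eta w)%:E)%E.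
Proof.
move=> em; have [->|r1] := eqVneq (\int[PP]_w (symrisk h1 eta w)%:E)%E +oo%E.
  by rewrite leey.
have {}r1 : (\int[PP]_w (symrisk h1 eta w)%:E < +oo)%E by rewrite ltey.
(* [gain] is at most h1^2 |X|^2 cosh(eta.X), integrable once the risk of h1 is finite; it may then
   be cancelled from [balance]. *)
have gfin : (\int[PP]_w (gain eta w)%:E)%E \is a fin_num.
  rewrite ge0_fin_numE; last exact: integral_EFin_ge0.
  apply: le_lt_trans (symrisk_lty mh1 r1); apply: le_integral_EFin => //.
  - by apply: measurable_funM; [exact: measurable_hT|exact: measurable_cosh].
  - move=> w; rewrite /gain ler_wpM2r//.
      by rewrite (le_trans ler01)// cosh_ge1.
    rewrite ler_wpM2r ?sqnorm_ge0// /E ge_max sqr_ge0/=.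
    by rewrite lerBlDr lerDl sqr_ge0.
by rewrite -(leeD2rE _ _ gfin) balance leeD2l// cross_le_gain.
Qed.

(** At eta = 0 the cross term is 0, so the risks differ by the mean of [gain]. If that mean were 0,
    [gain] would vanish almost surely and force h1(T) = h2(T). Finiteness for h2 makes adding a
    positive mean strict. *)
Lemma base_risk_lt : (base_risk h2 < +oo)%E ->
  ~ {ae PP, forall w, h1 (tstat w) = h2 (tstat w)} ->
  (base_risk h2 < base_risk h1)%E.
Proof.
move=> b2 nae; pose z : p.-tuple R := [tuple 0 | i < p].
have z0 : sqnorm z = 0 by rewrite /sqnorm big1// => i _; rewrite tnth_mktuple expr0n.
have bE h : (\int[PP]_w (symrisk h z w)%:E = base_risk h)%E.
  by apply: eq_integral => w _; rewrite symrisk0.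
have d0 (w : Y) : dot z w.1 = 0.
  by rewrite /dot big1// => i _; rewrite (sqnorm_eq0 z0) mul0r.
have := balance z; rewrite !bE.
have -> : (\int[PP]_w (2 * cross z w)%:E = 0)%E.
  by under eq_integral do rewrite /cross d0 mul0r !mulr0; rewrite integral0.
rewrite adde0 => <-.
rewrite lteDl; last by rewrite ge0_fin_numE//; exact: integral_EFin_ge0.
rewrite lt_neqAle integral_EFin_ge0 ?andbT; last exact: gain_ge0.
apply/negP => /eqP/esym g0; apply: nae.
have mgE : measurable_fun [set: Y] (EFin \o gain z).
  by apply/measurable_EFinP; exact: measurable_gain.
have : (\int[PP]_w `|(EFin \o gain z) w| = 0)%E.
  by rewrite -g0; apply: eq_integral => w _; rewrite /= ger0_norm.
move=> /(ae_eq_integral_abs _ measurableT mgE) gae.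
apply: filterS2 gae (ae_product_gt0 p_gt0 k_gt0) => w /(_ I) [gw] [w1 w2].
have t0 : 0 < tstat w by rewrite divr_gt0.
move: gw; rewrite /gain d0 /cosh oppr0 expR0 EE//.
have -> : (1 + 1) / 2 = 1 :> R by field.
rewrite mulr1 => /eqP; rewrite mulf_eq0 (gt_eqF w1) orbF => /eqP e.
have := DE_le t0; rewrite e.
(* Positivity of [hBU] turns 2 D hBU <= 0 into D <= 0. *)
have hp : 0 < hpos (tstat w) by rewrite lt_max hBU_gt0 ?orbT// ltW.
rewrite pmulr_lle0// pmulr_rle0// DE// => d.
by have [le12 _] := h21 t0; apply/eqP; rewrite eq_le le12 andbT; lra.
Qed.

Lemma improves_dominates : (base_risk h2 < +oo)%E ->
  ~ {ae PP, forall w, h1 (tstat w) = h2 (tstat w)} ->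
  dominates k m (delta p h2) (delta p h1).
Proof.
move=> b2 nae.
have en (theta : p.-tuple R) sigma : 0 < sigma ->
    enorm (scalet sigma^-1 theta) = enorm theta / sigma.
  move=> s0; rewrite /enorm sqnorm_scalet sqrtrM ?sqr_ge0// sqrtr_sqr.
  by rewrite gtr0_norm ?invr_gt0// mulrC.
split.
  move=> l /andP[l0 lm] theta sigma [s0 el].
  rewrite !risk_symrisk// lee_wpmul2l ?lee_fin ?expR_ge0//.
  by rewrite symrisk_le// en// el.
exists 0; first by rewrite lexx ltW.
move=> theta sigma [s0 el]; rewrite !risk_symrisk//.
have e0 : sqnorm (scalet sigma^-1 theta) = 0.
  by rewrite -sqr_enorm en// el expr0n.
have bE h : (\int[PP]_w (symrisk h (scalet sigma^-1 theta) w)%:E = base_risk h)%E.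
  by apply: eq_integral => w _; rewrite symrisk0.
rewrite e0 mul0r oppr0 expR0 !mul1e !bE.
exact: base_risk_lt.
Qed.

End pair.

(** By the contrapositive of [base_risk_lty], an infinite risk at 0 is infinite at every parameter,
    so any finite risk at 0 suffices. *)
Lemma infinite_dominated (h1 h2 : R -> R) : measurable_fun [set: R] h1 -> measurable_fun [set: R] h2 ->
  ~ (base_risk h1 < +oo)%E -> (base_risk h2 < +oo)%E ->
  dominates k m (delta p h2) (delta p h1).
Proof.
move=> mh1 mh2 b1 b2.
have r1 (theta : p.-tuple R) sigma : 0 < sigma -> risk k theta sigma (delta p h1) = +oo%E.
  move=> s0; rewrite risk_symrisk//.
  have -> : (\int[PP]_w (symrisk h1 (scalet sigma^-1 theta) w)%:E = +oo)%E.
    apply/eqP/negPn/negP => ne; apply: b1.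
    by apply: (base_risk_lty mh1 (eta := scalet sigma^-1 theta)); rewrite ltey.
  by rewrite gt0_muley// lte_fin expR_gt0.
split; first by move=> l _ theta sigma [s0 _]; rewrite r1// leey.
exists 0; first by rewrite lexx ltW.
move=> theta sigma [s0 el]; rewrite r1//.
have e0 : sqnorm (scalet sigma^-1 theta) = 0.
  rewrite sqnorm_scalet -sqr_enorm; move/eqP : el.
  by rewrite mulf_eq0 invr_eq0 (gt_eqF s0) orbF => /eqP ->; rewrite expr0n mulr0.
rewrite risk_symrisk// e0 mul0r oppr0 expR0 mul1e.
by under eq_integral do rewrite symrisk0//.
Qed.

Lemma finite_base_risk (h : R -> R) : measurable_fun [set: R] h ->
  risk_not_identically_infinite k m (delta p h) -> (base_risk h < +oo)%E.
Proof.
move=> mh [theta [sigma [s0 _]]]; rewrite risk_symrisk// => r.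
apply: (base_risk_lty mh (eta := scalet sigma^-1 theta)).
rewrite ltey; apply/negP => /eqP e.
by move: r; rewrite e gt0_muley ?ltxx// lte_fin expR_gt0.
Qed.

End domination.

(** * Null sets for the law of T and for Lebesgue measure *)

Section null_sets.
Context {R : realType} (p k : nat).
Hypotheses (p_gt0 : (0 < p)%N) (k_gt0 : (0 < k)%N).
Local Notation PP := (@std R p \x @std R k)%E.
Local Notation Y := (p.-tuple R * k.-tuple R)%type.
Local Notation mu := (@lebesgue_measure R).

Lemma ge0_integral_eq0 d (T : measurableType d) (nu : {measure set T -> \bar R})
    (f : T -> \bar R) : measurable_fun [set: T] f -> (forall w, 0 <= f w)%E ->
  (\int[nu]_w f w = 0)%E -> {ae nu, forall w, f w = 0%E}.
Proof.
move=> mf f0 fi.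
have : (\int[nu]_w `|f w| = 0)%E.
  by rewrite -fi; apply: eq_integral => w _; rewrite gee0_abs.
move=> /(ae_eq_integral_abs _ measurableT mf); apply: filterS => w; exact.
Qed.

(** Dilating x by sqrt(c) replaces T by c T and multiplies the density by a positive factor: if T
    avoids A almost surely, so does c T. *)
Let rescaled (A : set R) (c : R) : measurable A -> 0 < c ->
  (\int[PP]_w (\1_A (tstat w))%:E = 0)%E ->
  (\int[PP]_w (\1_A (c * tstat w) * expR (- ((c - 1) * sqnorm w.1 / 2)))%:E = 0)%E.
Proof.
move=> mA c0 z.
have mI : measurable_fun [set: R] (\1_A : R -> R) by exact: measurable_indic.
have I0 t : 0 <= \1_A t :> R by [].
have mT : measurable_fun [set: Y] (fun w => \1_A (tstat w) : R).
  exact: (measurableT_comp mI (@measurable_tstat R p k)).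
have mG : measurable_fun [set: Y]
    (fun w => \1_A (c * tstat w) * expR (- ((c - 1) * sqnorm w.1 / 2))).
  apply: measurable_funM; last by measurability.
  by apply: (measurableT_comp mI); measurability.
have G0 (w : Y) : 0 <= \1_A (c * tstat w) * expR (- ((c - 1) * sqnorm w.1 / 2)).
  by rewrite mulr_ge0 ?expR_ge0.
have cp0 : 0 < Num.sqrt c ^+ p by rewrite exprn_gt0// sqrtr_gt0.
suff e : (\int[PP]_w (\1_A (tstat w))%:E = (Num.sqrt c ^+ p)%:E *
    \int[PP]_w (\1_A (c * tstat w) * expR (- ((c - 1) * sqnorm w.1 / 2)))%:E)%E.
  move: z; rewrite e => /eqP; rewrite mule_eq0 => /orP[/eqP[]/eqP|/eqP//].
  by rewrite (gt_eqF cp0).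
rewrite (fubini_tonelli1 (fun w : Y => (\1_A (tstat w))%:E)); last 2 first.
- exact/measurable_EFinP.
- by move=> w; rewrite lee_fin.
rewrite (fubini_tonelli1 (fun w : Y =>
   (\1_A (c * tstat w) * expR (- ((c - 1) * sqnorm w.1 / 2)))%:E)); last 2 first.
- exact/measurable_EFinP.
- by move=> w; rewrite lee_fin.
apply: (etrans (fubini_tonelli (fun w : Y => (\1_A (tstat w))%:E) _ _)).
- exact/measurable_EFinP.
- by move=> w; rewrite lee_fin.
apply: esym; rewrite /fubini_F; apply: (etrans (congr1 (fun I => _ * I)%E (fubini_tonelli
  (fun w : Y => (\1_A (c * tstat w) * expR (- ((c - 1) * sqnorm w.1 / 2)))%:E) _ _))).
- exact/measurable_EFinP.
- by move=> w; rewrite lee_fin.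
have mH : measurable_fun [set: k.-tuple R] (fun z => \int[std p]_x
    (\1_A (c * tstat (x, z)) * expR (- ((c - 1) * sqnorm (x, z).1 / 2)))%:E)%E.
  have mG' : measurable_fun [set: Y]
      (fun w : Y => (\1_A (c * tstat w) * expR (- ((c - 1) * sqnorm w.1 / 2)))%:E).
    exact/measurable_EFinP.
  have G0' (w : Y) : (0 <= (\1_A (c * tstat w) * expR (- ((c - 1) * sqnorm w.1 / 2)))%:E)%E.
    by rewrite lee_fin.
  exact: (measurable_fun_fubini_tonelli_G (m1 := std p) _ mG' G0').
have H0 z' : (0 <= \int[std p]_x
    (\1_A (c * tstat (x, z')) * expR (- ((c - 1) * sqnorm (x, z').1 / 2)))%:E)%E.
  by apply: integral_ge0 => x _; rewrite lee_fin.
rewrite -ge0_integralZl// ?lee_fin ?(ltW cp0)//.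
apply: eq_integral => y _; apply: esym.
pose F (x : p.-tuple R) : R := \1_A (tstat (x, y)) * expR (- (sqnorm x / 2)).
have mF : measurable_fun [set: p.-tuple R] (EFin \o F).
  apply/measurable_EFinP; apply: measurable_funM; last by measurability.
  exact: (measurableT_comp mT (measurable_pair2 y)).
have F0 x : (0 <= (EFin \o F) x)%E by rewrite lee_fin mulr_ge0 ?expR_ge0.
have sc0 : 0 < Num.sqrt c by rewrite sqrtr_gt0.
transitivity (\int[std p]_x ((EFin \o F) x * (expR (sqnorm x / 2))%:E))%E.
  by apply: eq_integral => x _; rewrite -EFinM /F -mulrA -expRD addNr expR0 mulr1.
apply: (etrans (std_scaling sc0 mF F0)); congr (_ * _)%E.
apply: eq_integral => x _; rewrite -EFinM /F /tstat [(_, _).1]/= [(_, _).2]/=.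
rewrite sqnorm_scalet sqr_sqrtr ?(ltW c0)// -!mulrA -expRD !mulrA.
by congr (_ * expR _)%:E; rewrite [(_, _).1]/=; field.
Qed.

Lemma fubini_null d1 d2 (T1 : measurableType d1) (T2 : measurableType d2)
    (m1 : {sigma_finite_measure set T1 -> \bar R})
    (m2 : {sigma_finite_measure set T2 -> \bar R}) (f : T1 * T2 -> \bar R) :
  measurable_fun [set: T1 * T2] f -> (forall w, 0 <= f w)%E ->
  (\int[m1]_x \int[m2]_y f (x, y) = 0)%E ->
  {ae m2, forall y, \int[m1]_x f (x, y) = 0}%E.
Proof.
move=> mf f0; rewrite (fubini_tonelli f mf f0) => fi.
apply: (ge0_integral_eq0 _ _ fi); first exact: (measurable_fun_fubini_tonelli_G f mf f0).
by move=> y; exact: integral_ge0.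
Qed.

(** Integrating [rescaled] over c and exchanging the integrals yields a single w with T(w) > 0 such
    that c T(w) lies outside A for almost every c; the change of variable t = c T(w) then gives
    measure 0. *)
Lemma tstat_null_set (A : set R) : measurable A -> A `<=` [set t | 0 < t] ->
  (\int[PP]_w (\1_A (tstat w))%:E = 0)%E -> mu A = 0%E.
Proof.
move=> mA A0 z.
have mI : measurable_fun [set: R] (\1_A : R -> R) by exact: measurable_indic.
have I0 t : 0 <= \1_A t :> R by [].
pose phi (v : measurableTypeR R * Y) : R :=
  \1_A (v.1 * tstat v.2) * expR (- ((v.1 - 1) * sqnorm v.2.1 / 2)).
have m1 : measurable_fun [set: measurableTypeR R * Y] (fun v => v.1 : R).
  exact: measurable_fst.
have m2 : measurable_fun [set: measurableTypeR R * Y] (fun v => tstat v.2).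
  exact: (measurableT_comp (@measurable_tstat R p k) (@measurable_snd _ _ _ _)).
have m3 : measurable_fun [set: measurableTypeR R * Y] (fun v => sqnorm v.2.1).
  apply: (measurableT_comp (@measurable_sqnorm R p)).
  exact: (measurableT_comp (@measurable_fst _ _ _ _) (@measurable_snd _ _ _ _)).
have mphi : measurable_fun setT (EFin \o phi).
  apply/measurable_EFinP; apply: measurable_funM.
    by apply: (measurableT_comp mI); exact: measurable_funM.
  apply: (measurableT_comp (@measurable_expR R)); apply: measurableT_comp => //.
  apply: measurable_funM => //; apply: measurable_funM => //.
  exact: measurable_funB.
have phi0 v : (0 <= (EFin \o phi) v)%E by rewrite lee_fin mulr_ge0 ?expR_ge0.
have int0 : (\int[mu]_c \int[PP]_w (EFin \o phi) (c, w) = 0)%E.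
  rewrite -[RHS](@integral0 _ _ R mu setT); apply: eq_integral => c _.
  have [c0|c0] := ltP 0 c; first exact: (rescaled mA c0 z).
  rewrite -[RHS](@integral0 _ _ R PP setT); apply: eq_integral => w _.
  rewrite /phi/= indicE memNset ?mul0r// => /A0/=.
  by apply/negP; rewrite -leNgt mulr_le0_ge0// tstat_ge0.
pose m2' : probability Y R := PP.
have ae1 := @fubini_null _ _ (measurableTypeR R) Y mu m2' (EFin \o phi) mphi phi0 int0.
(* Two almost sure properties hold together at some point, the total mass being 1. *)
have [w [w0 [w1 w2]]] : exists w : Y, (\int[mu]_c (EFin \o phi) (c, w) = 0)%E /\
    0 < sqnorm w.1 /\ 0 < sqnorm w.2.
  apply/not_existsP => none.
  have aeF : {ae PP, forall w : Y, False}.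
    apply: filterS2 ae1 (ae_product_gt0 p_gt0 k_gt0) => w a b.
    exact: (none w).
  have : (\int[PP]_w cst 1 w = \int[PP]_w cst 0 w :> \bar R)%E.
    by apply: (ge0_integral_ae aeF).
  by rewrite integral_product1 integral0 => /eqP; rewrite onee_eq0.
have t0 : 0 < tstat w by rewrite divr_gt0.
have mphiw : measurable_fun [set: measurableTypeR R] (fun c => (EFin \o phi) (c, w)).
  exact: (measurableT_comp mphi (measurable_pair2 w)).
have ae2 := ge0_integral_eq0 mphiw (fun c => phi0 (c, w)) w0.
have mJ : measurable_fun [set: R] (fun t : R => (\1_A t : R)%:E).
  by apply/measurable_EFinP; exact: mI.
have J0 (t : R) : (0 <= (\1_A t : R)%:E)%E by rewrite lee_fin.
have tn : tstat w != 0 by rewrite gt_eqF.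
have muA : (\int[mu]_t (\1_A t : R)%:E = mu A)%E by rewrite integral_indic// setIT.
rewrite -muA (ge0_integral_lebesgue_affine 0 tn mJ J0).
rewrite [X in (_ * X)%E](_ : _ = 0%E) ?mule0//.
rewrite -[RHS](@integral0 _ _ R mu setT).
apply: (ge0_integral_ae ae2) => //.
- apply: (measurableT_comp mJ); apply: measurable_funD => //; exact: measurable_funM.
- move=> c [] /eqP; rewrite mulf_eq0 (gt_eqF (expR_gt0 _)) orbF addr0 mulrC => /eqP.
  by rewrite /= => ->.
Qed.

(** [tstat_null_set] handles the disagreement set within t > 0; the point 0 is added by hand, as a
    Lebesgue null set. *)
Lemma ae_tstat_eq (h1 h2 : R -> R) :
  measurable_fun [set: R] h1 -> measurable_fun [set: R] h2 ->
  {ae PP, forall w, h1 (tstat w) = h2 (tstat w)} ->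
  mu.-negligible [set t | 0 <= t /\ h1 t <> h2 t].
Proof.
move=> mh1 mh2 ae12.
pose A : set R := [set t | 0 < t] `&` [set t | h1 t - h2 t != 0].
have mA : measurable A.
  apply: measurableI; first by rewrite -set_itvoy; exact: measurable_itv.
  have := measurable_funB mh1 mh2 measurableT (measurableC (measurable_set1 (0 : R))).
  rewrite setTI; congr (measurable _); apply/seteqP; split => t /=; first by move=> /eqP.
  by move=> /eqP.
have muA : mu A = 0%E.
  apply: tstat_null_set => //; first by move=> t [].
  have mI : measurable_fun [set: R] (\1_A : R -> R) by exact: measurable_indic.
  rewrite -[RHS](@integral0 _ _ R PP setT).
  apply: (ge0_integral_ae ae12) => //.
  - apply/measurable_EFinP.
    exact: (measurableT_comp mI (@measurable_tstat R p k)).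
  move=> w e; rewrite indicE memNset// => -[_] /=.
  by rewrite e subrr eqxx.
exists (A `|` [set 0]); split.
- exact: measurableU.
- transitivity (mu A) => //; apply: (measureU0 (mu := mu)) => //.
  exact: lebesgue_measure_set1.
- move=> t /= [t0 /eqP ne]; move: t0; rewrite le_eqVlt => /predU1P[<-|t0]; first by right.
  by left; split => //=; rewrite subr_eq0.
Qed.

(** Every law of the model has a density with respect to the rescaled law of (X, |Z|^2), so
    agreement along T under the standard law carries over to all parameters. *)
Lemma distinct_tstat (m : R) (h1 h2 : R -> R) :
  measurable_fun [set: R] h1 -> measurable_fun [set: R] h2 ->
  distinct k m (delta p h2) (delta p h1) ->
  ~ {ae PP, forall w, h1 (tstat w) = h2 (tstat w)}.
Proof.
move=> mh1 mh2 [theta [sigma [s0 _] ne]] ae12; apply: ne.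
have mt : measurable_fun [set: p.-tuple R * R] (fun w => sqnorm w.1 / w.2).
  by measurability.
pose B : set R := [set t | h1 t - h2 t != 0].
have mB : measurable B.
  have := measurable_funB mh1 mh2 measurableT (measurableC (measurable_set1 (0 : R))).
  rewrite setTI; congr (measurable _); apply/seteqP; split => t /=; first by move=> /eqP.
  by move=> /eqP.
pose N := (fun w : p.-tuple R * R => sqnorm w.1 / w.2) @^-1` B.
have mN : measurable N by rewrite -[N]setTI; exact: mt.
exists N; split => //; last first.
  move=> w /= neq; rewrite /N /B/=; apply/eqP => /eqP; rewrite subr_eq0 => /eqP e.
  by apply: neq; rewrite /delta e.
have mI : measurable_fun [set: p.-tuple R * R] (fun w => (\1_N w)%:E : \bar R).
  by apply/measurable_EFinP; exact: measurable_indic.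
have := @model_integral R p k theta sigma _ s0 mI (fun w => _ : (0 <= (\1_N w)%:E)%E).
rewrite integral_indic// setIT => ->; last by move=> w; rewrite lee_fin.
rewrite -[RHS](@integral0 _ _ R PP setT).
have mW : measurable_fun [set: Y]
    (fun w : Y => (scalet sigma w.1, sigma ^+ 2 * sqnorm w.2) : p.-tuple R * R).
  by apply/measurable_fun_pairP; split; rewrite /comp /=; measurability.
apply: (ge0_integral_ae ae12) => //.
- apply: emeasurable_funM; first exact: (measurableT_comp mI mW).
  by measurability.
move=> w e; rewrite indicE memNset ?mul0e// /N /B/= sqnorm_scalet => /eqP; apply.
have -> : sigma ^+ 2 * sqnorm w.1 / (sigma ^+ 2 * sqnorm w.2) = tstat w.
  by rewrite invfM mulrACA divff ?mul1r// expf_neq0// gt_eqF.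
by rewrite e subrr.
Qed.

End null_sets.

(** * Domination by estimators whose average with h1 stays above h(m, 0, t) *)

Theorem theorem3p2 (R : realType) (p k : nat) (m : R)
    (p_ge1 : (1 <= p)%N) (k_ge1 : (1 <= k)%N) (m_gt0 : 0 < m) :
  (* (a) *)
  (forall h1 h2 : R -> R,
    measurable_fun [set: R] h1 -> measurable_fun [set: R] h2 ->
    risk_not_identically_infinite k m (delta p h2) ->
    distinct k m (delta p h2) (delta p h1) ->
    (forall t, 0 < t -> h2 t <= h1 t /\ hBU p k m t <= (h2 t + h1 t) / 2) ->
    dominates k m (delta p h2) (delta p h1))
  /\
  (* (b) *)
  (forall (h1 : R -> R) (Sub : set R),
    measurable_fun [set: R] h1 -> measurable Sub ->
    Sub `<=` [set t | 0 <= t /\ hBU p k m t < h1 t] ->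
    (0 < lebesgue_measure Sub)%E ->
    [/\ inadmissible k m (delta p h1),
        (let h := fun t => Num.min (h1 t) (hBU p k m t) in
         risk_not_identically_infinite k m (delta p h) ->
         dominates k m (delta p h) (delta p h1)) &
        (forall hstar : R -> R,
         measurable_fun Sub hstar ->
         (forall t, Sub t -> 2 * hBU p k m t - h1 t <= hstar t <= h1 t) ->
         let h := fun t => h1 t * \1_(~` Sub) t + hstar t * \1_Sub t in
         risk_not_identically_infinite k m (delta p h) ->
         distinct k m (delta p h) (delta p h1) ->
         dominates k m (delta p h) (delta p h1))])
  /\
  (* (c) *)
  (forall h1 : R -> R,
    measurable_fun [set: R] h1 ->
    (forall t, 0 <= t -> hBU p k m t <= h1 t) ->
    ~ {ae lebesgue_measure, forall t, 0 <= t -> h1 t = hBU p k m t} ->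
    dominates k m (delta p (hBU p k m)) (delta p h1)).
Proof.
have mB := measurable_hBU k m p_ge1.
(* [hBU] lies between 0 and m^2/p for t >= 0, which bounds the risk of the Bayes estimator at the
   origin. *)
have bB : (base_risk p k (hBU p k m) < +oo)%E.
  have c0 : 0 <= (m ^+ 2 / p%:R) ^+ 2 by rewrite sqr_ge0.
  apply: (base_risk_bounded _ _ mB c0).
  move=> t t0; rewrite lerXn2r// ?nnegrE ?hBU_le//; first by rewrite ltW// hBU_gt0.
  by rewrite divr_ge0// sqr_ge0.
split; [|split].
- move=> h1 h2 mh1 mh2 fin dis H.
  apply: improves_dominates => //.
  + by move=> t /H[? ?]; split => //; right.
  + exact: finite_base_risk fin.
  + exact: distinct_tstat dis.
- move=> h1 Sub mh1 mSub sub pos.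
  pose hm t := Num.min (h1 t) (hBU p k m t).
  have mhm : measurable_fun [set: R] hm by exact: measurable_minr.
  (* Where the minimum is h1 nothing changes; elsewhere it is [hBU], whose average with the larger
     h1 exceeds [hBU]. *)
  have im : improves p k m hm h1.
    move=> t t0; rewrite /hm; have [le|lt] := leP (h1 t) (hBU p k m t).
      by split => //; left.
    by split; [exact: ltW|right; lra].
  have nae : ~ {ae (@std R p \x @std R k)%E, forall w, h1 (tstat w) = hm (tstat w)}.
    move=> /(ae_tstat_eq p_ge1 k_ge1 mh1 mhm) neg.
    have : (@lebesgue_measure R).-negligible Sub.
      apply: negligibleS neg => t /sub[t0 lt]; split => //.
      by rewrite /hm => e; move: lt; rewrite e lt_min ltxx andbF.
    move=> [A [mA A0 SA]].
    have : (lebesgue_measure Sub <= lebesgue_measure A)%E by apply: le_measure; rewrite ?inE.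
    by rewrite A0 leNgt pos.
  split.
  (* Inadmissibility has two witnesses: the Bayes estimator if the risk of h1 at the origin is
     infinite, the minimum [hm] otherwise. *)
  + have [b1|b1] := pselect (base_risk p k h1 < +oo)%E; last first.
      by exists (hBU p k m) => //; exact: infinite_dominated.
    exists hm => //; apply: improves_dominates => //.
    have mh1' : measurable_fun [set: p.-tuple R * k.-tuple R]
        (fun w => h1 (tstat w) ^+ 2 * sqnorm w.1) by measurability.
    have mB' : measurable_fun [set: p.-tuple R * k.-tuple R]
        (fun w => hBU p k m (tstat w) ^+ 2 * sqnorm w.1) by measurability.
    have mhm' : measurable_fun [set: p.-tuple R * k.-tuple R]
        (fun w => hm (tstat w) ^+ 2 * sqnorm w.1) by measurability.
    have sq0 (h : R -> R) (w : p.-tuple R * k.-tuple R) :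
        0 <= h (tstat w) ^+ 2 * sqnorm w.1 by rewrite mulr_ge0 ?sqr_ge0 ?sqnorm_ge0.
    (* The square of the minimum is one of the two squares, hence at most their sum. *)
    apply: (@le_lt_trans _ _ (base_risk p k h1 + base_risk p k (hBU p k m))%E); last first.
      exact: lte_add_pinfty.
    rewrite /base_risk -integral_EFinD//.
    apply: le_integral_EFin => //; first exact: measurable_funD.
    move=> w; rewrite /hm; have [_|_] := leP (h1 (tstat w)) (hBU p k m (tstat w)).
      by rewrite lerDl sq0.
    by rewrite lerDr sq0.
  + by move=> h fin; apply: improves_dominates => //; exact: finite_base_risk fin.
  + move=> hstar mstar Hstar h fin dis.
    have hE t : h t = if t \in Sub then hstar t else h1 t.
      by rewrite /h !indicE in_setC; case: (t \in Sub); rewrite /= ?mulr0 ?mulr1 ?add0r ?addr0.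
    have mh : measurable_fun [set: R] h.
      apply: measurable_funD; first by apply: measurable_funM => //; apply: measurable_indic; exact: measurableC.
      rewrite (_ : (fun _ => _) = hstar \_ Sub).
        by apply/measurable_restrict => //; rewrite setTI.
      apply/funext => t; rewrite patchE indicE.
      by case: (t \in Sub); rewrite /= ?mulr1 ?mulr0.
    apply: improves_dominates => //.
    (* The lower bound on [hstar] says that its average with h1 is at least [hBU]. *)
    * move=> t t0; rewrite hE; case: ifPn => [/set_mem St|_]; last by split => //; left.
      have /andP[lo hi] := Hstar _ St; split => //; right; lra.
    * exact: finite_base_risk fin.
    * exact: distinct_tstat dis.
(* Agreement of h1 and [hBU] along T would give Lebesgue almost everywhere agreement on t >= 0,
   against [ne]. *)
- move=> h1 mh1 H ne; apply: improves_dominates => //.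
    by move=> t t0; have := H t (ltW t0); split => //; right; lra.
  move=> /(ae_tstat_eq p_ge1 k_ge1 mh1 mB) neg; apply: ne.
  apply: negligibleS neg => t /= /not_implyP[t0 e].
  by split.
Qed.
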